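(* The reconstruction operator $\Pi_h=\Pi_h^s\times\Pi_h^d: V^s\times V^d\to\Upsilon_h=\Upsilon_h^s\times\Upsilon_h^d$ has the property $$\Pi_h: V_h(0)\to\Upsilon_h\cap\Upsilon,$$ i.e. $\Pi_h\boldsymbol v_h\in\Upsilon_h\cap\Upsilon$ for every $\boldsymbol v_h\in V_h(0)$, where $$\Upsilon=\big\{\boldsymbol\psi\in H(\mathrm{div};\Omega):\ \nabla\cdot\boldsymbol\psi=0,\ (\boldsymbol\psi^s\cdot\boldsymbol n^s)|_{\Gamma^s}=0,\ (\boldsymbol\psi^d\cdot\boldsymbol n^d)|_{\Gamma^d}=0,\ (\boldsymbol\psi^s\cdot\boldsymbol n^s+\boldsymbol\psi^d\cdot\boldsymbol n^d)|_\Gamma=0\big\}.$$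
   Context: **Domains.** $\Omega^s,\Omega^d\subset\mathbb R^N$ ($N=2,3$) are bounded simply connected domains with interface $\Gamma=\partial\Omega^s\cap\partial\Omega^d$; $\Gamma^i=\partial\Omega^i\setminus\Gamma$ for $i=s,d$; interfaces and boundaries are polygonal/polyhedral; $\Omega=\Omega^s\cup\Omega^d$. $\boldsymbol n^i$ is the outward unit normal of $\Omega^i$ ($\boldsymbol n^s=-\boldsymbol n^d$ on $\Gamma$). A function on $\Omega$ is written as a pair $(\cdot^s,\cdot^d)$ of its restrictions. $(\cdot,\cdot)_E$ and $\langle\cdot,\cdot\rangle_e$, $\langle\cdot,\cdot\rangle_\Gamma$ are $L^2$ inner products; subscript $i=s,d$ means $E=\Omega^i$. $L_0^2(E)$ denotes the $L^2(E)$ functions with zero integral over $E$. **Spaces.** $V^s=\{\boldsymbol v\in[H^1(\Omega^s)]^N:\boldsymbol v=0\text{ on }\Gamma^s\}$, $V^d=\{\boldsymbol v\in H(\mathrm{div};\Omega^d):\boldsymbol v\cdot\boldsymbol n^d=0\text{ on }\Gamma^d\}$, and $b(\boldsymbol v,q)=-(\nabla\cdot\boldsymbol v^s,q)_s-(\nabla\cdot\boldsymbol v^d,q)_d$. $\mathcal T_h$ is a conforming, shape-regular simplicial triangulation matching at $\Gamma$. Fix $k\ge2$. $V_h^s\subset V^s$ is the space of continuous piecewise $P_k$ velocities enriched by suitable bubble functions, and $Q_h^s\subset L_0^2(\Omega^s)$ the space of (discontinuous) piecewise polynomials of degree $k-1$ with vanishing integral over $\Omega^s$ (the Linke–Matthies–Tobiska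 choice); this pair is LBB-stable and satisfies a discrete Korn inequality. $V_h^d\subset V^d$ is the Raviart–Thomas space $RT_{k-1}$ with vanishing normal component on $\Gamma^d$, and $Q_h^d\subset L_0^2(\Omega^d)$ is the analogous pressure space on $\Omega^d$; it is taken as known for these choices that $\nabla\cdot V_h^d=Q_h^d$. $Q_h=Q_h^s\times Q_h^d$ (so its elements have vanishing integral over $\Omega$). $\Lambda_h=\{\lambda_h\in L^2(\Gamma):\lambda_h|_e\in P_{k-1}(e)\text{ for every mesh face }e\subset\Gamma\}$. $$V_h=\{\boldsymbol v_h\in V_h^s\times V_h^d:\langle\boldsymbol v_h^s\cdot\boldsymbol n^s+\boldsymbol v_h^d\cdot\boldsymbol n^d,\lambda_h\rangle_\Gamma=0\ \forall\lambda_h\in\Lambda_h\},\quad V_h(0)=\{\boldsymbol v_h\in V_h:b(\boldsymbol v_h,\phi_h)=0\ \forall\phi_h\in Q_h\}.$$ The pair $V_h\times Q_h$ is inf-sup stable. **Reconstruction operator.** For $i=s,d$, $\Upsilon_h^i=\{\boldsymbol v\in H(\mathrm{div};\Omega^i):\boldsymbol v|_T\in RT_{k-1}(T)\ \forall T\subset\Omega^i,\ \boldsymbol v\cdot\boldsymbol n=0\text{ on }\Gamma^i\}$ with $RT_{k-1}(T)=[P_{k-1}(T)]^N+\boldsymbol xP_{k-1}(T)$ (so $\Upsilon_h^d=V_h^d$). The operator $\Pi_h^i:V^i\to\Upsilon_h^i$ is defined on each $T\subset\Omega^i$ by $(\Pi_h^i\boldsymbol v-\boldsymbol v,\boldsymbol\psi_h)_T=0$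 for all $\boldsymbol\psi_h\in[P_{k-2}(T)]^N$ and $\langle(\Pi_h^i\boldsymbol v-\boldsymbol v)\cdot\boldsymbol n,q_h\rangle_e=0$ for all $q_h\in P_{k-1}(e)$ and all faces $e\subset\partial T$.
   Formalization: The zero-mean condition on Q_h^d is dropped, as it contradicts ∇·V_h^d = Q_h^d when Γ contains a mesh face; the latter is kept. Face moments of Π_h^d are imposed only on cells where the normal trace is in L^2, and Ω includes the open interface. *)

(* Defs.v *)
From HB Require Import structures.
From mathcomp Require Import all_boot all_order all_algebra.
From mathcomp Require Import all_classical all_reals all_analysis.
Set Implicit Arguments.
Unset Strict Implicit.
Unset Printing Implicit Defensive.
Import Order.TTheory GRing.Theory Num.Theory numFieldNormedType.Exports.
Local Open Scope classical_set_scope.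
Local Open Scope ring_scope.

(* Standing conventions: MathComp-Analysis; points of R^N are row vectors, with
   N = n.+1; a function on the two-domain configuration is a pair (v^s, v^d);
   L^2 functions are represented by total functions, only their values on the
   domain at hand being used. *)

(* Product (= Borel) sigma-algebra on R^n, as the library does for tuples. *)
Section measurable_rV.
Context {R : realType} {n : nat}.

Let coord (i : 'I_n) (x : 'rV[R]_n) : measurableTypeR R := x ord0 i.

Let rV_set0 : g_sigma_preimage coord set0.
Proof. exact: sigma_algebra0. Qed.

Let rV_setC A : g_sigma_preimage coord A -> g_sigma_preimage coord (~` A).
Proof. exact: sigma_algebraC. Qed.

Let rV_bigcup (F : _^nat) : (forall i, g_sigma_preimage coord (F i)) ->
  g_sigma_preimage coord (\bigcup_i (F i)).
Proof. exact: sigma_algebra_bigcup. Qed.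

HB.instance Definition _ := @isMeasurable.Build default_measure_display
  'rV[R]_n (g_sigma_preimage coord) rV_set0 rV_setC rV_bigcup.

End measurable_rV.

(* n-dimensional Lebesgue measure, as an iterated product measure. *)
Section lebesgue_rV.
Context {R : realType}.

Definition rV_cons n (p : measurableTypeR R * 'rV[R]_n) : 'rV[R]_n.+1 :=
  \row_i oapp (p.2 ord0) p.1 (unlift ord0 i).

Lemma measurable_coord n (i : 'I_n) :
  measurable_fun [set: 'rV[R]_n] (fun x : 'rV[R]_n => x ord0 i : measurableTypeR R).
Proof.
move=> _ Y mY; rewrite setTI; apply: sub_sigma_algebra => /=.
rewrite -bigcup_seq/=; exists i => /=; first by rewrite mem_index_enum.
by exists Y => //; rewrite setTI.
Qed.

Lemma measurable_fun_rVP d (T : measurableType d) n (f : T -> 'rV[R]_n) :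
  (forall i, measurable_fun setT (fun x => f x ord0 i : measurableTypeR R)) ->
  measurable_fun setT f.
Proof.
move=> mf; pose coord (i : 'I_n) (x : 'rV[R]_n) : measurableTypeR R := x ord0 i.
apply: (@measurability _ _ _ _ _ _ (\big[setU/set0]_(i < n)
  preimage_set_system setT (coord i) measurable)) => //.
move=> _ [B + <-]; rewrite -bigcup_seq/= => -[i _ [C mC <-]].
by rewrite setTI; exact: mf.
Qed.

Lemma measurable_rV_cons n : measurable_fun setT (@rV_cons n).
Proof.
apply: measurable_fun_rVP => i; under eq_fun do rewrite mxE.
case: unliftP => [j _|_] /=.
  exact: (measurableT_comp (measurable_coord j) measurable_snd).
exact: measurable_fst.
Qed.

Let rV_uncons n (x : 'rV[R]_n.+1) : measurableTypeR R * 'rV[R]_n :=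
  (x ord0 ord0, \row_j x ord0 (lift ord0 j)).

Let measurable_rV_uncons n : measurable_fun setT (@rV_uncons n).
Proof.
apply: measurable_fun_pair; first exact: measurable_coord.
apply: measurable_fun_rVP => i; under eq_fun do rewrite mxE.
exact: measurable_coord.
Qed.

Let rV_consK n : cancel (@rV_cons n) (@rV_uncons n).
Proof.
move=> [x y]; rewrite /rV_uncons /rV_cons mxE unlift_none/=; congr (_, _).
by apply/rowP => i; rewrite !mxE liftK.
Qed.

Let rV_cons_sigma_finite n (mu : {sigma_finite_measure set 'rV[R]_n -> \bar R}) :
  sigma_finite setT (pushforward (lebesgue_measure \x mu)%E (@rV_cons n)).
Proof.
have /sigma_finiteP[F [TF ndF Foo]] := sigma_finiteT
  (lebesgue_measure : {sigma_finite_measure set (measurableTypeR R) -> \bar R}).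
have /sigma_finiteP[G [TG ndG Goo]] := sigma_finiteT mu.
exists (fun k => @rV_uncons n @^-1` (F k `*` G k)).
  rewrite -preimage_bigcup (_ : \bigcup_k _ = setT) ?preimage_setT//.
  rewrite -setXTT TF TG predeqE => -[x y]; split => [[k _ [/= ? ?]]|].
    by split; exists k.
  move=> [/= [k _ Fkx] [l _ Gly]]; exists (maxn k l) => //; split.
  - by move: x Fkx; exact/subsetPset/ndF/leq_maxl.
  - by move: y Gly; exact/subsetPset/ndG/leq_maxr.
move=> k; have [mF Fk] := Foo k; have [mG Gk] := Goo k; split.
  rewrite -[X in measurable X]setTI.
  by apply: measurable_rV_uncons => //; exact: measurableX.
rewrite /pushforward -comp_preimage (_ : _ \o _ = id); last first.
  by apply/funext => p; exact: rV_consK.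
by rewrite preimage_id product_measure1E// lte_mul_pinfty// ge0_fin_numE.
Qed.

Section step.
Variables (n : nat) (mu : {sigma_finite_measure set 'rV[R]_n -> \bar R}).

Definition lebesgue_cons : set 'rV[R]_n.+1 -> \bar R :=
  pushforward (lebesgue_measure \x mu)%E (@rV_cons n).

Let mcons := @measurable_rV_cons n.

Let lebesgue_cons0 : lebesgue_cons set0 = 0%E.
Proof. by rewrite /lebesgue_cons /pushforward preimage_set0 measure0. Qed.

Let lebesgue_cons_ge0 A : (0 <= lebesgue_cons A)%E.
Proof. exact: measure_ge0. Qed.

Let lebesgue_cons_sigma_additive : semi_sigma_additive lebesgue_cons.
Proof. exact: (@measure_semi_sigma_additive _ _ _
  (@measure_function_pushforward__canonical__measure_function_Measure _ _ _ _ _ _ _ mcons)). Qed.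

HB.instance Definition _ := isMeasure.Build _ _ _ lebesgue_cons
  lebesgue_cons0 lebesgue_cons_ge0 lebesgue_cons_sigma_additive.

HB.instance Definition _ := Measure_isSigmaFinite.Build _ _ _ lebesgue_cons
  (rV_cons_sigma_finite mu).

End step.

Fixpoint lebesgue_rV n : {sigma_finite_measure set 'rV[R]_n -> \bar R} :=
  if n is n'.+1 then lebesgue_cons (lebesgue_rV n') else \d_(0 : 'rV[R]_0).
End lebesgue_rV.

Section l2.
Context {R : realType}.

Definition L2 m (D : set 'rV[R]_m) (f : 'rV[R]_m -> R) : Prop :=
  measurable_fun D f /\
  (lebesgue_rV m).-integrable D (fun x => ((f x) ^+ 2)%:E).

End l2.

Section calculus.
Context {R : realType} {n : nat}.
Local Notation point := 'rV[R]_n.+1.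
Local Notation mu := (lebesgue_rV n.+1).
Implicit Types (D B U : set point) (u g d phi : point -> R) (v : point -> point).

Definition dot (x y : point) : R := \sum_i x ord0 i * y ord0 i.

Definition enorm (x : point) : R := Num.sqrt (dot x x).

Definition boundary D : set point := closure D `\` interior D.

Definition component v (i : 'I_n.+1) : point -> R := fun x => v x ord0 i.

Definition partial (i : 'I_n.+1) phi (x : point) : R :=
  'D_(delta_mx ord0 i) phi x.

Definition grad phi (x : point) : point := \row_i partial i phi x.

(* Test functions: C^1 on R^N, with compact support contained in U. *)
Definition C1c U phi : Prop :=
  [/\ forall x, differentiable phi x,
      forall i, continuous (partial i phi) &
      exists K, [/\ compact K, K `<=` U & forall x, ~ K x -> phi x = 0]].

Definition weak_partial D u (i : 'I_n.+1) g : Prop :=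
  L2 D g /\ forall phi, C1c D phi ->
    \int[mu]_(x in D) (u x * partial i phi x)
    = - \int[mu]_(x in D) (g x * phi x).

Definition H1 D u : Prop :=
  L2 D u /\ forall i, exists g, weak_partial D u i g.

(* The weak derivatives are unique almost everywhere; a representative is
   chosen (and is 0 when there is none). *)
Definition wpartial D (i : 'I_n.+1) u : point -> R :=
  xget (cst 0) [set g | weak_partial D u i g].

Definition weak_div D v d : Prop :=
  L2 D d /\ forall phi, C1c D phi ->
    \int[mu]_(x in D) dot (v x) (grad phi x)
    = - \int[mu]_(x in D) (d x * phi x).

Definition Hdiv D v : Prop :=
  (forall i, L2 D (component v i)) /\ exists d, weak_div D v d.

Definition wdiv D v : point -> R :=
  xget (cst 0) [set d | weak_div D v d].

(* The normal component of v in H(div; D) is the functional on traces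
     <v . n, phi>_{dD} = (v, grad phi)_D + (div v, phi)_D. *)
Definition normal_pairing D v phi : R :=
  \int[mu]_(x in D) (dot (v x) (grad phi x) + wdiv D v x * phi x).

(* v . n = 0 on the part B of the boundary of D *)
Definition no_flux D B v : Prop :=
  forall phi, C1c (~` (boundary D `\` B)) phi -> normal_pairing D v phi = 0.

(* u = 0 on B, for u in H^1(D): for every i, the normal component u n_i of
   the field u e_i vanishes on B. *)
Definition vanishes_on D B u : Prop :=
  forall i, no_flux D B (fun x => u x *: delta_mx ord0 i).

(* every loop in A is contractible in A *)
Definition simply_connected (A : set point) : Prop :=
  forall c : R -> point, {within `[0, 1], continuous c} ->
    (forall t, t \in `[0, 1] -> A (c t)) -> c 0 = c 1 ->
  exists H : R * R -> point,
    [/\ {within `[0, 1] `*` `[0, 1], continuous H},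
        forall s t, s \in `[0, 1] -> t \in `[0, 1] -> A (H (s, t)),
        forall t, t \in `[0, 1] -> H (0, t) = c t /\ H (1, t) = c 0 &
        forall s, s \in `[0, 1] -> H (s, 0) = c 0 /\ H (s, 1) = c 0].

(* The last clause excludes slits: a polyhedral domain lies on one side of
   each of its boundary faces. *)
Definition domain D : Prop :=
  [/\ open D /\ D !=set0, bounded_set D, connected D, simply_connected D &
      interior (closure D) = D].

End calculus.

Section polynomials.
Context {R : realType} {n : nat}.
Local Notation point := 'rV[R]_n.+1.

(* polynomials of total degree at most d *)
Definition Pk (d : nat) : set (point -> R) :=
  [set p | exists c : {ffun 'I_n.+1 -> 'I_d.+1} -> R, forall x : point,
     p x = \sum_(a : {ffun 'I_n.+1 -> 'I_d.+1} | (\sum_i a i <= d)%N)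
             c a * \prod_i x ord0 i ^+ a i].

Definition vPk (d : nat) : set (point -> point) :=
  [set v | forall i, Pk d (component v i)].

Definition RT (d : nat) : set (point -> point) :=
  [set v | exists a q, [/\ vPk d a, Pk d q & forall x, v x = a x + q x *: x]].

End polynomials.

(* A simplex of dimension m in R^N is the matrix of its m.+1 vertices. *)
Section simplices.
Context {R : realType} {n : nat}.
Local Notation point := 'rV[R]_n.+1.
Local Notation cell := 'M[R]_(n.+2, n.+1).

Definition edges m (S : 'M[R]_(m.+1, n.+1)) : 'M[R]_(m, n.+1) :=
  \matrix_(i < m) (row (lift ord0 i) S - row ord0 S).

Definition hull m (S : 'M[R]_(m, n.+1)) (A : {set 'I_m}) : set point :=
  [set x | exists t : 'rV[R]_m,
     [/\ forall i, 0 <= t ord0 i, forall i, i \notin A -> t ord0 i = 0,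
         \sum_i t ord0 i = 1 & x = t *m S]].

Definition simplex m (S : 'M[R]_(m, n.+1)) : set point := hull S [set: 'I_m].

Definition reference m : set 'rV[R]_m :=
  [set t | (forall i, 0 < t ord0 i) /\ \sum_i t ord0 i < 1].
Arguments reference : clear implicits.

Definition chart m (S : 'M[R]_(m.+1, n.+1)) (t : 'rV[R]_m) : point :=
  row ord0 S + t *m edges S.

(* relative interior of the simplex *)
Definition osimplex m (S : 'M[R]_(m.+1, n.+1)) : set point :=
  [set chart S t | t in reference m].

(* Integral with respect to the m-dimensional surface measure: the density
   of the affine chart is the square root of its Gram determinant. *)
Definition sint m (S : 'M[R]_(m.+1, n.+1)) (f : point -> R) : R :=
  Num.sqrt (\det (edges S *m (edges S)^T)) *
  \int[lebesgue_rV m]_(t in reference m) f (chart S t).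

(* the face opposite to the j-th vertex *)
Definition face (T : cell) (j : 'I_n.+2) : 'M[R]_(n.+1, n.+1) := row' j T.

(* g j is the L^2 normal trace (outward from T) of v on the j-th face of T *)
Definition normal_trace (T : cell) (v : point -> point)
    (g : 'I_n.+2 -> point -> R) : Prop :=
  [/\ Hdiv (osimplex T) v,
      forall j, L2 (reference n) (g j \o chart (face T j)) &
      forall phi, C1c setT phi ->
        normal_pairing (osimplex T) v phi
        = \sum_j sint (face T j) (fun x => g j x * phi x)].

Definition conforming (s : seq cell) : Prop :=
  uniq s /\ forall T T', T \in s -> T' \in s -> T != T' ->
    osimplex T `&` osimplex T' = set0 /\
    exists A A', simplex T `&` simplex T' = hull T A /\ hull T A = hull T' A'.

(* h_T <= sigma * rho_T, with rho_T the diameter of an inscribed ball *)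
Definition shape_regular (sigma : R) (T : cell) : Prop :=
  exists c r, [/\ 0 < r, (forall x, enorm (x - c) <= r -> simplex T x) &
    forall x y, simplex T x -> simplex T y -> enorm (x - y) <= sigma * (2 * r)].

Definition covers (s : seq cell) (D : set point) : Prop :=
  closure D = [set x | exists2 T, T \in s & simplex T x].

(* conforming on the union, hence matching at the interface *)
Definition triangulation (sigma : R) (Os Od : set point) (Ts Td : seq cell) :=
  [/\ forall T, T \in Ts ++ Td -> edges T \in unitmx /\ shape_regular sigma T,
      conforming (Ts ++ Td), covers Ts Os & covers Td Od].

(* piecewise in S; nothing is prescribed on the skeleton, a null set *)
Definition broken Y (s : seq cell) (S : set (point -> Y)) : set (point -> Y) :=
  [set f | forall T, T \in s ->
     exists2 p, S p & forall x, osimplex T x -> f x = p x].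

End simplices.

Section spaces.
Context {R : realType} {n : nat}.
Local Notation point := 'rV[R]_n.+1.
Local Notation cell := 'M[R]_(n.+2, n.+1).
Local Notation scalar := (point -> R).
Local Notation field := (point -> point).
Local Notation mu := (lebesgue_rV n.+1).
Variables (Os Od : set point) (Ts Td : seq cell) (k : nat).

Definition Gamma : set point := boundary Os `&` boundary Od.
Definition outer (D : set point) : set point := boundary D `\` Gamma.

(* The domain of the coupled problem contains the interface: the interior of
   the closure of the union. *)
Definition Omega : set point := interior (closure (Os `|` Od)).

Definition paste (v : field * field) : field :=
  fun x => if x \in Os then v.1 x else if x \in Od then v.2 x else 0.

Definition Vs : set field :=
  [set v | forall j, H1 Os (component v j) /\ vanishes_on Os (outer Os) (component v j)].

Definition Vd : set field := [set v | Hdiv Od v /\ no_flux Od (outer Od) v].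

Definition b_form (v : field * field) (q : scalar * scalar) : R :=
  - (\int[mu]_(x in Os) (wdiv Os v.1 x * q.1 x))
  - (\int[mu]_(x in Od) (wdiv Od v.2 x * q.2 x)).

(* continuous piecewise P_k velocities enriched by the span of the given
   bubble functions *)
Definition Vhs m (bubble : 'I_m -> field) : set field :=
  [set v | Vs v /\ exists p (c : 'I_m -> R),
    [/\ Vs p, {within closure Os, continuous p}, broken Ts (vPk k) p &
        forall x, v x = p x + \sum_i c i *: bubble i x]].

Definition Qhs : set scalar :=
  [set q | [/\ L2 Os q, broken Ts (Pk k.-1) q & \int[mu]_(x in Os) q x = 0]].

Definition Upsh1 (D : set point) (s : seq cell) : set field :=
  [set v | [/\ Hdiv D v, broken s (RT k.-1) v & no_flux D (outer D) v]].

Definition Vhd : set field := Upsh1 Od Td.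

Definition Upsh : set (field * field) := Upsh1 Os Ts `*` Upsh1 Od Td.

Definition in_Gamma (T : cell) (j : 'I_n.+2) : bool :=
  `[< simplex (face T j) `<=` Gamma >].

Definition Lambdah : set scalar :=
  [set l | forall T j, T \in Ts ++ Td -> in_Gamma T j ->
     exists2 p, Pk k.-1 p & forall x, osimplex (face T j) x -> l x = p x].

Definition pairing_Gamma (s : seq cell) (g : cell -> 'I_n.+2 -> scalar)
    (l : scalar) : R :=
  \sum_(T <- s) \sum_(j | in_Gamma T j)
    sint (face T j) (fun x => g T j x * l x).

(* <v^s . n^s + v^d . n^d, l>_Gamma = 0 for every l in Lambda_h; as L^2
   pairings these involve the L^2 normal traces gs, gd of v^s and v^d *)
Definition weakly_coupled (v : field * field) : Prop :=
  exists gs gd,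
    [/\ forall T, T \in Ts -> normal_trace T v.1 (gs T),
        forall T, T \in Td -> normal_trace T v.2 (gd T) &
        forall l, Lambdah l -> pairing_Gamma Ts gs l + pairing_Gamma Td gd l = 0].

Definition Vh m (bubble : 'I_m -> field) : set (field * field) :=
  [set v | [/\ Vhs bubble v.1, Vhd v.2 & weakly_coupled v]].

Definition Qh (Qhd : set scalar) : set (scalar * scalar) := Qhs `*` Qhd.

Definition Vh0 m (bubble : 'I_m -> field) (Qhd : set scalar) :
    set (field * field) :=
  [set v | Vh bubble v /\ forall q, Qh Qhd q -> b_form v q = 0].

(* div V_h^d = Q_h^d, as sets of classes of functions on Od. As fields of V_h^d
   may have a flux through Gamma, their divergences need not have zero mean;
   Q_h^d is therefore not required to lie in L^2_0(Od). *)
Definition div_onto (Qhd : set scalar) : Prop :=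
  (forall v, Vhd v -> exists2 q, Qhd q & weak_div Od v q) /\
  (forall q, Qhd q -> exists2 v, Vhd v & weak_div Od v q).

Definition Upsilon : set (field * field) :=
  [set psi |
    [/\ Hdiv Omega (paste psi), weak_div Omega (paste psi) (cst 0),
        no_flux Os (outer Os) psi.1, no_flux Od (outer Od) psi.2 &
        forall phi, C1c (~` (outer Os `|` outer Od)) phi ->
          normal_pairing Os psi.1 phi + normal_pairing Od psi.2 phi = 0]].

(* P is the operator Pi_h^i on V. The face moments are L^2(e) products, so
   they are imposed where the normal trace of P v - v is in L^2; this is always
   so for v in H^1, and for piecewise polynomials. *)
Definition reconstruction (D : set point) (s : seq cell) (V : set field)
    (P : field -> field) : Prop :=
  forall v, V v -> Upsh1 D s (P v) /\ forall T, T \in s ->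
    (forall psi, vPk (k - 2) psi ->
       \int[mu]_(x in osimplex T) dot (P v x - v x) (psi x) = 0) /\
    (forall g, normal_trace T (fun x => P v x - v x) g ->
       forall j q, Pk k.-1 q -> sint (face T j) (fun x => g j x * q x) = 0).

Definition norm0 (D : set point) (q : scalar) : R :=
  Num.sqrt (\int[mu]_(x in D) (q x) ^+ 2).

Definition norm0v (D : set point) (v : field) : R :=
  Num.sqrt (\sum_i norm0 D (component v i) ^+ 2).

Definition norm1 (D : set point) (v : field) : R :=
  Num.sqrt (norm0v D v ^+ 2 +
            \sum_i \sum_j norm0 D (wpartial D i (component v j)) ^+ 2).

Definition normdiv (D : set point) (v : field) : R :=
  Num.sqrt (norm0v D v ^+ 2 + norm0 D (wdiv D v) ^+ 2).

Definition inf_sup X Y (beta : R) (V : set X) (Q : set Y) (a : X -> Y -> R)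
    (nV : X -> R) (nQ : Y -> R) : Prop :=
  forall q, Q q -> ((beta * nQ q)%:E <=
    ereal_sup [set (a v q / nV v)%:E | v in [set v | V v /\ nV v != 0%R]])%E.

Definition LBB (beta : R) m (bubble : 'I_m -> field) : Prop :=
  inf_sup beta (Vhs bubble) Qhs
    (fun v q => \int[mu]_(x in Os) (wdiv Os v x * q x)) (norm1 Os) (norm0 Os).

Definition Korn (kappa : R) m (bubble : 'I_m -> field) : Prop :=
  forall v, Vhs bubble v ->
    kappa * \sum_i \sum_j norm0 Os (wpartial Os i (component v j)) ^+ 2 <=
    \sum_i \sum_j norm0 Os (fun x =>
      (wpartial Os i (component v j) x + wpartial Os j (component v i) x) / 2) ^+ 2.

Definition coupled_inf_sup (beta : R) m (bubble : 'I_m -> field)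
    (Qhd : set scalar) : Prop :=
  inf_sup beta (Vh bubble) (Qh Qhd) b_form
    (fun v => Num.sqrt (norm1 Os v.1 ^+ 2 + normdiv Od v.2 ^+ 2))
    (fun q => Num.sqrt (norm0 Os q.1 ^+ 2 + norm0 Od q.2 ^+ 2)).

End spaces.

(* Main.v *)
(* Write w = (w^s, w^d) for the reconstruction of v. On each cell w is a
   Raviart-Thomas field, so its normal traces on the faces are polynomials of
   degree k - 1, and for every test function phi the sum
     <w^s . n^s, phi> + <w^d . n^d, phi>
   is a sum over the facets of the mesh of integrals of (jump of w . n) phi.
   The jump vanishes on a facet off the interface because of H(div) conformity
   and of the boundary condition (localise phi at a point of the facet), and on
   a facet of the interface because the face moments of w and v agree and the
   jump itself is an admissible multiplier in Lambda_h. Hence the sum is 0 for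
   every phi.
   The moments also give (div w, q) = (div v, q) for piecewise polynomials q of
   degree k - 1. With div V_h^d = Q_h^d this makes div w^d vanish; taking phi = 1
   near the two domains, div w^s then has zero mean, so it lies in Q_h^s and
   b(v, .) = 0 makes it vanish as well. With both divergences zero, the balance
   of fluxes says that the pasted field is weakly divergence free on Omega. *)
Require Import Defs.
From mathcomp Require Import all_boot all_order all_algebra.
From mathcomp Require Import all_classical all_reals all_analysis.
From mathcomp Require Import perm measurable_realfun ring lra.
Set Implicit Arguments.
Unset Strict Implicit.
Unset Printing Implicit Defensive.
Import Order.TTheory GRing.Theory Num.Theory numFieldNormedType.Exports.
Local Open Scope classical_set_scope.
Local Open Scope ring_scope.

(** * Borel sets and Lebesgue measure on row vectors *)

(** Both [normal_trace] and [wdiv] are characterised by integral identities only, and [wdiv] is a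
    chosen representative, so pointwise arguments have to pass through explicit polynomials. On a
    cell these come from a Green formula for Raviart-Thomas fields, obtained without outward
    normals: the field is expanded along the edges issuing from vertex 0, and each edge derivative
    is integrated by the fundamental theorem of calculus in reference coordinates. The change of
    variables rests on uniqueness of Haar measure with an unspecified factor, later fixed by testing
    with the constant 1. Chosen divergences are compared with polynomial ones by the du Bois-Reymond
    lemma. The geometric obstacle is that the two cells at a facet may list its vertices in
    different orders. Conformity shows that the two facets are equal as sets; their charts then
    differ by an affine automorphism of the reference simplex, which preserves integrals. Jumps and
    divergences are shown to vanish by pairing them with themselves; this is where the common degree
    k - 1 of normal traces, multipliers and pressures enters. *)

Section borel_rV.
Context {R : realType}.
Local Notation mu n := (@lebesgue_rV R n).

Lemma ball_rVP n (x y : 'rV[R]_n) (e : R) :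
  ball x e y <-> 0 < e /\ forall i, `|x ord0 i - y ord0 i| < e.
Proof.
split=> [[e0 H]|[e0 H]]; split => //; first by move=> i; exact: H.
by move=> i j; rewrite ord1; exact: H.
Qed.

(** Balls with rational centres and radii are countably many, here enumerated by [unpickle]; a ball
    whose double leaves [U] gets radius 0 and is thus empty. The room between [r k] and [r k *+ 2]
    later lets a bump function on the small ball have compact support in [U]. *)
Lemma open_rV_bigcup_ball n (U : set 'rV[R]_n) : open U ->
  exists c : nat -> 'rV[R]_n, exists r : nat -> R,
    (forall k, ball (c k) (r k *+ 2) `<=` U) /\ U = \bigcup_k ball (c k) (r k).
Proof.
move=> oU.
pose p k : 'rV[rat]_n * rat := odflt (0, 0) (unpickle k).
pose c k : 'rV[R]_n := map_mx ratr (p k).1.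
pose r k : R := if `[< ball (c k) (ratr (p k).2 *+ 2) `<=` U >] then ratr (p k).2 else 0.
have sub k : ball (c k) (r k *+ 2) `<=` U.
  by rewrite /r; case: asboolP => // _ x /ball_rVP[]; rewrite mul0rn ltxx.
exists c, r; split; first exact: sub.
apply/seteqP; split; last first.
  move=> x [k _ /[dup] /ball_rVP[rk _] h]; apply: (sub k).
  by apply: le_ball h; rewrite mulr2n lerDl ltW.
move=> x Ux; have /nbhs_ballP[e /= e0 eU] := open_nbhs_nbhs (conj oU Ux).
(* A point within 2q of a centre that is itself within q of [x] is within 3q < [e] of [x]. *)
have [q] : exists q : rat, ratr q \in `]0, (e / 3)[.
  by apply: rat_in_itvoo; rewrite divr_gt0.
rewrite in_itv /= => /andP[q0 qe].
have H i : exists s : rat, `|x ord0 i - ratr s| < ratr q.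
  have [s] : exists s : rat, ratr s \in `](x ord0 i - ratr q), (x ord0 i + ratr q)[.
    by apply: rat_in_itvoo; rewrite ltrD2l -subr_gt0 opprK addr_gt0.
  by rewrite in_itv /= => sq; exists s; rewrite distrC ltr_distl.
have [s hs] := choice H.
pose k := pickle ((\row_i s i : 'rV[rat]_n), q).
have pk : p k = ((\row_i s i : 'rV[rat]_n), q) by rewrite /p /k pickleK.
have ck i : c k ord0 i = ratr (s i) by rewrite /c pk /= !mxE.
have rk : r k = ratr q.
  rewrite /r pk /=; case: asboolP => // -[] y /ball_rVP[_ yc].
  apply: eU; apply/ball_rVP; split => // i.
  have := hs i; have := yc i; rewrite ck => h1 h2.
  rewrite (_ : x ord0 i - y ord0 i = (x ord0 i - ratr (s i)) + (ratr (s i) - y ord0 i)); last by ring.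
  by rewrite (le_lt_trans (ler_normD _ _))//; rewrite mulr2n in h1; move: qe h2; lra.
exists k => //; apply/ball_rVP; rewrite rk; split => // i.
by rewrite ck distrC.
Qed.

Lemma measurable_ball_rV n (x : 'rV[R]_n) (e : R) : measurable (ball x e).
Proof.
have [e0|e0] := ltP 0 e; last first.
  rewrite (_ : ball x e = set0) //; apply/seteqP; split => // y /ball_rVP[].
  by rewrite ltNge e0.
rewrite (_ : ball x e = \bigcap_(i in [set: 'I_n])
  ((fun y : 'rV[R]_n => y ord0 i : measurableTypeR R) @^-1` ball (x ord0 i) e)); last first.
  apply/seteqP; split => y; first by move=> /ball_rVP[_ h] i _; exact: h.
  by move=> h; apply/ball_rVP; split => // i; exact: h.
apply: fin_bigcap_measurable => // i _.
rewrite -[X in measurable X]setTI; apply: measurable_coord => //.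
exact: measurable_ball.
Qed.

Lemma open_measurable_rV n (U : set 'rV[R]_n) : open U -> measurable U.
Proof.
move=> /open_rV_bigcup_ball[c [r [_ ->]]].
by apply: bigcup_measurable => k _; exact: measurable_ball_rV.
Qed.

Lemma continuous_measurable_rV n (f : 'rV[R]_n -> R) :
  continuous f -> measurable_fun setT f.
Proof.
move=> /continuousP cf.
apply: (measurability _ (RGenOpens.measurableE R)) => _ [_ [a [b ->]] <-].
by rewrite setTI; apply: open_measurable_rV; apply: cf; exact: interval_open.
Qed.

Lemma lebesgue_rV_measurableX n (A : set ('rV[R]_n.+1)) : measurable A ->
  measurable ((@rV_cons R n) @^-1` A).
Proof.
by move=> mA; rewrite -[X in measurable X]setTI; exact: measurable_rV_cons.
Qed.

Lemma lebesgue_rVS n (A : set ('rV[R]_n.+1)) :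
  mu n.+1 A = (lebesgue_measure \x mu n)%E ((@rV_cons R n) @^-1` A).
Proof. by []. Qed.

(** The norm on row vectors is the sup norm, so a ball is a cube of side [e *+ 2]; in dimension 0 it
    is a single point of Dirac mass 1. *)
Lemma lebesgue_rV_ball n (x : 'rV[R]_n) (e : R) : 0 < e ->
  mu n (ball x e) = ((e *+ 2) ^+ n)%:E.
Proof.
move=> e0; elim: n x => [|n IH] x.
  rewrite /= diracE mem_set ?expr0//; apply/ball_rVP; split => //.
  by case.
rewrite lebesgue_rVS.
rewrite (_ : _ @^-1` _ = ball (x ord0 ord0) e `*` ball (\row_j x ord0 (lift ord0 j)) e).
  rewrite product_measure1E; [|exact: measurable_ball|exact: measurable_ball_rV].
  rewrite IH [X in (X * _)%E](_ : _ = (e *+ 2)%:E) -?EFinM ?exprS//.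
  exact: (lebesgue_measure_ball _ (ltW e0)).
apply/seteqP; split => -[s y] /=.
  move=> /ball_rVP[_ h]; split.
    by have := h ord0; rewrite mxE unlift_none.
  by apply/ball_rVP; split => // i; have := h (lift ord0 i); rewrite !mxE liftK.
move=> [h0 /ball_rVP[_ h]]; apply/ball_rVP; split => // i; rewrite mxE.
by case: unliftP => [j ->|->] //=; have := h j; rewrite !mxE.
Qed.

Lemma bounded_sub_ball n (A : set 'rV[R]_n) : bounded_set A ->
  exists2 e : R, 0 < e & A `<=` ball 0 e.
Proof.
move=> [M [_ AM]]; exists (`|M| + 2); first by rewrite ltr_wpDl.
move=> x Ax; rewrite -ball_normE /= sub0r normrN.
apply: le_lt_trans (AM (`|M| + 1) _ x Ax) _; last by rewrite ltrD2l ltr1n.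
by rewrite (le_lt_trans (ler_norm _))// ltrDl.
Qed.

Lemma lebesgue_rV_bounded n (A : set 'rV[R]_n) : measurable A -> bounded_set A ->
  (mu n A < +oo)%E.
Proof.
move=> mA /bounded_sub_ball[e e0 Ae].
apply: (le_lt_trans (le_measure (mu n) _ _ Ae)); rewrite ?inE//.
  exact: measurable_ball_rV.
by rewrite [ltLHS]lebesgue_rV_ball// ltry.
Qed.

Lemma lebesgue_rV_open_gt0 n (A : set 'rV[R]_n) : open A -> A !=set0 -> (0 < mu n A)%E.
Proof.
move=> oA [x Ax]; have /nbhs_ballP[e /= e0 eA] := open_nbhs_nbhs (conj oA Ax).
apply: (@lt_le_trans _ _ (mu n (ball x e))).
  by rewrite lebesgue_rV_ball// lte_fin exprn_gt0// mulrn_wgt0.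
by apply: le_measure => //; rewrite inE; [exact: measurable_ball_rV|exact: open_measurable_rV].
Qed.

Lemma lebesgue_measure_shift (a : R) (A : set (measurableTypeR R)) : measurable A ->
  lebesgue_measure ((fun x : measurableTypeR R => x + a) @^-1` A) = lebesgue_measure A.
Proof.
move=> mA.
have ms : measurable_fun setT (fun x : measurableTypeR R => (x + a : measurableTypeR R)).
  by apply: measurable_funD => //; exact: measurable_id.
pose nu := @measure_function_pushforward__canonical__measure_function_Measure
   _ _ _ _ R (@lebesgue_measure R) _ ms.
apply/esym; apply: (@lebesgue_measure_unique R nu) => // X [[b c] /= _ <-].
rewrite /nu/= /pushforward (_ : _ @^-1` _ = `](b - a), (c - a)]%classic).
  rewrite !lebesgue_measure_itv /= !lte_fin ltrD2r.
  by case: ifP => // _; rewrite -!EFinD; congr (_%:E); ring.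
by apply/seteqP; split => x /=; rewrite !in_itv /= ltrBlDr lerBrDr.
Qed.

Lemma measurable_shift_rV n (a : 'rV[R]_n) : measurable_fun setT (fun x : 'rV[R]_n => x + a).
Proof.
apply: measurable_fun_rVP => i; under eq_fun do rewrite mxE.
by apply: measurable_funD; [exact: measurable_coord|exact: measurable_cst].
Qed.

Lemma lebesgue_rV_shift n (a : 'rV[R]_n) (A : set 'rV[R]_n) : measurable A ->
  mu n ((fun x => x + a) @^-1` A) = mu n A.
Proof.
elim: n a A => [|n IH] a A mA.
  by congr (mu 0 _); rewrite [a]thinmx0; apply/seteqP; split => x /=; rewrite addr0.
have mA' := lebesgue_rV_measurableX mA.
rewrite !lebesgue_rVS /product_measure1 /=.
pose a' := \row_j a ord0 (lift ord0 j).
pose h (x : measurableTypeR R) := mu n (xsection ((@rV_cons R n) @^-1` A) x).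
transitivity (\int[lebesgue_measure]_(x in [set: measurableTypeR R]) h (x + a ord0 ord0)%R)%E.
  apply: eq_integral => x _.
  rewrite /h/= -(IH a' (xsection _ (x + a ord0 ord0)%R)); last exact: measurable_xsection.
  congr (mu n _); apply/seteqP; split => y /=; rewrite /xsection/= !inE /=;
    rewrite (_ : rV_cons (x, y) + a = rV_cons ((x + a ord0 ord0)%R, y + a'))//;
     by apply/rowP => i; rewrite !mxE; case: unliftP => [j ->|->] //=; rewrite !mxE.
have ms : measurable_fun setT (fun x : measurableTypeR R => (x + a ord0 ord0 : measurableTypeR R)).
  by apply: measurable_funD => //; exact: measurable_id.
have := @ge0_integral_pushforward _ _ _ _ R _ ms (@lebesgue_measure R) setT h.
rewrite preimage_setT => <-//; last first.
- exact: measurable_fun_xsection.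
pose nu := @measure_function_pushforward__canonical__measure_function_Measure
   _ _ _ _ R (@lebesgue_measure R) _ ms.
apply: (@eq_measure_integral _ _ _ _ lebesgue_measure nu) => B mB _.
exact: lebesgue_measure_shift.
Qed.

Lemma measurable_mulmxD n (M : 'M[R]_n) :
  measurable_fun setT (fun p : 'rV[R]_n * 'rV[R]_n => p.2 *m M + p.1).
Proof.
apply: measurable_fun_rVP => i; under eq_fun do rewrite !mxE.
apply: measurable_funD; last first.
  exact: (measurableT_comp (measurable_coord i) measurable_fst).
apply: measurable_sum => j; apply: measurable_funM; last exact: measurable_cst.
exact: (measurableT_comp (measurable_coord j) measurable_snd).
Qed.

Lemma fubini_sections n m (E : set ('rV[R]_n * 'rV[R]_m)) : measurable E ->
  (\int[mu n]_(x in setT) mu m (xsection E x) =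
   \int[mu m]_(y in setT) mu n (ysection E y))%E.
Proof.
move=> mE; have := indic_fubini_tonelli (mu n) (mu m) mE.
by rewrite (indic_fubini_tonelli_FE _ mE) (indic_fubini_tonelli_GE (mu n) mE).
Qed.

(* Uniqueness of Haar measure: both sides are the volume of
   [{(x, y) | x \in A, y M + x \in B}], up to a shear. *)
Lemma lebesgue_rV_mulmx_swap n (M : 'M[R]_n) (A B : set 'rV[R]_n) : M \in unitmx ->
  measurable A -> (forall x, A x -> A (- x)) -> measurable B ->
  (mu n (mulmxr M @^-1` B) * mu n A = mu n (mulmxr M @^-1` A) * mu n B)%E.
Proof.
move=> uM mA symA mB.
have mL C : measurable C -> measurable (mulmxr M @^-1` C : set 'rV[R]_n).
  move=> mC; rewrite -[X in measurable X]setTI.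
  have mm : measurable_fun setT (mulmxr M : 'rV[R]_n -> 'rV[R]_n).
    apply: measurable_fun_rVP => i; under eq_fun do rewrite /= !mxE.
    apply: measurable_sum => j; apply: measurable_funM; last exact: measurable_cst.
    exact: measurable_coord.
  exact: mm.
(* The section of [E] at a point of [A] is a translate of the preimage of [B], and that of [E'] at a
   point of [B] is a translate of the preimage of [A], by symmetry of [A]. For fixed [y] the
   sections of [E] and [E'] are translates of each other by [y *m M]. *)
pose E := [set p : 'rV[R]_n * 'rV[R]_n | A p.1 /\ B (p.2 *m M + p.1)].
pose E' := [set p : 'rV[R]_n * 'rV[R]_n | A (p.1 - p.2 *m M) /\ B p.1].
have mE : measurable E.
  apply: measurableI; rewrite -[X in measurable X]setTI.
    exact: measurable_fst.
  exact: (@measurable_mulmxD n M).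
have mE' : measurable E'.
  rewrite (_ : E' = (fun p : 'rV[R]_n * 'rV[R]_n => p.2 *m (- M) + p.1) @^-1` A `&`
     fst @^-1` B); last first.
    by apply/seteqP; split => x /=; rewrite /E'/= mulmxN addrC.
  apply: measurableI; rewrite -[X in measurable X]setTI; last exact: measurable_fst.
  exact: (@measurable_mulmxD n (- M)).
have hF : (\int[mu n]_(x in setT) mu n (xsection E x) =
           mu n (mulmxr M @^-1` B) * mu n A)%E.
  rewrite -[in RHS](setIT A) -integral_indic// -ge0_integralZl//; last exact/measurable_EFinP/measurable_indic.
  apply: eq_integral => x _; rewrite indicE.
  have [xA|xA] := boolP (x \in A); last first.
    rewrite mule0 (_ : xsection E x = set0) ?measure0//.
    by apply/seteqP; split => y //; rewrite /xsection/= inE => -[/mem_set]; rewrite (negbTE xA).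
  rewrite mule1 -(lebesgue_rV_shift (x *m invmx M) (mL _ mB)).
  congr (mu n _); apply/seteqP; split => y /=; rewrite /xsection/= inE /E/= mulmxDl mulmxKV//.
    by case.
  by move=> ?; split => //; exact/set_mem.
have hG : (\int[mu n]_(x in setT) mu n (xsection E' x) =
           mu n (mulmxr M @^-1` A) * mu n B)%E.
  rewrite -[in RHS](setIT B) -integral_indic// -ge0_integralZl//; last exact/measurable_EFinP/measurable_indic.
  apply: eq_integral => x _; rewrite indicE.
  have [xA|xA] := boolP (x \in B); last first.
    rewrite mule0 (_ : xsection E' x = set0) ?measure0//.
    by apply/seteqP; split => y //; rewrite /xsection/= inE => -[_ /mem_set]; rewrite (negbTE xA).
  rewrite mule1 -(lebesgue_rV_shift (- (x *m invmx M)) (mL _ mA)).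
  congr (mu n _); apply/seteqP; split => y /=; rewrite /xsection/= inE /E'/= mulmxDl mulNmx mulmxKV//.
    by move=> [/symA]; rewrite opprB.
  by move=> /symA; rewrite opprB => ?; split => //; exact/set_mem.
rewrite -hF -hG !fubini_sections//; apply: eq_integral => y _.
rewrite -(lebesgue_rV_shift (y *m M) (measurable_ysection y mE')).
by congr (mu n _); apply/seteqP; split => x /=; rewrite /ysection/= !inE /E/E'/= addrK addrC.
Qed.

(** The swap identity with a fixed cube for [A] makes the ratio of volumes independent of [B]. The
    factor is 1 / |det M|, but it stays an anonymous constant here. *)
Lemma lebesgue_rV_affine n (a : 'rV[R]_n) (M : 'M[R]_n) : M \in unitmx ->
  exists c : {nonneg R}, forall B, measurable B ->
    mu n ((fun x => a + x *m M) @^-1` B) = (c%:num%:E * mu n B)%E.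
Proof.
move=> uM; pose A : set 'rV[R]_n := ball 0 1.
have mA : measurable A by exact: measurable_ball_rV.
have symA x : A x -> A (- x).
  by move=> /ball_rVP[_ h]; apply/ball_rVP; split => // i; have := h i; rewrite !mxE !sub0r !normrN.
have muA : mu n A = ((1 *+ 2) ^+ n)%:E by rewrite lebesgue_rV_ball.
have ml : measurable (mulmxr M @^-1` A : set 'rV[R]_n).
  rewrite -[X in measurable X]setTI.
  have mm : measurable_fun setT (mulmxr M : 'rV[R]_n -> 'rV[R]_n).
    apply: measurable_fun_rVP => i; under eq_fun do rewrite /= !mxE.
    apply: measurable_sum => j; apply: measurable_funM; last exact: measurable_cst.
    exact: measurable_coord.
  exact: mm.
have fin : mu n (mulmxr M @^-1` A) \is a fin_num.
  rewrite ge0_fin_numE//; apply: lebesgue_rV_bounded => //.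
  exists (n%:R * `|invmx M|); split; first exact: num_real.
  move=> r hr x /= Ax; apply/ltW/(le_lt_trans _ hr).
  rewrite -[x](mulmxK uM).
  have h1 i : `|(x *m M) ord0 i| <= 1 by move/ball_rVP : Ax => [_ /(_ i)]; rewrite mxE sub0r normrN => /ltW.
  rewrite {1}/Num.norm /= mx_normrE; apply/bigmax_leP; split => /=.
    by rewrite mulr_ge0.
  move=> [i0 i] _; rewrite [i0]ord1 mxE (le_trans (ler_norm_sum _ _ _))//=.
  rewrite mulr_natl -[X in _ *+ X]card_ord -sumr_const ler_sum// => j _.
  rewrite normrM -[leRHS]mul1r ler_pM//.
  by rewrite [leRHS]/Num.norm /= mx_normrE; apply/bigmax_geP; right => /=; exists (j, i).
have c0 : 0 <= fine (mu n (mulmxr M @^-1` A)) / (1 *+ 2) ^+ n.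
  by rewrite divr_ge0// ?fine_ge0// exprn_ge0.
exists (NngNum c0) => B mB /=.
transitivity (mu n (mulmxr M @^-1` ((fun x => x + a) @^-1` B))).
  by congr (mu n _); apply/seteqP; split => x /=; rewrite addrC.
have mB' : measurable ((fun x => x + a) @^-1` B).
  by rewrite -[X in measurable X]setTI; exact: measurable_shift_rV.
have := lebesgue_rV_mulmx_swap uM mA symA mB'.
rewrite muA lebesgue_rV_shift// -(fineK fin) => H.
by rewrite EFinM muleAC -H -muleA -EFinM divff ?mule1// expf_neq0// pnatr_eq0.
Qed.

(** One constant serves all domains and integrands; this uniformity allows it to be computed later
    from the integrand 1. A signed integrand is split into its positive and negative parts, both of
    finite integral. *)
Lemma integral_affine n (a : 'rV[R]_n) (M : 'M[R]_n) : M \in unitmx ->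
  exists2 c : R, 0 <= c & forall (D : set 'rV[R]_n) (f : 'rV[R]_n -> R),
    measurable D -> measurable_fun setT f ->
    (mu n).-integrable ((fun x => a + x *m M) @^-1` D) (EFin \o f \o (fun x => a + x *m M)) ->
    (mu n).-integrable D (EFin \o f) ->
    \int[mu n]_(x in (fun x => a + x *m M) @^-1` D) f (a + x *m M)
    = c * \int[mu n]_(x in D) f x.
Proof.
move=> uM; have [c hc] := lebesgue_rV_affine a uM; exists c%:num => // D f mD mf If1 If2.
have mm : measurable_fun setT (fun x : 'rV[R]_n => a + x *m M).
  apply: measurable_fun_rVP => i; under eq_fun do rewrite /= !mxE.
  apply: measurable_funD; first exact: measurable_cst.
  apply: measurable_sum => j; apply: measurable_funM; last exact: measurable_cst.
  exact: measurable_coord.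
have mfE : measurable_fun setT (EFin \o f) by exact/measurable_EFinP.
rewrite /Rintegral.
transitivity (fine (\int[pushforward (mu n) (fun x => a + x *m M)]_(x in D) (f x)%:E)).
  congr fine; apply/esym.
  exact: (@integral_pushforward _ _ _ _ R _ mm (mu n) D (EFin \o f)).
pose nu := @measure_function_pushforward__canonical__measure_function_Measure
   _ _ _ _ R (mu n) _ mm.
transitivity (fine (\int[mscale c (mu n)]_(x in D) (f x)%:E)).
  congr fine; apply: (@eq_measure_integral _ _ _ _ (mscale c (mu n)) nu) => B mB _.
  exact: hc.
have mfD : measurable_fun D (EFin \o f) by exact: measurable_funTS.
rewrite [X in fine X = _]integralE [X in _ = _ * fine X]integralE.
rewrite (@ge0_integral_mscale _ _ R (mu n) _ mD c _ (measurable_funepos mfD))//.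
rewrite (@ge0_integral_mscale _ _ R (mu n) _ mD c _ (measurable_funeneg mfD))//.
have Ip := integral_funepos_lt_pinfty mD If2; have In := integral_funeneg_lt_pinfty mD If2.
have p0 : (0 <= \int[mu n]_(x in D) (EFin \o f)^\+ x)%E by exact: integral_ge0.
have n0 : (0 <= \int[mu n]_(x in D) (EFin \o f)^\- x)%E by exact: integral_ge0.
have := ge0_fin_numE p0; have := ge0_fin_numE n0; rewrite Ip In => /fineK <- /fineK <-.
by rewrite -!EFinM -!EFinB /= mulrBr.
Qed.

End borel_rV.

(** * C^1 functions and cutoffs *)

Section C1_functions.
Context {R : realType} {n : nat}.
Local Notation point := 'rV[R]_n.+1.
Local Notation mu := (@lebesgue_rV R n.+1).
Implicit Types (f g phi : point -> R).

Definition C1 phi := (forall x, differentiable phi x) /\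
  forall i, continuous (partial i phi).

Lemma C1_differentiable phi x : C1 phi -> differentiable phi x.
Proof. by case. Qed.

Lemma C1_continuous phi : C1 phi -> continuous phi.
Proof. by move=> [d _] x; exact: differentiable_continuous. Qed.

Lemma partialE i phi x : differentiable phi x ->
  partial i phi x = 'd phi x (delta_mx ord0 i).
Proof. by move=> d; rewrite /partial deriveE. Qed.

Lemma derive_partial (v : point) phi x : differentiable phi x ->
  'D_v phi x = \sum_i v ord0 i * partial i phi x.
Proof.
move=> d; rewrite deriveE// {1}[v]row_sum_delta linear_sum.
by apply: eq_bigr => i _; rewrite linearZ partialE.
Qed.

Lemma partialD i f g x : differentiable f x -> differentiable g x ->
  partial i (fun y => f y + g y) x = partial i f x + partial i g x.
Proof. by move=> df dg; apply: deriveD; exact: diff_derivable. Qed.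

Lemma partialM i f g x : differentiable f x -> differentiable g x ->
  partial i (fun y => f y * g y) x = f x * partial i g x + g x * partial i f x.
Proof. by move=> df dg; apply: deriveM; exact: diff_derivable. Qed.

Lemma partial_cst i c x : partial i (fun _ : point => c) x = 0.
Proof. exact: derive_cst. Qed.

Lemma partial_coord i j x : partial i (fun y : point => y ord0 j) x = (i == j)%:R.
Proof.
have @l : {linear point -> R}.
  by exists (fun N : point => N ord0 j); do 2![eexists]; do ?[constructor];
     rewrite ?mxE// => ? *; rewrite ?mxE//; move=> ?; rewrite !mxE.
rewrite partialE; last exact: differentiable_coord.
rewrite (_ : (fun y : point => y ord0 j) = l)// diff_lin; last exact: coord_continuous.
by rewrite /= mxE eqxx /= eq_sym.
Qed.

Lemma partialV i f x : f x != 0 -> differentiable f x ->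
  partial i (fun y => (f y)^-1) x = - (f x) ^- 2 * partial i f x.
Proof. by move=> f0 df; apply: deriveV => //; exact: diff_derivable. Qed.

Lemma partial_comp i (h : R -> R) f x : derivable h (f x) 1 -> differentiable f x ->
  partial i (h \o f) x = h^`()%classic (f x) * partial i f x.
Proof.
move=> dh df; have dh' : differentiable h (f x) by apply/derivable1_diffP.
rewrite !partialE//; last exact: differentiable_comp.
by rewrite diff_comp//= diff1E// mulrC.
Qed.

Lemma continuous_fD (T : topologicalType) (f g : T -> R) : continuous f -> continuous g ->
  continuous (fun x => f x + g x).
Proof. by move=> cf cg x; exact: cvgD (cf x) (cg x). Qed.

Lemma continuous_fM (T : topologicalType) (f g : T -> R) : continuous f -> continuous g ->
  continuous (fun x => f x * g x).
Proof. by move=> cf cg x; exact: cvgM (cf x) (cg x). Qed.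

Lemma C1_cst c : C1 (fun=> c).
Proof.
split=> [x|i]; first exact: differentiable_cst.
by rewrite (_ : partial i _ = cst 0); [exact: cst_continuous|apply/funext => x; exact: partial_cst].
Qed.

Lemma C1_coord j : C1 (fun x => x ord0 j).
Proof.
split=> [x|i]; first exact: differentiable_coord.
by rewrite (_ : partial i _ = cst (i == j)%:R); [exact: cst_continuous|apply/funext => x; exact: partial_coord].
Qed.

Lemma C1D f g : C1 f -> C1 g -> C1 (fun x => f x + g x).
Proof.
move=> [df cf] [dg cg]; split=> [x|i]; first exact: differentiableD.
rewrite (_ : partial i _ = fun x => partial i f x + partial i g x).
  exact: continuous_fD.
by apply/funext => x; rewrite partialD.
Qed.

Lemma C1M f g : C1 f -> C1 g -> C1 (fun x => f x * g x).
Proof.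
move=> [df cf] [dg cg]; split=> [x|i]; first exact: differentiableM.
rewrite (_ : partial i _ = fun x => f x * partial i g x + g x * partial i f x).
  by apply: continuous_fD; apply: continuous_fM => // x; exact: differentiable_continuous.
by apply/funext => x; rewrite partialM.
Qed.

Lemma C1N f : C1 f -> C1 (fun x => - f x).
Proof.
move=> cf; rewrite (_ : (fun x => _) = (fun x => -1 * f x)).
  by apply: C1M => //; exact: C1_cst.
by apply/funext => x; rewrite mulN1r.
Qed.

Lemma C1V f : C1 f -> (forall x, f x != 0) -> C1 (fun x => (f x)^-1).
Proof.
move=> [df cf] f0; split=> [x|i]; first exact: differentiableV.
rewrite (_ : partial i _ = fun x => -1 * ((f x)^-1 * ((f x)^-1 * partial i f x))).
  have cV : continuous (fun x => (f x)^-1).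
    by move=> x; apply: differentiable_continuous; exact: differentiableV.
  by apply: continuous_fM; [exact: cst_continuous|do 2 apply: continuous_fM => //].
by apply/funext => x; rewrite partialV// mulrA -invfM -expr2 mulN1r mulNr.
Qed.

Lemma C1_comp (h : R -> R) f : (forall x, derivable h x 1) -> continuous h^`()%classic ->
  C1 f -> C1 (h \o f).
Proof.
move=> dh ch [df cf]; split=> [x|i].
  by apply: differentiable_comp => //; apply/derivable1_diffP.
rewrite (_ : partial i _ = fun x => h^`()%classic (f x) * partial i f x).
  apply: continuous_fM => // x.
  by apply: continuous_comp; [exact: differentiable_continuous|exact: ch].
by apply/funext => x; rewrite partial_comp.
Qed.

Lemma C1_sum I (r : seq I) (P : pred I) (F : I -> point -> R) :
  (forall i, P i -> C1 (F i)) -> C1 (fun x => \sum_(i <- r | P i) F i x).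
Proof.
move=> h; elim: r => [|i r IH].
  by under eq_fun do rewrite big_nil; exact: C1_cst.
under eq_fun do rewrite big_cons; have := h i; case: (P i) => // /(_ isT) Fi.
exact: C1D.
Qed.

Lemma C1_prod I (r : seq I) (P : pred I) (F : I -> point -> R) :
  (forall i, P i -> C1 (F i)) -> C1 (fun x => \prod_(i <- r | P i) F i x).
Proof.
move=> h; elim: r => [|i r IH].
  by under eq_fun do rewrite big_nil; exact: C1_cst.
under eq_fun do rewrite big_cons; have := h i; case: (P i) => // /(_ isT) Fi.
exact: C1M.
Qed.

Lemma partial_sum I (r : seq I) (P : pred I) (F : I -> point -> R) i x :
  (forall k, P k -> differentiable (F k) x) ->
  partial i (fun x => \sum_(k <- r | P k) F k x) x = \sum_(k <- r | P k) partial i (F k) x.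
Proof.
move=> h; suff [] : differentiable (fun x => \sum_(k <- r | P k) F k x) x /\
  partial i (fun x => \sum_(k <- r | P k) F k x) x = \sum_(k <- r | P k) partial i (F k) x by [].
elim: r => [|k r [IH1 IH2]].
  by under eq_fun do rewrite big_nil; rewrite big_nil partial_cst; split => //; exact: differentiable_cst.
under eq_fun do rewrite big_cons; rewrite big_cons; have := h k; case: (P k) => // /(_ isT) Fi.
by split; [exact: differentiableD|rewrite partialD// IH2].
Qed.

Lemma C1cE (U : set point) phi : C1c U phi <-> C1 phi /\
  exists K, [/\ compact K, K `<=` U & forall x, ~ K x -> phi x = 0].
Proof. by split => [[]|[[]]]. Qed.

Lemma C1c_C1 (U : set point) phi : C1c U phi -> C1 phi.
Proof. by case/C1cE. Qed.

Lemma C1c_sub (U V : set point) phi : U `<=` V -> C1c U phi -> C1c V phi.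
Proof.
move=> UV /C1cE[h [K [cK KU K0]]]; apply/C1cE; split => //; exists K; split => //.
exact: subset_trans UV.
Qed.

Lemma C1c_mull (U : set point) f phi : C1 f -> C1c U phi -> C1c U (fun x => f x * phi x).
Proof.
move=> cf /C1cE[h [K [cK KU K0]]]; apply/C1cE; split; first exact: C1M.
by exists K; split => // x /K0 ->; rewrite mulr0.
Qed.

Lemma rV_compact_closed (K : set point) : compact K -> closed K.
Proof. by apply: compact_closed; exact: norm_hausdorff. Qed.

(** The support set is closed, so [phi] vanishes in a whole neighbourhood of each point outside it,
    and so do its derivatives. *)
Lemma C1c_out (U : set point) phi : C1c U phi -> 
  exists K, [/\ compact K, closed K, K `<=` U, forall x, ~ K x -> phi x = 0 &
   forall x i, ~ K x -> partial i phi x = 0].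
Proof.
move=> /C1cE[h [K [cK KU K0]]]; have clK := rV_compact_closed cK.
exists K; split => // x i Kx; rewrite -(partial_cst i 0 x).
apply: near_eq_derive.
have /open_nbhs_nbhs : open_nbhs x (~` K) by split => //; rewrite openC.
by apply: filterS => y; exact: K0.
Qed.

Lemma compact_bounded_rV (K : set point) : compact K -> bounded_set K.
Proof. exact: compact_bounded. Qed.

(** Squaring the positive part makes it of class C^1, the regularity asked of test functions. *)
Definition pos2 (s : R) : R := Num.max s 0 ^+ 2.

Lemma is_derive_pos2 s : is_derive (s : R) 1 pos2 (2 * Num.max s 0).
Proof.
(* The quadratic remainder bound holds for all signs of [s] and [s + t], so the difference quotient
   with step [h] is within |h| of its limit. *)
have key t : `|pos2 (s + t) - pos2 s - 2 * Num.max s 0 * t| <= t ^+ 2.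
  rewrite /pos2 ler_norml; apply/andP.
  by case: (leP s 0) => hs; case: (leP (s + t) 0) => ht; split; nra.
have H : h^-1 *: (pos2 (h *: 1 + s) - pos2 s) @[h --> 0^'] --> 2 * Num.max s 0.
  apply/cvgrPdist_le => e e0; near=> h.
  have h0 : h != 0 by near: h; exact: nbhs_dnbhs_neq.
  have he : `|h| <= e by near: h; apply: dnbhs0_le.
  rewrite distrC -(ler_pM2r (_ : 0 < `|h|)) ?normr_gt0// -normrM.
  rewrite mulrBl [X in X - _]mulrC mulrA mulfV// mul1r.
  rewrite [_%:A]mulr1 (addrC h) (le_trans (key h))//.
  by rewrite -real_normK ?num_real// expr2 ler_wpM2r.
apply: DeriveDef; first by apply/cvg_ex; eexists; exact: H.
exact/cvg_lim/H.
Unshelve. all: by end_near. Qed.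

Lemma derivable_pos2 s : derivable pos2 s 1.
Proof. by have := is_derive_pos2 s => -[]. Qed.

Lemma continuous_derive_pos2 : continuous pos2^`()%classic.
Proof.
rewrite (_ : pos2^`()%classic = fun s => 2 * Num.max s 0).
  apply: continuous_fM => s; first exact: cst_continuous.
  by apply: (@continuous_max _ R id (fun=> 0)); [exact: cvg_id|exact: cst_continuous].
by apply/funext => s; rewrite derive1E; have := is_derive_pos2 s => -[].
Qed.

Lemma C1_pos2 f : C1 f -> C1 (fun x => pos2 (f x)).
Proof. exact: (C1_comp derivable_pos2 continuous_derive_pos2). Qed.

Lemma pos2_ge0 s : 0 <= pos2 s. Proof. exact: sqr_ge0. Qed.

Lemma pos2_gt0 s : (0 < pos2 s) = (0 < s).
Proof.
rewrite /pos2; case: (leP s 0) => hs; first by rewrite expr0n/= ltxx.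
by rewrite exprn_gt0.
Qed.

Lemma pos2_eq0 s : s <= 0 -> pos2 s = 0.
Proof. by rewrite /pos2 => /max_idPr ->; rewrite expr0n. Qed.

(** A product over the coordinates because balls of the sup norm are cubes; for [0 < r] it is
    positive exactly on [ball c r]. *)
Definition bump (c : point) (r : R) (x : point) : R :=
  \prod_i pos2 (r ^+ 2 - (x ord0 i - c ord0 i) ^+ 2).

Lemma C1_bump c r : C1 (bump c r).
Proof.
apply: C1_prod => i _; apply: C1_pos2; apply: C1D; first exact: C1_cst.
apply: C1N; rewrite (_ : (fun x => _) = (fun x : point => (x ord0 i - c ord0 i) * (x ord0 i - c ord0 i))); last first.
  by apply/funext => x; rewrite expr2.
by apply: C1M; apply: C1D; (exact: C1_coord || exact: C1_cst).
Qed.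

Lemma bump_ge0 c r x : 0 <= bump c r x.
Proof. by apply: prodr_ge0 => i _; exact: pos2_ge0. Qed.

Lemma bump_gt0 c r x : 0 < r -> 0 < bump c r x <-> ball c r x.
Proof.
move=> r0; have E i : (0 < pos2 (r ^+ 2 - (x ord0 i - c ord0 i) ^+ 2)) = (`|c ord0 i - x ord0 i| < r).
  rewrite pos2_gt0 subr_gt0 distrC -[in LHS]real_normK ?num_real//.
  by rewrite ltr_pXn2r// nnegrE// ltW.
split=> [h|/ball_rVP[_ h]]; last by apply: prodr_gt0 => i _; rewrite E.
apply/ball_rVP; split => // i; rewrite -E lt_def pos2_ge0 andbT.
by apply: contraTneq h => h; rewrite /bump (bigD1 i)//= h mul0r ltxx.
Qed.

Lemma sub_bounded (A B : set point) : A `<=` B -> bounded_set B -> bounded_set A.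
Proof.
by move=> AB [M [Mr BM]]; exists M; split => // e /BM h x /AB; exact: h.
Qed.

Lemma bounded_ball_rV (c : point) r : bounded_set (ball c r).
Proof.
exists (`|c| + r); split; first exact: num_real.
move=> M hM x; rewrite -ball_normE /= => h; apply/ltW/(le_lt_trans _ hM).
by rewrite -[x](subrK c) (le_trans (ler_normD _ _))// addrC lerD2l -normrN opprB ltW.
Qed.

Lemma C1c_bump c r (U : set point) : ball c (r *+ 2) `<=` U -> 0 < r -> C1c U (bump c r).
Proof.
move=> cU r0; apply/C1cE; split; first exact: C1_bump.
exists (closed_ball c r); split.
- apply: bounded_closed_compact; last exact: closed_ball_closed.
  by apply: sub_bounded (bounded_ball_rV c (r *+ 2)); apply: closed_ball_subset => //; rewrite mulr2n ltrDl.
- by apply: subset_trans cU; apply: closed_ball_subset => //; rewrite mulr2n ltrDl.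
- move=> x; apply: contra_notP => /eqP b0; apply: subset_closed_ball.
  by apply/bump_gt0 => //; rewrite lt_def b0 bump_ge0.
Qed.

(** The quotient [a / (a + b)] is 1 where [b] vanishes and 0 where [a] does; [a] is positive for
    [rho < r *+ 2] and [b] for [rho > r], so the denominator never vanishes. The factor [n.+1] in
    [r] puts the cube of half-side [e] inside the Euclidean ball [rho <= r]. *)
Lemma cutoff_exists (e : R) : 0 < e -> exists2 chi : point -> R, C1c setT chi &
  forall x, ball 0 e x -> chi x = 1 /\ forall i, partial i chi x = 0.
Proof.
move=> e0; pose r : R := n.+1%:R * e ^+ 2.
have r0 : 0 < r by rewrite mulr_gt0// exprn_gt0.
pose rho (x : point) := \sum_i x ord0 i * x ord0 i.
have Crho : C1 rho by apply: C1_sum => i _; apply: C1M; exact: C1_coord.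
pose a x := pos2 (r *+ 2 + - rho x); pose b x := pos2 (rho x + - r).
have Ca : C1 a by apply: C1_pos2; apply: C1D; [exact: C1_cst|exact: C1N].
have Cb : C1 b by apply: C1_pos2; apply: C1D; [|exact: C1_cst].
have ab x : 0 < a x + b x.
  have [h|h] := ltP (rho x) (r *+ 2).
    by rewrite ltr_wpDr ?pos2_ge0// pos2_gt0 subr_gt0.
  by rewrite ltr_wpDl ?pos2_ge0// pos2_gt0 subr_gt0 (lt_le_trans _ h)// mulr2n ltrDl.
pose chi x := a x * (a x + b x)^-1.
have C1chi : C1 chi.
  by apply: C1M => //; apply: C1V; [exact: C1D|move=> x; rewrite gt_eqF].
have chi1 x : ball 0 e x -> chi x = 1.
  move=> /ball_rVP[_ h]; rewrite /chi /b pos2_eq0 ?addr0 ?divff//.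
    by have := ab x; rewrite /b pos2_eq0 ?addr0 => [/gt_eqF->//|];
    rewrite subr_le0 /rho /r mulr_natl -[X in _ *+ X]card_ord -sumr_const ler_sum// => i _;
    have := h i; rewrite mxE sub0r normrN -expr2 -real_normK ?num_real// => ?; rewrite ler_pXn2r// ?nnegrE// ltW.
  rewrite subr_le0 /rho /r mulr_natl -[X in _ *+ X]card_ord -sumr_const ler_sum// => i _.
  by have := h i; rewrite mxE sub0r normrN -expr2 -real_normK ?num_real// => ?; rewrite ler_pXn2r// ?nnegrE// ltW.
exists chi.
  apply/C1cE; split => //; exists [set x | rho x <= r *+ 2]; split => //.
    apply: bounded_closed_compact.
      exists (1 + r *+ 2); split; first exact: num_real.
      move=> M hM x /= xr; apply/ltW/(le_lt_trans _ hM).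
      rewrite {1}/Num.norm /= mx_normrE; apply/bigmax_leP; split => /=.
        by rewrite addr_ge0// mulrn_wge0// ltW.
      move=> [i0 i] _; rewrite [i0]ord1 /=.
      have : x ord0 i * x ord0 i <= r *+ 2.
        rewrite (le_trans _ xr)// /rho (bigD1 i)//= lerDl sumr_ge0// => k _.
        by rewrite -expr2 sqr_ge0.
      by rewrite -expr2 -real_normK ?num_real//; have := normr_ge0 (x ord0 i); nra.
    apply: (@closed_comp _ _ rho [set y | y <= r *+ 2]).
      by move=> x _; exact: C1_continuous.
    exact: closed_le.
  by move=> x /= /negP; rewrite -ltNge => h; rewrite /chi /a pos2_eq0 ?mul0r// subr_le0 ltW.
move=> x xe; split; first exact: chi1.
move=> i; rewrite -(partial_cst i 1 x); apply: near_eq_derive.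
have /open_nbhs_nbhs : open_nbhs x (ball (0 : point) e) by split => //; exact: ball_open.
by apply: filterS => y; exact: chi1.
Qed.

End C1_functions.

(** * L^2 functions and the du Bois-Reymond lemma *)

Section L2_facts.
Context {R : realType} {n : nat}.
Local Notation point := 'rV[R]_n.
Local Notation mu := (@lebesgue_rV R n).
Implicit Types (D : set point) (f g : point -> R).

Lemma continuous_bounded_rV D f : continuous f -> bounded_set D ->
  exists M : R, forall x, D x -> `|f x| <= M.
Proof.
move=> cf /bounded_sub_ball[e e0 De].
have cK : compact (closed_ball (0 : point) e).
  apply: bounded_closed_compact; last exact: closed_ball_closed.
  exists (e *+ 2); split; first exact: num_real.
  move=> M hM x xe; apply/ltW/(le_lt_trans _ hM).
  have : ball (0 : point) (e *+ 2) x.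
    by apply: closed_ball_subset xe => //; rewrite mulr2n ltrDl.
  by rewrite -ball_normE /= sub0r normrN => /ltW.
have cf' : {within closed_ball (0 : point) e, continuous f}.
  exact: continuous_subspaceT.
have /compact_bounded[M [_ hM]] := continuous_compact cf' cK.
exists (`|M| + 1) => x Dx; apply: hM; first by rewrite (le_lt_trans (ler_norm _))// ltrDl.
by exists x => //; apply: subset_closed_ball; exact: De.
Qed.

Lemma continuous_integrable D f : continuous f -> measurable D -> bounded_set D ->
  mu.-integrable D (EFin \o f).
Proof.
move=> cf mD bD; have [M hM] := continuous_bounded_rV cf bD.
apply: measurable_bounded_integrable => //; first exact: lebesgue_rV_bounded.
  by apply: measurable_funTS; exact: continuous_measurable_rV.
by exists M; split; [exact: num_real|move=> e /ltW Me x /hM /le_trans; exact].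
Qed.

Lemma L2_cont D f : continuous f -> measurable D -> bounded_set D -> L2 D f.
Proof.
move=> cf mD bD; split; first by apply: measurable_funTS; exact: continuous_measurable_rV.
apply: (@continuous_integrable D (fun x => f x ^+ 2)) => // x.
rewrite /continuous_at expr2; under eq_fun do rewrite expr2.
exact: cvgM (cf x) (cf x).
Qed.

Lemma L2_integrableM D f g : measurable D -> L2 D f -> L2 D g ->
  mu.-integrable D (fun x => (f x * g x)%:E).
Proof.
move=> mD [mf f2] [mg g2].
apply: (le_integrable mD _ _ (integrableD mD f2 g2)).
  by apply/measurable_EFinP; exact: measurable_funM.
move=> x _ /=; rewrite lee_fin normrM [leRHS]ger0_norm ?addr_ge0 ?sqr_ge0//.
rewrite -(real_normK (num_real (f x))) -(real_normK (num_real (g x))).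
by have := sqr_ge0 (`|f x| - `|g x|); have := normr_ge0 (f x); have := normr_ge0 (g x); nra.
Qed.

Lemma L2_integrable D f : measurable D -> bounded_set D -> L2 D f ->
  mu.-integrable D (EFin \o f).
Proof.
move=> mD bD Lf; have L1 : L2 D (fun=> 1) by apply: L2_cont => //; exact: cst_continuous.
have := L2_integrableM mD Lf L1; apply: eq_integrable => // x _ /=.
by rewrite mulr1.
Qed.

Lemma L2D D f g : measurable D -> L2 D f -> L2 D g -> L2 D (fun x => f x + g x).
Proof.
move=> mD Lf Lg; have [mf f2] := Lf; have [mg g2] := Lg.
split; first exact: measurable_funD.
have fg := L2_integrableM mD Lf Lg.
have := integrableD mD (integrableD mD f2 g2) (integrableZl mD 2 fg).
by apply: eq_integrable => // x _ /=; rewrite -EFinM -!EFinD; congr (_%:E); ring.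
Qed.

Lemma L2Z D c f : measurable D -> L2 D f -> L2 D (fun x => c * f x).
Proof.
move=> mD [mf f2]; split; first by apply: measurable_funM => //; exact: measurable_cst.
have := integrableZl mD (c ^+ 2) f2; apply: eq_integrable => // x _ /=.
by rewrite -EFinM exprMn.
Qed.

Lemma L2B D f g : measurable D -> L2 D f -> L2 D g -> L2 D (fun x => f x - g x).
Proof.
move=> mD Lf Lg; have := L2D mD Lf (L2Z (-1) mD Lg).
by under eq_fun do rewrite mulN1r.
Qed.

Lemma L2_0 D : measurable D -> L2 D (fun=> 0).
Proof.
move=> mD; split; first exact: measurable_cst.
by have := integrable0 mu D; apply: eq_integrable => // x _ /=; rewrite expr0n.
Qed.

Lemma L2_sum D I (r : seq I) (F : I -> point -> R) : measurable D ->
  (forall i, L2 D (F i)) -> L2 D (fun x => \sum_(i <- r) F i x).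
Proof.
move=> mD h; elim: r => [|i r IH].
  by under eq_fun do rewrite big_nil; exact: L2_0.
by under eq_fun do rewrite big_cons; exact: L2D.
Qed.

Lemma L2S D E f : measurable D -> measurable E -> E `<=` D -> L2 D f -> L2 E f.
Proof.
move=> mD mE ED [mf f2]; split; first exact: measurable_funS ED mf.
exact: integrableS f2.
Qed.

Lemma eq_L2 D f g : measurable D -> {in D, f =1 g} -> L2 D f -> L2 D g.
Proof.
move=> mD fg [mf f2]; split; first exact: eq_measurable_fun mf.
by apply: eq_integrable f2 => // x xD /=; rewrite fg.
Qed.

Lemma ae_eq_Rintegral D f g : measurable D -> measurable_fun D f -> measurable_fun D g ->
  {ae mu, forall x, D x -> f x = g x} ->
  \int[mu]_(x in D) f x = \int[mu]_(x in D) g x.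
Proof.
move=> mD mf mg fg; congr fine; apply: ae_eq_integral => //.
- exact/measurable_EFinP.
- exact/measurable_EFinP.
- by apply: filterS fg => x /= h Dx; rewrite h.
Qed.

Lemma L2_sqr_eq0 D f : measurable D -> L2 D f -> \int[mu]_(x in D) (f x * f x) = 0 ->
  {ae mu, forall x, D x -> f x = 0}.
Proof.
move=> mD Lf; have [mf f2] := Lf => h.
have iff := L2_integrableM mD Lf Lf.
have : (\int[mu]_(x in D) `|(f x * f x)%:E| = 0)%E.
  rewrite (eq_integral (fun x => (f x * f x)%:E)); last first.
    by move=> x _; rewrite /= ger0_norm// -expr2 sqr_ge0.
  by rewrite -[LHS]fineK ?integrable_fin_num// [fine _]h.
move/(ae_eq_integral_abs mu mD (measurable_int _ iff)); apply: filterS => x /= H /H [].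
by move/eqP; rewrite mulf_eq0 orbb => /eqP.
Qed.

Lemma Rintegral_bigsetU (I : choiceType) (F : I -> set point) f (s : seq I) :
  (forall i, measurable (F i)) -> uniq s -> trivIset [set` s] F ->
  mu.-integrable (\big[setU/set0]_(i <- s) F i) (EFin \o f) ->
  \int[mu]_(x in \big[setU/set0]_(i <- s) F i) f x = \sum_(i <- s) \int[mu]_(x in F i) f x.
Proof.
move=> mF; elim: s => [|h t IH] us tF.
  by rewrite !big_nil Rintegral_set0.
have mt : measurable (\big[setU/set0]_(i <- t) F i) by exact: bigsetU_measurable.
rewrite !big_cons => fi; have /andP[ht ut] := us.
rewrite Rintegral_setU//; last first.
  rewrite disj_set2E; apply/disj_setPS; rewrite -bigcup_seq setI_bigcupr.
  move=> x [i /= it [hx ix]]; apply/negP : ht; rewrite negbK.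
  have := tF h i; rewrite /= !inE eqxx it orbT => /(_ isT isT) -> //.
  by exists x.
congr (_ + _); apply: IH => //.
  by apply: sub_trivIset tF => i /= it; rewrite inE it orbT.
by apply: integrableS fi => //; exact: measurableU.
Qed.

Lemma Rintegral_diff_null D N f : measurable D -> measurable N -> mu N = 0%E ->
  mu.-integrable D (EFin \o f) ->
  \int[mu]_(x in D `\` N) f x = \int[mu]_(x in D) f x.
Proof. by move=> mD mN N0 fi; rewrite /Rintegral [in RHS](negligible_integral mN). Qed.

End L2_facts.

Section du_Bois_Reymond.
Context {R : realType} {n : nat}.
Local Notation point := 'rV[R]_n.+1.
Local Notation mu := (@lebesgue_rV R n.+1).

(** Dominated convergence with majorant |f|. It serves twice below: for test functions tending to an
    indicator and for increasing unions of sets. *)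
Lemma integral_mul_limit0 (D : set point) (f : point -> R) (g_ : nat -> point -> R)
    (g : point -> R) : measurable D -> mu.-integrable D (EFin \o f) ->
  (forall k, measurable_fun D (g_ k)) -> measurable_fun D g ->
  (forall k x, `|g_ k x| <= 1) -> (forall x, D x -> g_ ^~ x @ \oo --> g x) ->
  (forall k, \int[mu]_(x in D) (f x * g_ k x) = 0) ->
  \int[mu]_(x in D) (f x * g x) = 0.
Proof.
move=> mD fi mg_ mg g1 gg h.
have mf : measurable_fun D f by exact/measurable_EFinP/measurable_int/fi.
have [|||||_ _ H] := @dominated_convergence _ _ R mu D mD (fun k x => (f x * g_ k x)%:E)
  (fun x => (f x * g x)%:E) (fun x => `|(f x)%:E|%E).
- by move=> k; apply/measurable_EFinP; exact: measurable_funM.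
- by apply/measurable_EFinP; exact: measurable_funM.
- apply: aeW => x Dx; apply: cvg_EFin; first by near=> k.
  by apply: cvgM; [exact: cvg_cst|exact: gg].
- exact: integrable_abse.
- apply: aeW => x k Dx /=; rewrite lee_fin normrM.
  by rewrite ler_piMr.
rewrite /Rintegral; have -> // : (\int[mu]_(x in D) (f x * g x)%:E = 0)%E.
apply/esym; apply: cvg_unique H => //.
apply: cvg_near_cst; apply: nearW => k.
have fgi : mu.-integrable D (fun x => (f x * g_ k x)%:E).
  apply: (le_integrable mD _ _ fi); first by apply/measurable_EFinP; exact: measurable_funM.
  by move=> x _ /=; rewrite lee_fin normrM ler_piMr.
by rewrite -[LHS]fineK ?integrable_fin_num// [fine _]h.
Unshelve. all: by end_near. Qed.

Lemma measurable_rV_sub (G : set (set point)) :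
  (forall i a, <<s G>> [set x : point | a < x ord0 i]) ->
  forall A, measurable A -> <<s G>> A.
Proof.
move=> hG; apply: smallest_sub; first exact: smallest_sigma_algebra.
move=> A; rewrite -bigcup_seq/= => -[i _ [B mB <-]]; rewrite setTI.
have mc : measurable_fun setT (fun x : g_sigma_algebraType G => x ord0 i : measurableTypeR R).
  apply: (measurability _ (RGenOInfty.measurableE R)) => _ [_ [a ->] <-].
  rewrite setTI; rewrite (_ : _ @^-1` _ = [set x : point | a < x ord0 i]); first exact: hG.
  by apply/seteqP; split => x /=; rewrite in_itv/= andbT.
by have := mc measurableT _ mB; rewrite setTI.
Qed.

(* The test functions [k psi / (1 + k psi)], with [psi = phi * phi0], converge to
   the indicator of [0 < phi] on the support of [phi0]; the sets [0 < phi] form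
   a pi-system generating the Borel sets. *)
Lemma du_Bois_Reymond_support (D : set point) (f phi0 : point -> R) : measurable D ->
  L2 D f ->
  (forall phi, C1c D phi -> \int[mu]_(x in D) (f x * phi x) = 0) ->
  C1c D phi0 -> (forall x, 0 <= phi0 x) ->
  {ae mu, forall x, 0 < phi0 x -> f x = 0}.
Proof.
move=> mD Lf h0 Cphi0 phi0_ge0.
pose D0 := [set x | 0 < phi0 x].
have [K [cK clK KD K0 _]] := C1c_out Cphi0.
have D0K : D0 `<=` K by move=> x; rewrite /D0/=; apply: contraPP => /K0 ->; rewrite ltxx.
have D0D : D0 `<=` D by exact: subset_trans KD.
have cphi0 := C1_continuous (C1c_C1 Cphi0).
have mpos (phi : point -> R) : continuous phi -> measurable [set x : point | 0 < phi x].
  by move=> /continuousP c; apply: open_measurable_rV; apply: (c [set y | 0 < y]); exact: open_gt.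
have mD0 : measurable D0 by exact: mpos.
have bD0 : bounded_set D0 by apply: sub_bounded D0K _; exact: compact_bounded_rV.
have LD0 : L2 D0 f by exact: L2S Lf.
have fi := L2_integrable mD0 bD0 LD0.
(* [H] is a lambda-system containing the pi-system [G], which generates the Borel sets; hence [f]
   integrates to 0 over every Borel subset of [D0]. *)
pose H := [set A : set point | measurable A /\ \int[mu]_(x in D0) (f x * \1_A x) = 0].
pose G := [set A : set point | exists phi, [/\ C1 phi, forall x, 0 <= phi x &
  A = [set x | 0 < phi x]]].
have int1 A : measurable A -> mu.-integrable D0 (fun x => (f x * \1_A x)%:E).
  move=> mA; have mf := measurable_int _ fi; apply: (le_integrable mD0 _ _ fi).
    apply/measurable_EFinP/measurable_funM; first exact/measurable_EFinP.
    exact: measurable_indic.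
  move=> x _ /=; rewrite lee_fin normrM ler_piMr// indicE.
  by case: (_ \in _); rewrite ?normr1 ?normr0.
have GH : G `<=` H.
  move=> _ [phi [C1phi phi0' ->]]; split; first by apply: mpos; exact: C1_continuous.
  pose psi x := phi x * phi0 x.
  have Cpsi : C1c D psi by exact: C1c_mull.
  have psi_ge0 x : 0 <= psi x by rewrite mulr_ge0.
  have den k x : 0 < 1 + k%:R * psi x by rewrite ltr_pwDl// mulr_ge0.
  pose g_ (k : nat) x := k%:R * (1 + k%:R * psi x)^-1 * psi x.
  have Cg k : C1c D (g_ k).
    apply: C1c_mull => //; apply: C1M; first exact: C1_cst.
    apply: C1V; last by move=> x; rewrite gt_eqF.
    by apply: C1D; [exact: C1_cst|apply: C1M; [exact: C1_cst|exact: C1c_C1 Cpsi]].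
  have gE k x : g_ k x = 1 - (1 + k%:R * psi x)^-1.
    by rewrite /g_; have := den k x; move=> /gt_eqF/negbT ?; field.
  apply: (@integral_mul_limit0 _ _ g_) => //.
  - by move=> k; apply: measurable_funTS; apply: continuous_measurable_rV; exact: C1_continuous (C1c_C1 (Cg k)).
  - by apply: measurable_indic; apply: mpos; exact: C1_continuous.
  - move=> k x; rewrite gE ger0_norm; first by rewrite gerBl invr_ge0 ltW.
    by rewrite subr_ge0 invf_le1// lerDl mulr_ge0.
  - move=> x D0x; rewrite indicE; have [phx|phx] := ltP 0 (phi x).
      rewrite mem_set//=; apply/cvgrPdist_le => e e0.
      have psx : 0 < psi x by rewrite mulr_gt0.
      near=> k; rewrite gE opprB addrCA subrr addr0 ger0_norm; last by rewrite invr_ge0 ltW.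
      rewrite -[leRHS]invrK lef_pV2 ?posrE ?invr_gt0//.
      rewrite (@le_trans _ _ (k%:R * psi x))//; last by rewrite lerDr.
      rewrite -ler_pdivrMr//; near: k; exact: nbhs_infty_ger.
    rewrite memNset/=; last by apply/negP; rewrite -leNgt.
    apply: cvg_near_cst; apply: nearW => k.
    by rewrite /g_ /psi (_ : phi x = 0) ?mul0r ?mulr0//; apply/eqP; rewrite eq_le phx phi0'.
  - move=> k; rewrite -[RHS](h0 _ (Cg k)) [RHS]Rintegral_mkcond [LHS]Rintegral_mkcond.
    apply: eq_Rintegral => x _; rewrite /patch.
    have [xD0|xD0] := boolP (x \in D0); first by rewrite mem_set//; apply: D0D; exact/set_mem.
    case: ifP => // _; rewrite /g_ /psi (_ : phi0 x = 0) ?mulr0//.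
    move: xD0; rewrite notin_setE /D0/= => /negP; rewrite -leNgt => ?.
    by apply/eqP; rewrite eq_le phi0_ge0 andbT.
have GI : setI_closed G.
  move=> _ _ [p [Cp p0 ->]] [q [Cq q0 ->]]; exists (fun x => p x * q x); split.
  - exact: C1M.
  - by move=> x; rewrite mulr_ge0.
  - apply/seteqP; split => x /=; first by move=> [? ?]; rewrite mulr_gt0.
    move=> pq; have : (p x != 0) && (q x != 0) by rewrite -negb_or -mulf_eq0 gt_eqF.
    by rewrite !lt_def !p0 !q0 !andbT => /andP.
have lH : lambda_system setT H.
  split => //.
  - split; first exact: measurableT.
    rewrite (_ : setT = [set x : point | 0 < (1 : R)]); last by apply/seteqP; split => x //= _; exact: ltr01.
    by case: (GH [set x : point | 0 < (1 : R)]) => //; exists (fun=> 1); split => //; exact: C1_cst.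
  - move=> A B BA [mA HA] [mB HB]; split; first exact: measurableD.
    rewrite (_ : (fun x => f x * _) = fun x => f x * \1_A x - f x * \1_B x).
      rewrite RintegralB//; [by rewrite HA HB subrr|exact: int1|exact: int1].
    apply/funext => x; rewrite -mulrBr; congr (_ * _); rewrite !indicE in_setD.
    have [xB|xB] := boolP (x \in B); first by rewrite (mem_set (BA _ (set_mem xB))) subrr.
    by rewrite andbT subr0.
  - move=> F ndF HF; have mF k : measurable (F k) by case: (HF k).
    split; first exact: bigcup_measurable.
    apply: (@integral_mul_limit0 _ _ (fun k => \1_(F k))) => //.
    + by apply: measurable_indic; exact: bigcup_measurable.
    + by move=> k x; rewrite indicE; case: (_ \in _); rewrite ?normr1 ?normr0.
    + move=> x _; have [[k _ Fkx]|nx] := pselect ((\bigcup_k F k) x).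
        apply: cvg_near_cst; near=> m; rewrite !indicE.
        have -> : x \in \bigcup_k F k by rewrite inE; exists k.
        have Fkm : F k `<=` F m by apply/subsetPset/ndF; near: m; exact: nbhs_infty_ge.
        by rewrite mem_set//; exact: Fkm.
      apply: cvg_near_cst; apply: nearW => k; rewrite !indicE (memNset nx) memNset// => Fk.
      by apply: nx; exists k.
    + by move=> k; case: (HF k).
have sG A : measurable A -> H A.
  move=> mA; apply: (lambda_system_subset GI lH GH) => //.
  apply: measurable_rV_sub mA => i a; apply: sub_sigma_algebra.
  (* The half-space [a < x ord0 i] is the positivity set of this C^1 function. *)
  exists (fun x => pos2 (x ord0 i + - a)); split.
  - by apply: C1_pos2; apply: C1D; [exact: C1_coord|exact: C1_cst].
  - by move=> x; exact: pos2_ge0.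
  - by apply/seteqP; split => x /=; rewrite pos2_gt0 subr_gt0.
have := @integral_ae_eq _ _ R mu D0 mD0 (cst 0%E) (EFin \o f) fi (measurable_cst _).
have HE : forall E, E `<=` D0 -> measurable E ->
    (\int[mu]_(x in E) (EFin \o f) x = \int[mu]_(x in E) cst 0 x)%E.
  move=> E ED0 mE; rewrite integral0.
  have [_ HE] := sG _ mE.
  have fiE : mu.-integrable E (EFin \o f) by exact: integrableS fi.
  rewrite -[LHS]fineK ?integrable_fin_num//.
  congr (_%:E); rewrite -[RHS]HE -/(Rintegral mu E f) [LHS]Rintegral_mkcond [RHS]Rintegral_mkcond.
  apply: eq_Rintegral => x _; rewrite /patch indicE.
  have [xE|xE] := boolP (x \in E); last by rewrite mulr0; case: ifP.
  by rewrite mulr1 (mem_set (ED0 _ (set_mem xE))).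
by move/(_ HE); apply: filterS => x /= hx /hx [].
Unshelve. all: by end_near. Qed.

(** One test function controls [f] only where it is positive; countably many bumps cover [D], and
    countably many null sets have a null union. *)
Lemma du_Bois_Reymond (D : set point) (f : point -> R) : open D -> L2 D f ->
  (forall phi, C1c D phi -> \int[mu]_(x in D) (f x * phi x) = 0) ->
  {ae mu, forall x, D x -> f x = 0}.
Proof.
move=> oD Lf h; have [c [r [cr DE]]] := open_rV_bigcup_ball oD.
have H k : {ae mu, forall x, ball (c k) (r k) x -> f x = 0}.
  have [r0|r0] := ltP 0 (r k); last first.
    by apply: aeW => x /ball_rVP[]; rewrite ltNge r0.
  have := du_Bois_Reymond_support (open_measurable_rV oD) Lf h (C1c_bump (cr k) r0) (bump_ge0 _ _).
  by apply: filterS => x hx /(bump_gt0 _ _ r0).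
have /ae_foralln : forall k, {ae mu, forall x, ball (c k) (r k) x -> f x = 0} by [].
by apply: filterS => x hx; rewrite {1}DE => -[k _]; exact: hx.
Qed.

End du_Bois_Reymond.

(** * Polynomials and Raviart-Thomas fields *)

Section polynomial_facts.
Context {R : realType} {n : nat}.
Local Notation point := 'rV[R]_n.+1.
Implicit Types (p q : point -> R) (d : nat).

Definition monomial (a : 'I_n.+1 -> nat) (x : point) : R := \prod_i x ord0 i ^+ a i.

Lemma Pk_monomial d a : (\sum_i a i <= d)%N -> Pk d (monomial a).
Proof.
move=> ad; have ale i : (a i <= d)%N by apply: leq_trans ad; rewrite (bigD1 i)//= leq_addr.
pose a' : {ffun 'I_n.+1 -> 'I_d.+1} := [ffun i => inord (a i)].
have a'E i : a' i = a i :> nat by rewrite /a' ffunE inordK// ltnS.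
exists (fun b => (b == a')%:R) => x; rewrite (bigD1 a')/=; last first.
  by under eq_bigr do rewrite a'E.
rewrite eqxx mul1r [X in _ + X]big1 ?addr0; last by move=> b /andP[_ /negbTE ->]; rewrite mul0r.
by apply: eq_bigr => i _; rewrite a'E.
Qed.

Lemma PkD d p q : Pk d p -> Pk d q -> Pk d (fun x => p x + q x).
Proof.
move=> [c hc] [e he]; exists (fun a => c a + e a) => x; rewrite hc he -big_split/=.
by apply: eq_bigr => a _; rewrite mulrDl.
Qed.

Lemma PkZ d r p : Pk d p -> Pk d (fun x => r * p x).
Proof.
move=> [c hc]; exists (fun a => r * c a) => x; rewrite hc mulr_sumr.
by apply: eq_bigr => a _; rewrite mulrA.
Qed.

Lemma Pk_cst d (r : R) : Pk d (fun _ : point => r).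
Proof.
have := PkZ r (@Pk_monomial d (fun=> 0%N) _); rewrite /monomial big1//.
rewrite (_ : (fun _ => _) = fun=> r); first by apply.
by apply/funext => x; rewrite big1 ?mulr1// => i _; rewrite expr0.
Qed.

Lemma Pk_sum d I (r : seq I) (P : pred I) (F : I -> point -> R) :
  (forall i, P i -> Pk d (F i)) -> Pk d (fun x => \sum_(i <- r | P i) F i x).
Proof.
move=> h; elim: r => [|i r IH].
  by under eq_fun do rewrite big_nil; exact: Pk_cst.
under eq_fun do rewrite big_cons; have := h i; case: (P i) => // /(_ isT) Fi.
exact: PkD.
Qed.

(** An induction principle for polynomials of bounded degree, which replaces manipulation of the
    coefficient families in [Pk]. *)
Lemma Pk_lincomb d (Q : (point -> R) -> Prop) :
  (forall a, (\sum_i a i <= d)%N -> Q (monomial a)) ->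
  (forall p q, Q p -> Q q -> Q (fun x => p x + q x)) ->
  (forall r p, Q p -> Q (fun x => r * p x)) -> Q (fun=> 0) ->
  forall p, Pk d p -> Q p.
Proof.
move=> Qm QD QZ Q0 p [c hc].
rewrite (_ : p = fun x => \sum_(a : {ffun 'I_n.+1 -> 'I_d.+1} | (\sum_i a i <= d)%N)
             c a * monomial (fun i => a i) x); last by apply/funext.
elim: (index_enum _) => [|a r IH]; first by under eq_fun do rewrite big_nil.
have [ad|/negbTE ad] := boolP (\sum_i a i <= d)%N; last first.
  by under eq_fun do rewrite big_cons ad.
under eq_fun do rewrite big_cons ad.
by apply: QD => //; apply: QZ; exact: Qm.
Qed.

Lemma Pk_le d d' p : (d <= d')%N -> Pk d p -> Pk d' p.
Proof.
move=> dd; apply: Pk_lincomb => [a ad|r q|r q|].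
- by apply: Pk_monomial; exact: leq_trans ad dd.
- exact: PkD.
- exact: PkZ.
- exact: Pk_cst.
Qed.

Lemma monomialS a i (x : point) : x ord0 i * monomial a x = monomial (fun j => a j + (i == j))%N x.
Proof.
rewrite /monomial (bigD1 i)//= [in RHS](bigD1 i)//= eqxx addn1 exprS -!mulrA; congr (_ * (_ * _)).
by apply: eq_bigr => j ij; rewrite (negbTE (_ : i != j)) ?addn0// eq_sym.
Qed.

Lemma sum_addn1 (a : 'I_n.+1 -> nat) i : (\sum_j (a j + (i == j)) = (\sum_j a j).+1)%N.
Proof.
rewrite big_split/= [X in (_ + X)%N](bigD1 i)//= eqxx [X in (_ + (_ + X))%N]big1 ?addn1//.
by move=> j /negbTE; rewrite eq_sym => ->.
Qed.

Lemma Pk_coordM d p i : Pk d p -> Pk d.+1 (fun x => x ord0 i * p x).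
Proof.
move: p; apply: Pk_lincomb => [a ad|p q hp hq|r p hp|].
- rewrite (_ : (fun x => _) = monomial (fun j => a j + (i == j))%N).
    by apply: Pk_monomial; rewrite sum_addn1.
  by apply/funext => x; exact: monomialS.
- by under eq_fun do rewrite mulrDr; exact: PkD.
- by under eq_fun do rewrite mulrCA; exact: PkZ.
- by under eq_fun do rewrite mulr0; exact: Pk_cst.
Qed.

Lemma C1_exp (f : point -> R) k : C1 f -> C1 (fun x => f x ^+ k).
Proof.
move=> cf; elim: k => [|k IH]; first by under eq_fun do rewrite expr0; exact: C1_cst.
by under eq_fun do rewrite exprS; exact: C1M.
Qed.

Lemma C1_monomial a : C1 (monomial a).
Proof. by apply: C1_prod => i _; apply: C1_exp; exact: C1_coord. Qed.

Lemma C1_Pk d p : Pk d p -> C1 p.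
Proof.
move: p; apply: Pk_lincomb => [a _|p q|r p|].
- exact: C1_monomial.
- exact: C1D.
- by move=> hp; apply: C1M => //; exact: C1_cst.
- exact: C1_cst.
Qed.

Lemma monomial0 a : (forall j, a j = 0%N) -> monomial a = fun=> 1.
Proof. by move=> h; apply/funext => x; rewrite /monomial big1// => i _; rewrite h expr0. Qed.

Lemma Pk_partial_monomial d a i : (\sum_j a j <= d)%N -> Pk d.-1 (partial i (monomial a)).
Proof.
elim: d a => [|d IH] a; first rewrite leqn0 sum_nat_eq0 => /forallP a0.
  rewrite monomial0; last by move=> j; have := a0 j => /= /eqP.
  by rewrite (_ : partial i _ = fun=> 0); [exact: Pk_cst|apply/funext => x; exact: partial_cst].
move=> ad; have [/forallP a0|] := boolP [forall j, a j == 0%N].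
  rewrite monomial0; last by move=> j; apply/eqP.
  by rewrite (_ : partial i _ = fun=> 0); [exact: Pk_cst|apply/funext => x; exact: partial_cst].
rewrite negb_forall => /existsP[j aj].
(* Split off one factor [x ord0 j] of positive exponent and differentiate the product
   [x ord0 j * monomial b x]. *)
pose b l := (a l - (j == l))%N.
have ab l : a l = (b l + (j == l))%N.
  by rewrite /b; case: eqP => [<-|_] /=; rewrite ?subn0 ?addn0// subnK// lt0n.
have bd : (\sum_l b l <= d)%N.
  by move: ad; under eq_bigr do rewrite ab; rewrite sum_addn1.
have -> : monomial a = fun x => x ord0 j * monomial b x.
  apply/funext => x; rewrite monomialS; congr (monomial _ x); apply/funext => l; exact: ab.
rewrite (_ : partial i _ = fun x => x ord0 j * partial i (monomial b) x + (i == j)%:R * monomial b x).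
  apply: PkD; last by apply: PkZ; exact: Pk_monomial.
  (* At the bottom degree the cofactor is the constant 1 and its derivative is 0. The bound
     [Pk_coordM] would overshoot there, because [0.-1] is 0 and not one less. *)
  case: d IH ad bd => [|d] IH ad bd; last by apply: Pk_coordM; exact: IH.
  move: bd; rewrite leqn0 sum_nat_eq0 => /forallP b0.
  rewrite monomial0; last by move=> l; have := b0 l => /= /eqP.
  rewrite (_ : (fun x => _) = fun=> 0); first exact: Pk_cst.
  by apply/funext => x; rewrite partial_cst mulr0.
apply/funext => x; rewrite partialM; first by rewrite partial_coord; congr (_ + _); exact: mulrC.
  exact: differentiable_coord.
by apply: C1_differentiable; exact: C1_monomial.
Qed.

Lemma Pk_partial d p i : Pk d p -> Pk d.-1 (partial i p).
Proof.
move=> hp; suff [] : C1 p /\ Pk d.-1 (partial i p) by [].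
move: p hp; apply: Pk_lincomb => [a ad|p q [cp hp] [cq hq]|r p [cp hp]|].
- by split; [exact: C1_monomial|exact: Pk_partial_monomial].
- split; first exact: C1D.
  rewrite (_ : partial i _ = fun x => partial i p x + partial i q x); first exact: PkD.
  by apply/funext => x; rewrite partialD//; exact: C1_differentiable.
- split; first by apply: C1M => //; exact: C1_cst.
  rewrite (_ : partial i _ = fun x => r * partial i p x); first exact: PkZ.
  apply/funext => x; rewrite partialM; first by rewrite partial_cst mulr0 addr0.
    exact: differentiable_cst.
  exact: C1_differentiable.
- split; first exact: C1_cst.
  by rewrite (_ : partial i _ = fun=> 0); [exact: Pk_cst|apply/funext => x; exact: partial_cst].
Qed.

(** The classical divergence, explicit and polynomial for Raviart-Thomas fields, in contrast to the
    chosen representative [wdiv]. *)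
Definition cdiv (v : point -> point) (x : point) : R := \sum_i partial i (component v i) x.

Lemma C1_RT d (v : point -> point) i : RT d v -> C1 (component v i).
Proof.
move=> [a [q [ha hq hv]]]; rewrite (_ : component v i = fun x => component a i x + q x * x ord0 i).
  apply: C1D; first exact: C1_Pk (ha i).
  by apply: C1M; [exact: C1_Pk hq|exact: C1_coord].
by apply/funext => x; rewrite /component hv !mxE.
Qed.

(** The divergence of [q x *: x] is N q + x . grad q, where the derivative lowers the degree and the
    coordinate restores it. The successor guarantees that the truncated predecessor really is one
    less. *)
Lemma Pk_cdiv_RT d (v : point -> point) : RT d.+1 v -> Pk d.+1 (cdiv v).
Proof.
move=> [a [q [ha hq hv]]]; apply: Pk_sum => i _.
rewrite (_ : partial i _ = fun x => partial i (component a i) x +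
    (q x + x ord0 i * partial i q x)).
  apply: PkD; first by apply: Pk_le (Pk_partial i (ha i)); exact: leqnSn.
  by apply: PkD => //; apply: Pk_coordM; exact: (Pk_partial i hq).
apply/funext => x; rewrite (_ : component v i = fun x => component a i x + q x * x ord0 i).
  have dq : differentiable q x by exact/C1_differentiable/C1_Pk/hq.
  rewrite partialD; last 2 first.
  - exact/C1_differentiable/C1_Pk/(ha i).
  - by apply: differentiableM => //; exact: differentiable_coord.
  by rewrite partialM//; [rewrite partial_coord eqxx mulr1|exact: differentiable_coord].
by apply/funext => y; rewrite /component hv !mxE.
Qed.

(* On [x . w = c] the normal component of [q x *: x] is [c * q x]: its extra
   degree is lost. *)
Lemma RT_normal d (v : point -> point) (w : 'I_n.+1 -> R) c : RT d v -> exists2 p, Pk d p &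
  forall x : point, \sum_i x ord0 i * w i = c -> \sum_i v x ord0 i * w i = p x.
Proof.
move=> [a [q [ha hq hv]]].
exists (fun x => \sum_i w i * component a i x + c * q x).
  by apply: PkD; [apply: Pk_sum => i _; apply: PkZ; exact: ha|exact: PkZ].
move=> x <-; rewrite mulr_suml -big_split/=; apply: eq_bigr => i _.
by rewrite hv !mxE /component; ring.
Qed.

End polynomial_facts.

(** * Affine independence and simplices *)

Lemma unitmx_inj (F : fieldType) n (M : 'M[F]_n) :
  (forall x : 'rV_n, x *m M = 0 -> x = 0) -> M \in unitmx.
Proof.
move=> h; rewrite -row_free_unit -kermx_eq0; apply/eqP/row_matrixP => i.
by rewrite row0; apply: h; rewrite -row_mul mulmx_ker row0.
Qed.

Section simplex_facts.
Context {R : realType} {n : nat}.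
Local Notation point := 'rV[R]_n.+1.
Local Notation mu := (@lebesgue_rV R).
Local Notation ref m := (@reference R m).

(** Barycentric coordinates from reference coordinates: index 0 carries the missing weight. [unbc]
    forgets it, and the two are inverse to each other on vectors of sum 1. *)
Definition bc m (t : 'rV[R]_m) : 'rV[R]_m.+1 :=
  \row_i oapp (fun j => t ord0 j) (1 - \sum_j t ord0 j) (unlift ord0 i).

Definition unbc m (s : 'rV[R]_m.+1) : 'rV[R]_m := \row_j s ord0 (lift ord0 j).

Lemma bc0 m (t : 'rV[R]_m) : bc t ord0 ord0 = 1 - \sum_j t ord0 j.
Proof. by rewrite mxE unlift_none. Qed.

Lemma bcS m (t : 'rV[R]_m) j : bc t ord0 (lift ord0 j) = t ord0 j.
Proof. by rewrite mxE liftK. Qed.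

Lemma sum_bc m (t : 'rV[R]_m) : \sum_i bc t ord0 i = 1.
Proof.
by rewrite big_ord_recl bc0; under [X in _ + X]eq_bigr do rewrite bcS; rewrite subrK.
Qed.

Lemma unbcK m (s : 'rV[R]_m.+1) : \sum_i s ord0 i = 1 -> bc (unbc s) = s.
Proof.
move=> s1; apply/rowP => i; case: (unliftP ord0 i) => [j ->|->].
  by rewrite bcS mxE.
by rewrite bc0 -s1 big_ord_recl; under [X in _ - X]eq_bigr do rewrite mxE; rewrite addrK.
Qed.

Lemma bcK m (t : 'rV[R]_m) : unbc (bc t) = t.
Proof. by apply/rowP => j; rewrite mxE bcS. Qed.

Lemma chartE m (S : 'M[R]_(m.+1, n.+1)) t : chart S t = bc t *m S.
Proof.
rewrite /chart; apply/rowP => k; rewrite !mxE big_ord_recl bc0 mulrBl mul1r -addrA.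
congr (_ + _); rewrite mulr_suml -sumrN -big_split/=; apply: eq_bigr => j _.
by rewrite bcS !mxE; ring.
Qed.

Lemma reference_bc m (t : 'rV[R]_m) : ref m t <-> forall i, 0 < bc t ord0 i.
Proof.
split=> [[t0 t1] i|h].
  by case: (unliftP ord0 i) => [j ->|->]; rewrite ?bcS// bc0 subr_gt0.
by split=> [j|]; [rewrite -bcS|rewrite -subr_gt0 -bc0].
Qed.

Lemma osimplexP m (S : 'M[R]_(m.+1, n.+1)) x : osimplex S x <->
  exists s : 'rV[R]_m.+1, [/\ forall i, 0 < s ord0 i, \sum_i s ord0 i = 1 & x = s *m S].
Proof.
split=> [[t /reference_bc rt <-]|[s [s0 s1 ->]]].
  by exists (bc t); split; [|exact: sum_bc|rewrite chartE].
exists (unbc s); last by rewrite chartE unbcK.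
by apply/reference_bc; rewrite unbcK.
Qed.

Lemma simplexP m (S : 'M[R]_(m, n.+1)) x : simplex S x <->
  exists s : 'rV[R]_m, [/\ forall i, 0 <= s ord0 i, \sum_i s ord0 i = 1 & x = s *m S].
Proof.
split=> [[s [? _ ? ?]]|[s [? ? ?]]]; exists s; split => //.
by move=> i; rewrite inE.
Qed.

Lemma osimplex_sub m (S : 'M[R]_(m.+1, n.+1)) : osimplex S `<=` simplex S.
Proof.
by move=> x /osimplexP[s [s0 s1 ->]]; apply/simplexP; exists s; split => // i; exact: ltW.
Qed.

(** Affine independence of the rows, phrased with weights of sum 0 so that it also applies to faces,
    whose edge matrix is not square. *)
Definition affind m (S : 'M[R]_(m, n.+1)) :=
  forall t : 'rV[R]_m, \sum_i t ord0 i = 0 -> t *m S = 0 -> t = 0.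

Lemma affind_inj m (S : 'M[R]_(m, n.+1)) (s t : 'rV[R]_m) : affind S ->
  \sum_i s ord0 i = \sum_i t ord0 i -> s *m S = t *m S -> s = t.
Proof.
move=> aS st h; apply/eqP; rewrite -subr_eq0; apply/eqP/aS.
  under eq_bigr do rewrite !mxE.
  by rewrite big_split/= sumrN st subrr.
by rewrite mulmxBl h subrr.
Qed.

Lemma row_simplex m (S : 'M[R]_(m, n.+1)) i : simplex S (row i S).
Proof.
apply/simplexP; exists (delta_mx ord0 i); split; last by rewrite rowE.
  by move=> j; rewrite mxE eqxx /=; case: eqP.
by rewrite (bigD1 i)//= mxE !eqxx big1 ?addr0// => j /negbTE ji; rewrite mxE ji andbF.
Qed.

Definition stochastic m k (M : 'M[R]_(m, k)) :=
  (forall i j, 0 <= M i j) /\ forall i, \sum_j M i j = 1.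

Lemma stochastic_sum m k (M : 'M[R]_(m, k)) (s : 'rV[R]_m) : stochastic M ->
  \sum_j (s *m M) ord0 j = \sum_i s ord0 i.
Proof.
move=> [_ M1]; under eq_bigr do rewrite mxE.
by rewrite exchange_big/=; apply: eq_bigr => i _; rewrite -mulr_sumr M1 mulr1.
Qed.

(** Each vertex of [S'] is a convex combination of the rows of [S] with support in [A]; these
    weights are the rows of [M]. *)
Lemma hull_stochastic m k (S : 'M[R]_(m, n.+1)) (S' : 'M[R]_(k, n.+1)) (A : {set 'I_m}) :
  simplex S' `<=` hull S A ->
  exists M, [/\ stochastic M, forall i j, j \notin A -> M i j = 0 & S' = M *m S].
Proof.
move=> sub; have H i : exists s : 'rV[R]_m, [/\ forall j, 0 <= s ord0 j,
    forall j, j \notin A -> s ord0 j = 0, \sum_j s ord0 j = 1 & row i S' = s *m S].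
  by have [s hs] := sub _ (row_simplex S' i); exists s.
have [s hs] := choice H; exists (\matrix_(i, j) s i ord0 j); split.
- split=> i; last by under eq_bigr do rewrite mxE; case: (hs i).
  by move=> j; rewrite mxE; case: (hs i).
- by move=> i j jA; rewrite mxE; case: (hs i) => _ ->.
- apply/row_matrixP => i; rewrite row_mul; case: (hs i) => _ _ _ ->; congr (_ *m _).
  by apply/rowP => j; rewrite !mxE.
Qed.

Lemma stochastic_affind m k (S : 'M[R]_(m, n.+1)) (S' : 'M[R]_(k, n.+1)) M :
  stochastic M -> S' = M *m S -> affind S' -> forall t : 'rV_k, t *m M = 0 -> t = 0.
Proof.
move=> sM -> aS' t tM; apply: aS'; last by rewrite mulmxA tM mul0mx.
by rewrite -(stochastic_sum _ sM) tM big1// => j _; rewrite mxE.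
Qed.

(** An invertible matrix has no zero column, so every coordinate of the product receives a positive
    term. This carries relative interiors to relative interiors. *)
Lemma stochastic_gt0 m (M : 'M[R]_m) (s : 'rV[R]_m) : stochastic M -> M \in unitmx ->
  (forall i, 0 < s ord0 i) -> forall j, 0 < (s *m M) ord0 j.
Proof.
move=> [M0 _] uM s0 j; rewrite mxE.
have [i Mij] : exists i, M i j != 0.
  apply/existsP; apply: contraT; rewrite negb_exists => /forallP h.
  have : M *m delta_mx j (ord0 : 'I_1) = 0.
    rewrite -colE; apply/colP => i; rewrite !mxE; apply/eqP; have := h i.
    by rewrite negbK.
  move/(congr1 (mulmx (invmx M))); rewrite mulKmx// mulmx0 => /matrixP/(_ j ord0).
  by rewrite !mxE !eqxx => /eqP; rewrite oner_eq0.
apply: (@lt_le_trans _ _ (s ord0 i * M i j)).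
  by rewrite mulr_gt0// lt_def Mij M0.
by rewrite (bigD1 i)//= lerDl sumr_ge0// => k _; rewrite mulr_ge0// ltW.
Qed.

(** Writing the vertices of each simplex in terms of the other gives two stochastic matrices,
    mutually inverse by affine independence. They are permutation matrices, but nonnegativity
    together with the inverse already carries the later arguments. *)
Lemma same_simplex_mx m (S S' : 'M[R]_(m, n.+1)) : affind S -> affind S' ->
  simplex S = simplex S' ->
  exists M, exists M', [/\ stochastic M /\ stochastic M', S' = M *m S, S = M' *m S',
    M \in unitmx & M' \in unitmx /\ M *m M' = 1%:M /\ M' *m M = 1%:M].
Proof.
move=> aS aS' SS'.
have sub1 : simplex S' `<=` simplex S by rewrite SS'.
have sub2 : simplex S `<=` simplex S' by rewrite SS'.
have [M [sM _ hM]] := hull_stochastic sub1.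
have [M' [sM' _ hM']] := hull_stochastic sub2.
have uM : M \in unitmx by apply: unitmx_inj; exact: stochastic_affind sM hM aS'.
have uM' : M' \in unitmx by apply: unitmx_inj; exact: stochastic_affind sM' hM' aS.
have MM' : M *m M' = 1%:M.
  apply/row_matrixP => i; rewrite row_mul row1; apply: (affind_inj aS').
    by rewrite stochastic_sum// rowE stochastic_sum.
  by rewrite -mulmxA -hM' -row_mul -hM rowE.
by exists M, M'; split => //; split => //; split => //; exact: mulmx1C.
Qed.

Lemma same_simplex_osimplex m (S S' : 'M[R]_(m.+1, n.+1)) : affind S -> affind S' ->
  simplex S = simplex S' -> osimplex S = osimplex S'.
Proof.
move=> aS aS' /(same_simplex_mx aS aS')[M [M' [[sM sM'] hM hM' uM [uM' _]]]].
apply/seteqP; split=> x /osimplexP[s [s0 s1 ->]]; apply/osimplexP.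
  exists (s *m M'); split; [exact: stochastic_gt0|by rewrite stochastic_sum|].
  by rewrite -mulmxA -hM'.
exists (s *m M); split; [exact: stochastic_gt0|by rewrite stochastic_sum|].
by rewrite -mulmxA -hM.
Qed.

Lemma continuous_sum_rV k I (r : seq I) (F : I -> 'rV[R]_k -> R) :
  (forall i, continuous (F i)) -> continuous (fun x => \sum_(i <- r) F i x).
Proof.
move=> h; elim: r => [|i r IH].
  by under eq_fun do rewrite big_nil; exact: cst_continuous.
by under eq_fun do rewrite big_cons; exact: continuous_fD.
Qed.

Lemma open_reference m : open (ref m).
Proof.
rewrite openE => t [t0 t1].
have pos : \forall s \near t, forall i, 0 < (s : 'rV[R]_m) ord0 i.
  apply: (@filter_forall _ _ (fun i (s : 'rV[R]_m) => 0 < s ord0 i) _ (nbhs_filter t)) => i.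
  have /continuousP c : continuous (fun t : 'rV[R]_m => t ord0 i) by exact: coord_continuous.
  by apply: open_nbhs_nbhs; split; [apply: (c [set y | 0 < y]); exact: open_gt|exact: t0].
have lt1 : \forall s \near t, \sum_i (s : 'rV[R]_m) ord0 i < 1.
  have /continuousP c : continuous (fun t : 'rV[R]_m => \sum_i t ord0 i).
    by apply: continuous_sum_rV => i; exact: coord_continuous.
  by apply: open_nbhs_nbhs; split; [apply: (c [set y | y < 1]); exact: open_lt|exact: t1].
by apply: (@filterS2 _ _ (nbhs_filter t) _ _ _ _ pos lt1) => s; split.
Qed.

Lemma measurable_reference m : measurable (ref m).
Proof. by apply: open_measurable_rV; exact: open_reference. Qed.

Lemma bounded_reference m : bounded_set (ref m).
Proof.
exists 1; split; first exact: num_real.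
move=> M M1 t [t0 t1]; apply/ltW/(le_lt_trans _ M1).
rewrite {1}/Num.norm /= mx_normrE; apply/bigmax_leP; split => //= -[i j] _ /=.
rewrite [i]ord1 ger0_norm; last exact: ltW.
rewrite (le_trans _ (ltW t1))// (bigD1 j)//= lerDl sumr_ge0// => k _.
exact: ltW.
Qed.

Lemma reference_neq0 m : ref m !=set0.
Proof.
exists (const_mx (m.+1%:R^-1)); split=> [i|]; first by rewrite mxE invr_gt0.
under eq_bigr do rewrite mxE.
by rewrite sumr_const card_ord -[_ *+ _]mulr_natl ltr_pdivrMr// mul1r ltr_nat.
Qed.

Lemma volume_reference_gt0 m : 0 < \int[mu m]_(t in ref m) 1.
Proof.
have mr := @measurable_reference m; rewrite Rintegral_cst// mul1r fine_gt0//.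
apply/andP; split; first exact: (lebesgue_rV_open_gt0 (@open_reference m) (@reference_neq0 m)).
exact: (lebesgue_rV_bounded mr (@bounded_reference m)).
Qed.

Lemma continuous_affine m k (a : 'rV[R]_k) (M : 'M[R]_(m, k)) :
  continuous (fun x : 'rV[R]_m => a + x *m M).
Proof.
move=> x; have FF : Filter (nbhs (x : 'rV[R]_m)) := nbhs_filter x.
apply/cvgrPdist_lt => e e0.
have h j : \forall y \near x, `|(a + x *m M) ord0 j - (a + y *m M) ord0 j| < e.
  have : continuous (fun y : 'rV[R]_m => a ord0 j + \sum_i y ord0 i * M i j).
    apply: continuous_fD; first exact: cst_continuous.
    apply: continuous_sum_rV => i; apply: continuous_fM; last exact: cst_continuous.
    exact: coord_continuous.
  move=> /(_ x)/cvgrPdist_lt/(_ e e0); apply: filterS => y.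
  by rewrite !mxE.
have : \forall y \near x, forall j, `|(a + x *m M) ord0 j - (a + y *m M) ord0 j| < e.
  exact: (@filter_forall _ _ (fun j (y : 'rV[R]_m) => `|(a + x *m M) ord0 j - (a + y *m M) ord0 j| < e) _ FF).
apply: (@filterS _ _ FF) => y hy; have : ball (a + x *m M) e (a + y *m M) by apply/ball_rVP.
by rewrite -ball_normE.
Qed.

Lemma continuous_chart m (S : 'M[R]_(m.+1, n.+1)) : continuous (chart S).
Proof. exact: continuous_affine. Qed.

Lemma continuous_chart_comp m (S : 'M[R]_(m.+1, n.+1)) (f : point -> R) :
  continuous f -> continuous (fun t => f (chart S t)).
Proof. by move=> cf t; apply: continuous_comp; [exact: continuous_chart|exact: cf]. Qed.

Lemma reference_integrable m (f : 'rV[R]_m -> R) : continuous f ->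
  (mu m).-integrable (ref m) (EFin \o f).
Proof.
move=> cf; apply: continuous_integrable => //; first exact: measurable_reference.
exact: bounded_reference.
Qed.

(* The constant produced by Haar's theorem is 1 because the reference simplex
   is mapped onto itself. *)
Lemma integral_reference_automorphism m (a : 'rV[R]_m) (N : 'M[R]_m) : N \in unitmx ->
  (forall t, ref m (a + t *m N) <-> ref m t) ->
  forall f : 'rV[R]_m -> R, continuous f ->
  \int[mu m]_(t in ref m) f (a + t *m N) = \int[mu m]_(t in ref m) f t.
Proof.
move=> uN hN; have [c _ hc] := integral_affine a uN.
have pre : (fun x => a + x *m N) @^-1` ref m = ref m.
  by apply/seteqP; split=> t /hN.
have key f : continuous f ->
    \int[mu m]_(t in ref m) f (a + t *m N) = c * \int[mu m]_(t in ref m) f t.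
  move=> cf; rewrite -[in LHS]pre; apply: hc; first exact: measurable_reference.
  - exact: continuous_measurable_rV.
  - rewrite pre; apply: (@reference_integrable m (f \o (fun x => a + x *m N))) => x.
    by apply: continuous_comp; [exact: continuous_affine|exact: cf].
  - exact: reference_integrable.
have c1 : c = 1.
  have := key (fun=> 1) (@cst_continuous _ _ _).
  by move=> /esym; rewrite -[RHS]mul1r => /mulIf; apply; rewrite gt_eqF// volume_reference_gt0.
by move=> f cf; rewrite key// c1 mul1r.
Qed.

(** Two vertex orders of one simplex have charts that differ by an affine automorphism of the
    reference simplex. This is what makes integrals over a shared facet comparable from its two
    sides. *)
Lemma same_simplex_integral m (S S' : 'M[R]_(m.+1, n.+1)) : affind S -> affind S' ->
  simplex S = simplex S' -> forall f : point -> R, continuous f ->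
  \int[mu m]_(t in ref m) f (chart S' t) = \int[mu m]_(t in ref m) f (chart S t).
Proof.
move=> aS aS' /(same_simplex_mx aS aS')[M [M' [[sM sM'] hM hM' uM [uM' [MM' M'M]]]]] f cf.
(* Eliminating the barycentric coordinate of index 0 turns multiplication by [M] into the affine map
   sending [t] to [a + t *m N]. *)
pose a := unbc (row ord0 M).
pose N : 'M[R]_m := \matrix_(i, j) (M (lift ord0 i) (lift ord0 j) - M ord0 (lift ord0 j)).
have bcN t : bc t *m M = bc (a + t *m N).
  rewrite -[LHS]unbcK; last by rewrite stochastic_sum// sum_bc.
  congr bc; apply/rowP => j; rewrite !mxE big_ord_recl bc0 mulrBl mul1r -addrA; congr (_ + _).
  rewrite mulr_suml -sumrN -big_split/=; apply: eq_bigr => i _.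
  by rewrite bcS !mxE; ring.
have uN : N \in unitmx.
  apply: unitmx_inj => t tN.
  have h : (bc t - bc 0) *m M = 0.
    by rewrite mulmxBl !bcN tN mul0mx subrr.
  have : bc t - bc 0 = 0 by rewrite -[LHS](mulmxK uM) h mul0mx.
  by move/subr0_eq/(congr1 (@unbc m)); rewrite !bcK.
rewrite -(@integral_reference_automorphism m a N uN _ (fun t => f (chart S t))).
- apply: eq_Rintegral => t _; congr f.
  by rewrite !chartE -bcN -mulmxA -hM.
- move=> t; rewrite !reference_bc -bcN; split=> h i; last exact: stochastic_gt0.
  by rewrite -[bc t](mulmxK uM) (_ : invmx M = M') ?stochastic_gt0// -[RHS](mulKmx uM) MM' mulmx1.
- exact: continuous_chart_comp.
Qed.

End simplex_facts.

(** * Cells and their faces *)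

Section gram.
Context {R : realType}.

Lemma row_sqr_eq0 m (y : 'rV[R]_m) : (y *m y^T) ord0 ord0 = 0 -> y = 0.
Proof.
rewrite mxE => /eqP; rewrite psumr_eq0; last by move=> i _; rewrite mxE -expr2 sqr_ge0.
move=> /allP h; apply/rowP => i; have := h i (mem_index_enum _).
by rewrite !mxE -expr2 sqrf_eq0 => /eqP.
Qed.

Lemma row_sqr_ge0 m (y : 'rV[R]_m) : 0 <= (y *m y^T) ord0 ord0.
Proof. by rewrite mxE; apply: sumr_ge0 => i _; rewrite mxE -expr2 sqr_ge0. Qed.

(* The determinant of [(1 - s) A A^T + s I] does not vanish for [0 <= s <= 1]
   and equals 1 at [s = 1], so it is positive at [s = 0]. *)
Lemma gram_det_gt0 m k (A : 'M[R]_(m, k)) :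
  (forall y : 'rV_m, y *m A = 0 -> y = 0) -> 0 < \det (A *m A^T).
Proof.
move=> injA; pose B s := (1 - s) *: (A *m A^T) + s%:M.
have B_neq0 s : 0 <= s <= 1 -> \det (B s) != 0.
  move=> /andP[s0 s1]; rewrite -unitfE -/(_ \in unitmx) -unitmxE; apply: unitmx_inj => y yB.
  have : (1 - s) * (y *m A *m (y *m A)^T) ord0 ord0 + s * (y *m y^T) ord0 ord0 = 0.
    have : (y *m B s *m y^T) ord0 ord0 = 0 by rewrite yB mul0mx mxE.
    rewrite /B mulmxDr mulmxDl mxE -scalemxAr -scalemxAl mxE mul_mx_scalar -scalemxAl [X in _ + X]mxE.
    by rewrite trmx_mul !mulmxA.
  have h1 := row_sqr_ge0 (y *m A); have h2 := row_sqr_ge0 y.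
  move=> /eqP; rewrite paddr_eq0 ?mulr_ge0 ?subr_ge0// !mulf_eq0 subr_eq0.
  move=> /andP[/orP[/eqP <-|/eqP/row_sqr_eq0/injA//]].
  by rewrite oner_eq0 => /eqP/row_sqr_eq0.
pose p : {poly R} := \det ((1 - 'X) *: map_mx polyC (A *m A^T) + 'X%:M).
have pE s : p.[s] = \det (B s).
  rewrite -[LHS]/(horner_eval s p) -det_map_mx; congr (\det _).
  apply/matrixP => i j; rewrite !mxE rmorphD rmorphM rmorphB rmorph1 rmorphMn /=.
  by rewrite /horner_eval hornerX hornerC.
have B0 : B 0 = A *m A^T by rewrite /B subr0 scale1r raddf0 addr0.
have B1 : \det (B 1) = 1 by rewrite /B subrr scale0r add0r det1.
rewrite -B0 lt_def B_neq0 ?lexx ?ler01//=; have [//|lt0] := leP 0 (\det (B 0)).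
have [|x x01 /rootP] := @poly_ivt R p 0 1 ler01.
  by rewrite !pE B1 ler01 ltW.
by rewrite pE => /eqP; rewrite (negbTE (B_neq0 _ x01)).
Qed.

End gram.

Section cells.
Context {R : realType} {n : nat}.
Local Notation point := 'rV[R]_n.+1.
Local Notation cell := 'M[R]_(n.+2, n.+1).
Local Notation mu := (@lebesgue_rV R).
Local Notation ref m := (@reference R m).

Lemma affind_edges m (S : 'M[R]_(m.+1, n.+1)) : affind S ->
  forall y : 'rV_m, y *m edges S = 0 -> y = 0.
Proof.
move=> aS y hy; have h : bc y *m S = bc 0 *m S.
  by rewrite -!chartE /chart hy mul0mx.
have e : bc y = bc 0 by apply: affind_inj aS _ h; rewrite !sum_bc.
by rewrite -[y]bcK e bcK.
Qed.

Lemma gram_edges_gt0 m (S : 'M[R]_(m.+1, n.+1)) : affind S ->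
  0 < Num.sqrt (\det (edges S *m (edges S)^T)).
Proof. by move=> aS; rewrite sqrtr_gt0; apply: gram_det_gt0; exact: affind_edges. Qed.

(** Inverts the chart of the cell. It is affine on the whole space, so the cell, its interior and
    its faces are described by signs of its entries. *)
Definition bary (T : cell) (x : point) : 'rV[R]_n.+2 :=
  bc ((x - row ord0 T) *m invmx (edges T)).

Lemma sum_bary (T : cell) x : \sum_i bary T x ord0 i = 1.
Proof. exact: sum_bc. Qed.

Section cell.
Variable T : cell.
Hypothesis uT : edges T \in unitmx.

Lemma baryK x : bary T x *m T = x.
Proof. by rewrite -chartE /chart mulmxKV// addrC subrK. Qed.

Lemma bary_chart t : bary T (chart T t) = bc t.
Proof. by rewrite /bary /chart addrC addKr mulmxK. Qed.

Lemma baryE (s : 'rV[R]_n.+2) : \sum_i s ord0 i = 1 -> bary T (s *m T) = s.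
Proof. by move=> s1; rewrite -{1}(unbcK s1) -chartE bary_chart unbcK. Qed.

Lemma cell_affind : affind T.
Proof.
move=> t t0 tT; pose s := delta_mx ord0 ord0 : 'rV[R]_n.+2.
have s1 : \sum_i s ord0 i = 1.
  by rewrite (bigD1 ord0)//= mxE !eqxx big1 ?addr0// => j /negbTE j0; rewrite mxE j0 andbF.
have ts1 : \sum_i (t + s) ord0 i = 1.
  by under eq_bigr do rewrite mxE; rewrite big_split/= t0 add0r.
have := baryE ts1; rewrite mulmxDl tT add0r baryE// => /eqP.
by rewrite -subr_eq subrr => /eqP.
Qed.

Lemma hull_bary A x : hull T A x <->
  (forall i, 0 <= bary T x ord0 i) /\ (forall i, i \notin A -> bary T x ord0 i = 0).
Proof.
split=> [[s [s0 sA s1 ->]]|[h0 hA]]; first by rewrite baryE.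
by exists (bary T x); split; rewrite ?sum_bary ?baryK.
Qed.

Lemma simplex_bary x : simplex T x <-> forall i, 0 <= bary T x ord0 i.
Proof.
rewrite /simplex hull_bary; split=> [[]//|h]; split => // i.
by rewrite inE.
Qed.

Lemma osimplex_bary x : osimplex T x <-> forall i, 0 < bary T x ord0 i.
Proof.
split=> [/osimplexP[s [s0 s1 ->]]|h]; first by rewrite baryE.
by apply/osimplexP; exists (bary T x); rewrite sum_bary baryK.
Qed.

Definition extend (j : 'I_n.+2) (t : 'rV[R]_n.+1) : 'rV[R]_n.+2 :=
  \row_i oapp (fun k => t ord0 k) 0 (unlift j i).

Lemma extend_lift j t k : extend j t ord0 (lift j k) = t ord0 k.
Proof. by rewrite mxE liftK. Qed.

Lemma extend_self j t : extend j t ord0 j = 0.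
Proof. by rewrite mxE unlift_none. Qed.

Lemma sum_lift (V : zmodType) (j : 'I_n.+2) (F : 'I_n.+2 -> V) :
  \sum_i F i = F j + \sum_k F (lift j k).
Proof.
rewrite (bigD1 j)//=; congr (_ + _); rewrite (reindex_onto (lift j) (fun i => odflt ord0 (unlift j i)))/=.
  by apply: eq_bigl => k; rewrite liftK /= eqxx eq_sym neq_lift.
by move=> i ij; case: unliftP ij => [k ->|->]; rewrite ?eqxx.
Qed.

Lemma sum_extend j t : \sum_i extend j t ord0 i = \sum_k t ord0 k.
Proof.
by rewrite (sum_lift j) extend_self add0r; apply: eq_bigr => k _; rewrite extend_lift.
Qed.

Lemma extend_face j t : extend j t *m T = t *m face T j.
Proof.
apply/rowP => k; rewrite !mxE (sum_lift j) extend_self mul0r add0r.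
by apply: eq_bigr => i _; rewrite extend_lift !mxE.
Qed.

Definition restr (j : 'I_n.+2) (s : 'rV[R]_n.+2) : 'rV[R]_n.+1 :=
  \row_k s ord0 (lift j k).

Lemma restrK j (s : 'rV[R]_n.+2) : s ord0 j = 0 -> extend j (restr j s) = s.
Proof.
move=> sj; apply/rowP => i; case: (unliftP j i) => [k ->|->].
  by rewrite extend_lift mxE.
by rewrite extend_self.
Qed.

Lemma face_affind j : affind (face T j).
Proof.
move=> t t0 tT; have : extend j t = 0 by apply: cell_affind; rewrite ?sum_extend// extend_face.
move=> h; apply/rowP => k; rewrite -(extend_lift j) h !mxE//.
Qed.

Lemma simplex_face_bary j x : simplex (face T j) x <->
  bary T x ord0 j = 0 /\ forall i, 0 <= bary T x ord0 i.
Proof.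
split=> [/simplexP[t [t0 t1 ->]]|[xj x0]].
  rewrite -extend_face baryE ?sum_extend// extend_self; split => // i.
  by case: (unliftP j i) => [k ->|->]; rewrite ?extend_lift// extend_self.
apply/simplexP; exists (restr j (bary T x)); split.
- by move=> k; rewrite mxE.
- by rewrite -(sum_extend j) restrK// sum_bary.
- by rewrite -extend_face restrK// baryK.
Qed.

Lemma osimplex_face_bary j x : osimplex (face T j) x <->
  bary T x ord0 j = 0 /\ forall i, i != j -> 0 < bary T x ord0 i.
Proof.
split=> [/osimplexP[t [t0 t1 ->]]|[xj x0]].
  rewrite -extend_face baryE ?sum_extend// extend_self; split => // i ij.
  by case: (unliftP j i) ij => [k ->|->]; rewrite ?extend_lift// eqxx.
apply/osimplexP; exists (restr j (bary T x)); split.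
- by move=> k; rewrite mxE x0// eq_sym neq_lift.
- by rewrite -(sum_extend j) restrK// sum_bary.
- by rewrite -extend_face restrK// baryK.
Qed.

Lemma hull_face j (A : {set 'I_n.+2}) : (forall i, (i \in A) = (i != j)) -> hull T A = simplex (face T j).
Proof.
move=> hA; apply/seteqP; split=> x; rewrite hull_bary simplex_face_bary => -[h1 h2].
  by split => //; apply: h2; rewrite hA eqxx.
by split => // i; rewrite hA negbK => /eqP ->.
Qed.

Lemma hull_full (A : {set 'I_n.+2}) : (forall i, i \in A) -> hull T A = simplex T.
Proof.
move=> hA; apply/seteqP; split=> x; rewrite hull_bary simplex_bary; first by case.
by move=> h; split => // i; rewrite hA.
Qed.

(** Solving the chart for the coordinates gives an affine form. It takes the values 1 and 0 at two
    vertices, so it is not constant; the nonzero slope makes its zero set a genuine hyperplane. *)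
Lemma baryEaff i : exists b (w : 'I_n.+1 -> R), (exists k, w k != 0) /\
  forall x, bary T x ord0 i = b + \sum_k x ord0 k * w k.
Proof.
suff [b [w bw]] : exists b (w : 'I_n.+1 -> R), forall x, bary T x ord0 i = b + \sum_k x ord0 k * w k.
  exists b, w; split => //; apply/existsP; apply: contraT; rewrite negb_exists => /forallP w0.
  have cst x : bary T x ord0 i = b.
    by rewrite bw big1 ?addr0// => k _; have := w0 k; rewrite negbK => /eqP ->; rewrite mulr0.
  pose d j := delta_mx ord0 j : 'rV[R]_n.+2.
  have d1 j : \sum_i d j ord0 i = 1.
    by rewrite (bigD1 j)//= mxE !eqxx big1 ?addr0// => l /negbTE lj; rewrite mxE lj andbF.
  have db j : d j ord0 i = b by rewrite -(cst (d j *m T)) baryE.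
  have [j ji] : exists j, i != j.
    by exists (lift i ord0); exact: neq_lift.
  have := db i; rewrite -(db j) !mxE !eqxx (negbTE ji) andbF => /eqP.
  by rewrite oner_eq0.
case: (unliftP ord0 i) => [j ->|->].
  exists (- (row ord0 T *m invmx (edges T)) ord0 j), (fun k => invmx (edges T) k j) => x.
  by rewrite bcS mulmxBl mxE addrC; congr (_ + _); rewrite !mxE.
exists (1 + \sum_j (row ord0 T *m invmx (edges T)) ord0 j), (fun k => - \sum_j invmx (edges T) k j) => x.
rewrite bc0 mulmxBl -addrA; congr (_ + _).
under eq_bigr do rewrite mxE [X in _ + X]mxE.
rewrite big_split/= sumrN opprD opprK addrC; congr (_ + _).
under eq_bigr do rewrite mxE.
by rewrite exchange_big/= -sumrN; apply: eq_bigr => k _; rewrite mulrN mulr_sumr.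
Qed.

Lemma continuous_bary i : continuous (fun x => bary T x ord0 i).
Proof.
have [b [w [_ bw]]] := baryEaff i.
rewrite (_ : (fun x => _) = fun x : point => b + \sum_k x ord0 k * w k); last exact/funext.
apply: continuous_fD; first exact: cst_continuous.
apply: continuous_sum_rV => k; apply: continuous_fM; last exact: cst_continuous.
exact: coord_continuous.
Qed.

Lemma open_osimplex : open (osimplex T).
Proof.
rewrite openE => x /osimplex_bary x0.
have h : \forall y \near x, forall i, 0 < bary T y ord0 i.
  apply: (@filter_forall _ _ (fun i (y : point) => 0 < bary T y ord0 i) _ (nbhs_filter x)) => i.
  have /continuousP c := @continuous_bary i.
  by apply: open_nbhs_nbhs; split; [apply: (c [set y | 0 < y]); exact: open_gt|exact: x0].
by apply: (@filterS _ _ (nbhs_filter x)) h => y /osimplex_bary.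
Qed.

Lemma measurable_osimplex : measurable (osimplex T).
Proof. by apply: open_measurable_rV; exact: open_osimplex. Qed.

Lemma measurable_simplex : measurable (simplex T).
Proof.
rewrite (_ : simplex T = \bigcap_(i in [set: 'I_n.+2]) ((fun x => bary T x ord0 i) @^-1` `[0, +oo[)).
  apply: fin_bigcap_measurable => // i _.
  rewrite -[X in measurable X]setTI; apply: (continuous_measurable_rV (@continuous_bary i)) => //.
apply/seteqP; split => x /=.
  by move=> /simplex_bary h i _ /=; rewrite in_itv/= andbT.
by move=> h; apply/simplex_bary => i; have := h i I; rewrite /= in_itv/= andbT.
Qed.

Lemma bounded_simplex m (S : 'M[R]_(m, n.+1)) : bounded_set (simplex S).
Proof.
exists (\sum_i `|row i S|); split; first exact: num_real.
move=> M hM x /simplexP[s [s0 s1 ->]]; apply/ltW/(le_lt_trans _ hM).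
rewrite mulmx_sum_row (le_trans (ler_norm_sum _ _ _))//; apply: ler_sum => i _.
rewrite normrZ ger0_norm// -[leRHS]mul1r ler_wpM2r// -s1 (bigD1 i)//= lerDl.
exact: sumr_ge0.
Qed.

Lemma bounded_osimplex : bounded_set (osimplex T).
Proof. exact: sub_bounded (@osimplex_sub _ _ _ T) (bounded_simplex T). Qed.

Definition center : point := const_mx (n.+2%:R^-1) *m T.

Lemma bary_center i : bary T center ord0 i = n.+2%:R^-1.
Proof.
rewrite baryE ?mxE//; under eq_bigr do rewrite mxE.
by rewrite sumr_const card_ord -[_ *+ _]mulr_natl mulfV// pnatr_eq0.
Qed.

Lemma osimplex_center : osimplex T center.
Proof. by apply/osimplex_bary => i; rewrite bary_center invr_gt0. Qed.

Lemma osimplex_segment x y (e : R) : simplex T x -> osimplex T y -> 0 < e <= 1 ->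
  osimplex T ((1 - e) *: x + e *: y).
Proof.
move=> /simplex_bary x0 /osimplex_bary y0 /andP[e0 e1]; apply/osimplexP.
exists ((1 - e) *: bary T x + e *: bary T y); split.
- by move=> i; rewrite mxE [X in X + _]mxE [X in _ + X]mxE ltr_wpDl ?mulr_ge0 ?subr_ge0 ?mulr_gt0.
- under eq_bigr do rewrite mxE [X in X + _]mxE [X in _ + X]mxE.
  by rewrite big_split/= -!mulr_sumr !sum_bary; ring.
- by rewrite mulmxDl -!scalemxAl !baryK.
Qed.

(** On the segment from [x] to the centre, every point other than [x] is interior. *)
Lemma simplex_sub_closure : simplex T `<=` closure (osimplex T).
Proof.
move=> x xT U Ux; pose z (e : R) := x + e *: (center - x).
have cz : z e @[e --> 0] --> x.
  rewrite -[X in _ --> X]addr0 -(scale0r (center - x)).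
  apply: cvgD; first exact: cvg_cst.
  by apply: cvgZl; exact: cvg_id.
have h : \forall e \near (0 : R), U (z e) by exact: cz.
have /nbhs_ballP[d /= d0 dU] := h.
pose e := Num.min (d / 2) 1.
have e01 : 0 < e <= 1 by rewrite /e lt_min divr_gt0// ltr01 ge_min lexx orbT.
exists (z e); split; last first.
  apply: dU; rewrite -ball_normE /= sub0r normrN ger0_norm; last by case/andP: e01 => /ltW.
  by rewrite /e gt_min ltr_pdivrMr// mulr_natr mulr2n ltrDl d0.
rewrite (_ : z e = (1 - e) *: x + e *: center); first exact: osimplex_segment osimplex_center _.
by rewrite /z scalerBr scalerBl scale1r addrA addrAC.
Qed.

Lemma closed_simplex : closed (simplex T).
Proof.
rewrite (_ : simplex T = \bigcap_(i in [set: 'I_n.+2]) ((fun x => bary T x ord0 i) @^-1` [set y | 0 <= y])).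
  apply: closed_bigI => i _; apply: closed_comp; first by move=> x _; exact: continuous_bary.
  exact: closed_ge.
by apply/seteqP; split => x; rewrite simplex_bary => h i; [move=> _|]; apply: h.
Qed.

(** [integral_affine] is applied to the inverse chart, under which the preimage of the reference
    simplex is the open cell. *)
Lemma integral_osimplex : exists2 c : R, 0 <= c & forall f : point -> R, continuous f ->
  \int[mu n.+1]_(x in osimplex T) f x = c * \int[mu n.+1]_(t in ref n.+1) f (chart T t).
Proof.
have uV : invmx (edges T) \in unitmx by rewrite unitmx_inv.
pose a := - (row ord0 T *m invmx (edges T)).
have [c c0 hc] := integral_affine a uV; exists c => // f cf.
have aE x : a + x *m invmx (edges T) = (x - row ord0 T) *m invmx (edges T).
  by rewrite mulmxBl addrC.
have chartK x : chart T (a + x *m invmx (edges T)) = x.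
  by rewrite aE /chart mulmxKV// addrC subrK.
have pre : (fun x => a + x *m invmx (edges T)) @^-1` ref n.+1 = osimplex T.
  apply/seteqP; split=> x /=; first by move=> h; exists (a + x *m invmx (edges T)).
  move=> /osimplex_bary h; apply/reference_bc => i; rewrite aE; exact: h.
rewrite -hc; first by rewrite pre; apply: eq_Rintegral => x _; rewrite chartK.
- exact: measurable_reference.
- by apply: continuous_measurable_rV; exact: continuous_chart_comp.
- rewrite pre; apply: eq_integrable (continuous_integrable cf measurable_osimplex bounded_osimplex).
    exact: measurable_osimplex.
  by move=> x _ /=; rewrite chartK.
- by apply: reference_integrable; exact: continuous_chart_comp.
Qed.

End cell.

Lemma hyperplane_coord_null m (k : 'I_m) (d : R) : mu m [set x : 'rV[R]_m | x ord0 k = d] = 0%E.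
Proof.
elim: m k => [[]//|m IH] k.
have mH l (j : 'I_l) : measurable [set x : 'rV[R]_l | x ord0 j = d].
  rewrite (_ : [set x | _] = (fun x : 'rV[R]_l => x ord0 j : measurableTypeR R) @^-1` [set d])//.
  by rewrite -[X in measurable X]setTI; apply: measurable_coord.
rewrite lebesgue_rVS; case: (unliftP ord0 k) => [j ->|->].
  rewrite (_ : _ @^-1` _ = (setT : set (measurableTypeR R)) `*` [set x : 'rV[R]_m | x ord0 j = d]).
    by rewrite product_measure1E// ?IH ?mule0//; exact: mH.
  by apply/seteqP; split => -[x y] /=; rewrite mxE liftK//= => -[].
rewrite (_ : _ @^-1` _ = ([set d] : set (measurableTypeR R)) `*` (setT : set 'rV[R]_m)).
  rewrite product_measure1E// [X in (X * _)%E](_ : _ = 0%E) ?mul0e//.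
  exact: lebesgue_measure_set1.
by apply/seteqP; split => -[x y] /=; rewrite mxE unlift_none//= => -[].
Qed.

(** Replacing column [k] of the identity by [w] gives an invertible matrix under which this set is
    the preimage of a coordinate hyperplane. *)
Lemma hyperplane_null m (w : 'I_m -> R) k (d : R) : w k != 0 ->
  mu m [set x : 'rV[R]_m | \sum_i x ord0 i * w i = d] = 0%E.
Proof.
move=> wk; pose M : 'M[R]_m := \matrix_(i, j) (if j == k then w i else (i == j)%:R).
have uM : M \in unitmx.
  apply: unitmx_inj => x /rowP xM.
  have h j : j != k -> x ord0 j = 0.
    move=> jk; have := xM j; rewrite !mxE (bigD1 j)//= mxE (negbTE jk) eqxx mulr1 big1 ?addr0//.
    by move=> i ij; rewrite mxE (negbTE jk) (negbTE ij) mulr0.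
  apply/rowP => j; rewrite [RHS]mxE; have [->|] := eqVneq j k; last exact: h.
  have := xM k; rewrite !mxE (bigD1 k)//= mxE eqxx big1 ?addr0; last first.
    by move=> i ik; rewrite h// mul0r.
  by move/eqP; rewrite mulf_eq0 (negbTE wk) orbF => /eqP.
have [c hc] := lebesgue_rV_affine 0 uM.
have := hc [set x : 'rV[R]_m | x ord0 k = d] _; rewrite hyperplane_coord_null mule0 => <-.
  congr (mu m _); apply/seteqP; split => x /= <-; rewrite add0r mxE;
  by apply: eq_bigr => i _; rewrite mxE eqxx.
rewrite (_ : [set x | _] = (fun x : 'rV[R]_m => x ord0 k : measurableTypeR R) @^-1` [set d])//.
by rewrite -[X in measurable X]setTI; apply: measurable_coord.
Qed.

Lemma simplex_boundary_null (T : cell) : edges T \in unitmx ->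
  mu n.+1 (simplex T `\` osimplex T) = 0%E.
Proof.
move=> uT; apply/eqP; rewrite -measure_le0.
pose H i := [set x : point | bary T x ord0 i = 0].
have mH i : measurable (H i).
  rewrite (_ : H i = (fun x : point => bary T x ord0 i : measurableTypeR R) @^-1` [set 0])//.
  rewrite -[X in measurable X]setTI; apply: (continuous_measurable_rV (@continuous_bary _ uT i)) => //.
have H0 i : mu n.+1 (H i) = 0%E.
  have [b [w [[k wk] bw]]] := baryEaff uT i.
  by rewrite -(hyperplane_null (- b) wk); congr (mu _ _); apply/seteqP; split => x /=;
    rewrite /H/= bw => h; lra.
apply: (@le_trans _ _ (mu n.+1 (\big[setU/set0]_(i <- index_enum 'I_n.+2) H i))).
  apply: le_measure; rewrite ?inE.
  - by apply: measurableD; [exact: measurable_simplex|exact: measurable_osimplex].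
  - exact: bigsetU_measurable.
  - move=> x [/(simplex_bary uT) x0 /(osimplex_bary uT)/existsNP[i /negP xi]].
    rewrite -bigcup_seq/=; exists i; first by rewrite /= mem_index_enum.
    by apply/eqP; rewrite eq_le x0 andbT leNgt.
elim: (index_enum _) => [|i r IH]; first by rewrite big_nil measure0.
rewrite big_cons null_set_setU//; [exact: bigsetU_measurable|exact: H0|].
by apply/eqP; rewrite -measure_le0.
Qed.

End cells.

(** * Green's formula on a simplex *)

Section fubini_reference.
Context {R : realType}.
Local Notation mu := (@lebesgue_rV R).
Local Notation ref m := (@reference R m).
Local Notation cons m := (@rV_cons R m).

Lemma rV_cons0 m (s : R) (y : 'rV[R]_m) : cons m (s, y) ord0 ord0 = s.
Proof. by rewrite mxE unlift_none. Qed.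

Lemma rV_consS m (s : R) (y : 'rV[R]_m) (j : 'I_m) : cons m (s, y) ord0 (lift ord0 j) = y ord0 j.
Proof. by rewrite mxE liftK. Qed.

Lemma reference_cons m (s : R) (y : 'rV[R]_m) :
  ref m.+1 (cons m (s, y)) <-> ref m y /\ 0 < s < 1 - \sum_j y ord0 j.
Proof.
rewrite /reference/= big_ord_recl rV_cons0.
under [X in s + X]eq_bigr do rewrite rV_consS.
split=> [[h0 h1]|[[y0 y1] /andP[s0 s1]]].
  have s0 : 0 < s by have := h0 ord0; rewrite rV_cons0.
  split; last by rewrite s0 ltrBrDr.
  split=> [j|]; first by have := h0 (lift ord0 j); rewrite rV_consS.
  by apply: lt_trans h1; rewrite ltrDr.
split; last by rewrite -ltrBrDr.
by move=> i; case: (unliftP ord0 i) => [j ->|->]; rewrite ?rV_consS ?rV_cons0.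
Qed.

(** Slicing along the first coordinate: over a point of the lower-dimensional reference simplex the
    slice is a segment, ready for one-dimensional calculus. *)
Lemma integral_reference_fubini m (g : 'rV[R]_m.+1 -> R) : continuous g ->
  \int[mu m.+1]_(t in ref m.+1) g t =
  \int[mu m]_(y in ref m)
    (\int[lebesgue_measure]_(s in `]0, (1 - \sum_j y ord0 j)[) g (cons m (s, y))).
Proof.
move=> cg; pose h := (EFin \o g) \_ (ref m.+1).
have mr := @measurable_reference R.
have mg : measurable_fun setT (EFin \o g).
  by apply/measurable_EFinP; exact: continuous_measurable_rV.
have mh : measurable_fun setT h.
  by apply/(measurable_restrictT _ (mr m.+1)); apply: measurable_funTS.
have gi : (mu m.+1).-integrable (ref m.+1) (EFin \o g) by exact: reference_integrable.
have hi : (mu m.+1).-integrable setT h by apply/(integrable_mkcond _ (mr m.+1)).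
have mc := @measurable_rV_cons R m.
have hci : (lebesgue_measure \x mu m)%E.-integrable setT (h \o cons m).
  apply/integrableP; split; first exact: measurableT_comp.
  have /integrableP[_] := hi; apply: le_lt_trans.
  have := @ge0_integral_pushforward _ _ _ _ R _ mc (lebesgue_measure \x mu m)%E setT (abse \o h) measurableT _ _.
  rewrite preimage_setT => <-//; first exact: measurableT_comp.
  by move=> z _; exact: abse_ge0.
rewrite /Rintegral [in LHS]integral_mkcond [in RHS]integral_mkcond.
rewrite -/h; transitivity (fine (\int[(lebesgue_measure \x mu m)%E]_z (h \o cons m) z)).
  congr fine; have := @integral_pushforward _ _ _ _ R _ mc (lebesgue_measure \x mu m)%E setT h mh.
  by rewrite preimage_setT => /(_ hci measurableT).
rewrite -integral21_prod_meas1//; congr fine; apply: eq_integral => y _.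
rewrite /fubini_G /patch.
have [/set_mem yr|yr] := boolP (y \in ref m); last first.
  rewrite (eq_integral (cst 0%E)) ?integral0// => s _ /=; rewrite /h /patch memNset//.
  by move=> /reference_cons[/mem_set]; rewrite (negbTE yr).
have [y0 y1] := yr; set b := 1 - _; have b0 : 0 < b by rewrite subr_gt0.
have hE s : h (cons m (s, y)) = ((fun s => (g (cons m (s, y)))%:E) \_ `]0, b[) s.
  rewrite /h /patch; have [/set_mem/reference_cons[_ sb]|sb] := boolP (_ \in ref m.+1).
    by rewrite mem_set//= in_itv.
  rewrite memNset//= in_itv/= => sb'; move/negP : sb; apply; apply/mem_set/reference_cons.
  by split.
under eq_integral do rewrite /= hE.
(* The real-valued inner integral represents the extended one only if that is finite; here the
   integrand is continuous on a compact segment. *)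
rewrite -integral_mkcond fineK// integrable_fin_num//.
have cgc : continuous (fun s : R => g (cons m (s, y))).
  move=> s; apply: (@continuous_comp _ _ _ (fun s : R => cons m (s, y)) g); last exact: cg.
  rewrite (_ : (fun s : R => cons m (s, y)) = fun s => cons m (0, y) + s *: delta_mx ord0 ord0).
    apply: cvgD; first exact: cvg_cst.
    by apply: cvgZr_tmp; exact: cvg_id.
  apply/funext => r; apply/rowP => i; rewrite [RHS]mxE [X in _ = _ + X]mxE.
  case: (unliftP ord0 i) => [j ->|->]; rewrite ?rV_consS ?rV_cons0 mxE ?eqxx ?andbF ?mulr0 ?addr0 ?mulr1 ?add0r//.
have : lebesgue_measure.-integrable `[0, b] (EFin \o (fun s => g (cons m (s, y)))).
  apply: continuous_compact_integrable; first exact: segment_compact.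
  exact: continuous_subspaceT.
apply: integrableS => //; exact: subset_itv_oo_cc.
Qed.

End fubini_reference.

Section divergence.
Context {R : realType} {n : nat}.
Local Notation point := 'rV[R]_n.+1.
Local Notation cell := 'M[R]_(n.+2, n.+1).
Local Notation mu := (@lebesgue_rV R).
Local Notation ref m := (@reference R m).
Local Notation cons m := (@rV_cons R m).

(** A surface integral stripped of its Gram factor, so that integrals over one facet in two vertex
    orders are compared without comparing determinants. *)
Definition fint m (S : 'M[R]_(m.+1, n.+1)) (f : point -> R) : R :=
  \int[mu m]_(t in ref m) f (chart S t).

Lemma lift1E (j : 'I_n) : lift (lift ord0 ord0) (lift ord0 j) = lift ord0 (lift ord0 j) :> 'I_n.+2.
Proof. exact/val_inj. Qed.

Lemma lift10 : lift (lift ord0 ord0) ord0 = ord0 :> 'I_n.+2.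
Proof. exact/val_inj. Qed.

Lemma chart_entry m (S : 'M[R]_(m.+1, n.+1)) t k :
  chart S t ord0 k = S ord0 k + \sum_j t ord0 j * (S (lift ord0 j) k - S ord0 k).
Proof. by rewrite /chart !mxE; congr (_ + _); apply: eq_bigr => j _; rewrite !mxE. Qed.

(** The slice over [y] is parallel to the first edge. It starts on the face opposite to vertex 1
    and, by [chart_cons_top], ends on the face opposite to vertex 0, at the same parameter [y]. *)
Lemma chart_cons (T : cell) (s : R) (y : 'rV[R]_n) :
  chart T (cons n (s, y)) = chart (face T (lift ord0 ord0)) y + s *: row ord0 (edges T).
Proof.
apply/rowP => k; rewrite chart_entry [RHS]mxE chart_entry big_ord_recl rV_cons0.
under eq_bigr do rewrite rV_consS.
rewrite !mxE lift10 -addrA [s * _ + _]addrC; congr (_ + (_ + _)).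
by apply: eq_bigr => j _; rewrite !mxE lift1E.
Qed.

Lemma chart_cons_top (T : cell) (y : 'rV[R]_n) :
  chart T (cons n (1 - \sum_j y ord0 j, y)) = chart (face T ord0) y.
Proof.
apply/rowP => k; rewrite !chart_entry big_ord_recl rV_cons0.
under [X in _ + (_ + X) = _]eq_bigr do rewrite rV_consS.
under [in RHS]eq_bigr do rewrite !mxE.
rewrite !mxE [X in _ = _ + X](_ : _ = \sum_j y ord0 j * (T (lift ord0 (lift ord0 j)) k - T ord0 k)
   - (\sum_j y ord0 j) * (T (lift ord0 ord0) k - T ord0 k)); first by ring.
by rewrite mulr_suml -sumrB; apply: eq_bigr => j _; ring.
Qed.

(** The fundamental theorem of calculus on each slice leaves the difference of the end values, which
    are the integrands of the two face integrals. *)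
Lemma integral_edge_derivative (T : cell) (c : R) (f : point -> R) :
  (forall g : point -> R, continuous g -> \int[mu n.+1]_(x in osimplex T) g x = c * fint T g) ->
  C1 f ->
  \int[mu n.+1]_(x in osimplex T) 'D_(row ord0 (edges T)) f x =
  c * (fint (face T ord0) f - fint (face T (lift ord0 ord0)) f).
Proof.
move=> hc Cf; pose e := row ord0 (edges T).
have df x : differentiable f x by exact: C1_differentiable.
have cD : continuous (fun x => 'D_e f x).
  rewrite (_ : (fun x => _) = fun x => \sum_i e ord0 i * partial i f x).
    apply: continuous_sum_rV => i; apply: continuous_fM; first exact: cst_continuous.
    by case: Cf.
  by apply/funext => x; rewrite derive_partial.
have cf := C1_continuous Cf.
rewrite hc// /fint; congr (_ * _).
rewrite (integral_reference_fubini (continuous_chart_comp cD)).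
rewrite /fint -RintegralB; last 3 first.
- exact: measurable_reference.
- by apply: reference_integrable; exact: continuous_chart_comp.
- by apply: reference_integrable; exact: continuous_chart_comp.
apply: eq_Rintegral => y /set_mem[y0 y1].
set b := 1 - _; have b0 : 0 < b by rewrite subr_gt0.
pose p := chart (face T (lift ord0 ord0)) y.
pose h (s : R) := f (p + s *: e).
have hd (s : R) : is_derive s 1 h ('D_e f (p + s *: e)).
  have dg : is_diff s (fun s : R => p + s *: e) (fun s : R => s *: e).
    have : is_diff s (cst p + ( *:%R ^~ e : R -> point)) (0 + ( *:%R ^~ e : R -> point)) by exact: is_diffD.
    by rewrite add0r.
  have dfs : differentiable f (p + s *: e) by exact: df.
  have dh : differentiable h s.
    by apply: differentiable_comp => //; case: dg.
  apply: DeriveDef; first exact/derivable1_diffP.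
  rewrite deriveE// /h (_ : (fun s : R => _) = f \o (fun s : R => p + s *: e))//.
  have [dg1 dg2] := dg.
  by rewrite diff_comp// /= dg2 scale1r deriveE.
have ch : continuous (fun s : R => 'D_e f (p + s *: e)).
  move=> s; apply: (@continuous_comp _ _ _ (fun s : R => p + s *: e) (fun x => 'D_e f x)); last exact: cD.
  apply: cvgD; first exact: cvg_cst.
  by apply: cvgZr_tmp; exact: cvg_id.
have hcont : continuous h.
  by move=> s; apply: differentiable_continuous; apply/derivable1_diffP; have := hd s => -[].
transitivity (\int[@lebesgue_measure R]_(s in `]0, b[) 'D_e f (p + s *: e)).
  by apply: eq_Rintegral => s _; rewrite chart_cons.
rewrite /Rintegral -(@integral_itv_bndoo _ _ _ _ true false); last first.
  apply/measurable_EFinP; apply: measurable_funTS; exact: continuous_measurable_fun.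
rewrite (@continuous_FTC2 _ _ h)//.
- rewrite /= /h scale0r addr0; congr (f _ - f _).
  by rewrite -chart_cons_top chart_cons.
- exact: continuous_subspaceT.
- split.
  + by move=> s _; have := hd s => -[].
  + exact/cvg_at_right_filter/hcont.
  + exact/cvg_at_left_filter/hcont.
- by move=> s _; rewrite derive1E; have := hd s => -[].
Qed.

End divergence.

Section swap.
Context {R : realType} {n : nat}.
Local Notation point := 'rV[R]_n.+1.
Local Notation cell := 'M[R]_(n.+2, n.+1).
Local Notation mu := (@lebesgue_rV R).
Local Notation ref m := (@reference R m).

Lemma Rintegral_sum k (D : set 'rV[R]_k) I (r : seq I) (F : I -> 'rV[R]_k -> R) :
  measurable D -> (forall i, (mu k).-integrable D (EFin \o F i)) ->
  \int[mu k]_(x in D) \sum_(i <- r) F i x = \sum_(i <- r) \int[mu k]_(x in D) F i x.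
Proof.
move=> mD h; suff [] : (mu k).-integrable D (fun x => (\sum_(i <- r) F i x)%:E) /\
  \int[mu k]_(x in D) \sum_(i <- r) F i x = \sum_(i <- r) \int[mu k]_(x in D) F i x by [].
elim: r => [|i r [IH1 IH2]].
  under eq_fun do rewrite big_nil; rewrite big_nil; split; first exact: integrable0.
  by under eq_Rintegral do rewrite big_nil; rewrite Rintegral_cst// mul0r.
under eq_fun do rewrite big_cons; under eq_Rintegral do rewrite big_cons.
rewrite big_cons; split; last by rewrite RintegralD// IH2.
by have := integrableD mD (h i) IH1; apply: eq_integrable.
Qed.

(** This is |det (edges T)|. Written as a ratio of volumes it visibly depends on the open cell
    alone, not on the order of the vertices. *)
Definition cvol (T : cell) : R :=
  (\int[mu n.+1]_(x in osimplex T) 1) / \int[mu n.+1]_(t in ref n.+1) 1.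

Lemma integral_osimplex_cvol (T : cell) (f : point -> R) : edges T \in unitmx -> continuous f ->
  \int[mu n.+1]_(x in osimplex T) f x = cvol T * fint T f.
Proof.
move=> uT cf; have [c _ hc] := integral_osimplex uT; rewrite hc//; congr (_ * _).
by rewrite /cvol (hc (fun=> 1)) ?mulfK// ?gt_eqF ?volume_reference_gt0//; exact: cst_continuous.
Qed.

Lemma xrow_edges (T : cell) (i : 'I_n.+1) :
  edges (xrow (lift ord0 ord0) (lift ord0 i) T) = xrow ord0 i (edges T).
Proof.
apply/matrixP => j k; rewrite !mxE [X in _ - T X k = _]tpermD ?neq_lift//; congr (T _ k - _).
have [->|j0] := eqVneq j ord0; first by rewrite !tpermL.
have [->|ji] := eqVneq j i; first by rewrite !tpermR.
by rewrite !tpermD// ?(inj_eq lift_inj)// eq_sym.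
Qed.

Lemma bary_xrow (T : cell) a b x k : edges T \in unitmx -> edges (xrow a b T) \in unitmx ->
  bary T x ord0 k = bary (xrow a b T) x ord0 (tperm a b k).
Proof.
move=> uT uT'; have h : xcol a b (bary (xrow a b T) x) *m T = x.
  by rewrite xcolE -mulmxA -xrowE baryK.
rewrite -[in LHS]h baryE//; first by rewrite !mxE.
under eq_bigr do rewrite mxE.
by rewrite -(sum_bary (xrow a b T) x) [RHS](reindex_inj (@perm_inj _ (tperm a b))).
Qed.

(** Exchanging the vertices [lift ord0 ord0] and [lift ord0 i] reduces to the first edge: the open
    cell is unchanged and its faces are permuted. *)
Lemma edge_derivative (T : cell) (i : 'I_n.+1) (f : point -> R) : edges T \in unitmx -> C1 f ->
  \int[mu n.+1]_(x in osimplex T) 'D_(row i (edges T)) f x =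
  cvol T * (fint (face T ord0) f - fint (face T (lift ord0 i)) f).
Proof.
move=> uT Cf; pose T' := xrow (lift ord0 ord0) (lift ord0 i) T.
have uT' : edges T' \in unitmx.
  by rewrite xrow_edges xrowE unitmx_mul uT andbT unitmx_perm.
pose s := tperm (lift ord0 ord0) (lift ord0 i).
have bx x k : bary T x ord0 k = bary T' x ord0 (s k) by exact: bary_xrow.
have bx' x k : bary T' x ord0 k = bary T x ord0 (s k) by rewrite bx /s tpermK.
have e0 : row i (edges T) = row ord0 (edges T').
  by rewrite xrow_edges; apply/rowP => k; rewrite !mxE tpermL.
have s0 : s ord0 = ord0 by rewrite /s tpermD ?neq_lift.
have si : s (lift ord0 i) = lift ord0 ord0 by rewrite /s tpermR.
clearbody T' s.
have sT : simplex T = simplex T'.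
  apply/seteqP; split=> x /(simplex_bary _) h; apply/simplex_bary => // k.
    by rewrite bx'; exact: h.
  by rewrite bx; exact: h.
have oT : osimplex T = osimplex T'.
  by apply: same_simplex_osimplex sT; exact: cell_affind.
have sF j k : s j = k -> fint (face T j) f = fint (face T' k) f.
  move=> jk; have cf := C1_continuous Cf.
  have e : simplex (face T' k) = simplex (face T j).
    apply/seteqP; split=> x /simplex_face_bary[] // h0 h; apply/simplex_face_bary => //.
      by rewrite bx jk; split => // l; rewrite bx.
    by rewrite -jk -bx; split => // l; rewrite bx'.
  exact: same_simplex_integral (@face_affind _ _ _ uT' k) (@face_affind _ _ _ uT j) e f cf.
rewrite oT e0 (integral_edge_derivative (fun g => @integral_osimplex_cvol T' g uT') Cf).
rewrite (sF _ _ s0) (sF _ _ si).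
by rewrite /cvol oT.
Qed.

(** The [G i] are the coordinates of the field [F] in the basis of edge vectors, so its divergence
    is the sum of the derivatives of [G i] along the [i]-th edge. *)
Lemma divergence_simplex (T : cell) (F : 'I_n.+1 -> point -> R) : edges T \in unitmx ->
  (forall k, C1 (F k)) ->
  let G i x := \sum_k F k x * invmx (edges T) k i in
  \int[mu n.+1]_(x in osimplex T) \sum_k partial k (F k) x =
  cvol T * \sum_i (fint (face T ord0) (G i) - fint (face T (lift ord0 i)) (G i)).
Proof.
move=> uT CF G.
have CG i : C1 (G i) by apply: C1_sum => k _; apply: C1M => //; exact: C1_cst.
have pG i l x : partial l (G i) x = \sum_k invmx (edges T) k i * partial l (F k) x.
  rewrite partial_sum; last by move=> k _; apply: differentiableM; [exact: C1_differentiable|exact: differentiable_cst].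
  apply: eq_bigr => k _; rewrite partialM; [|exact: C1_differentiable|exact: differentiable_cst].
  by rewrite partial_cst mulr0 add0r.
transitivity (\int[mu n.+1]_(x in osimplex T) \sum_i 'D_(row i (edges T)) (G i) x).
  apply: eq_Rintegral => x _.
  under [RHS]eq_bigr => i _.
    rewrite derive_partial; last exact: C1_differentiable.
    under eq_bigr => l _ do rewrite pG mxE mulr_sumr.
    over.
  rewrite /= [RHS]exchange_big/= [RHS](eq_bigr (fun l => \sum_k (k == l)%:R * partial l (F k) x)).
    apply: eq_bigr => l _; rewrite (bigD1 l)//= eqxx mul1r big1 ?addr0// => k /negbTE ->.
    by rewrite mul0r.
  move=> l _; rewrite exchange_big/=; apply: eq_bigr => k _.
  under eq_bigr do rewrite mulrA [_ * invmx _ _ _]mulrC.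
  rewrite -mulr_suml; congr (_ * _).
  by have := mulVmx uT => /matrixP/(_ k l); rewrite !mxE.
rewrite Rintegral_sum; last 2 first.
- exact: measurable_osimplex.
- move=> i; apply: continuous_integrable; [|exact: measurable_osimplex|exact: bounded_osimplex].
  rewrite (_ : (fun x => _) = fun x => \sum_l row i (edges T) ord0 l * partial l (G i) x).
    apply: continuous_sum_rV => l; apply: continuous_fM; first exact: cst_continuous.
    by have [_] := CG i.
  by apply/funext => x; rewrite derive_partial//; exact: C1_differentiable.
by rewrite mulr_sumr; apply: eq_bigr => i _; rewrite edge_derivative.
Qed.

Lemma fint_sum m (S : 'M[R]_(m.+1, n.+1)) I (r : seq I) (F : I -> point -> R) :
  (forall i, continuous (F i)) ->
  fint S (fun x => \sum_(i <- r) F i x) = \sum_(i <- r) fint S (F i).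
Proof.
move=> cF; rewrite /fint Rintegral_sum//; first exact: measurable_reference.
by move=> i; apply: reference_integrable; exact: continuous_chart_comp.
Qed.

Lemma fintZ m (S : 'M[R]_(m.+1, n.+1)) (r : R) (F : point -> R) :
  continuous F -> fint S (fun x => r * F x) = r * fint S F.
Proof.
move=> cF; rewrite /fint RintegralZl//; first exact: measurable_reference.
by apply: reference_integrable; exact: continuous_chart_comp.
Qed.

Lemma eq_fint m (S : 'M[R]_(m.+1, n.+1)) (F G : point -> R) :
  (forall x, osimplex S x -> F x = G x) -> fint S F = fint S G.
Proof. by move=> h; apply: eq_Rintegral => t /set_mem rt; apply: h; exists t. Qed.

Definition garea (T : cell) j : R := Num.sqrt (\det (edges (face T j) *m (edges (face T j))^T)).

Lemma garea_neq0 (T : cell) j : edges T \in unitmx -> garea T j != 0.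
Proof. by move=> uT; rewrite gt_eqF//; apply: gram_edges_gt0; exact: face_affind. Qed.

Lemma sintE (T : cell) j f : sint (face T j) f = garea T j * fint (face T j) f.
Proof. by []. Qed.

Lemma continuous_Pk d (p : point -> R) : Pk d p -> continuous p.
Proof. by move=> /C1_Pk/C1_continuous. Qed.

(** The columns of [W] are gradients of barycentric coordinates, hence normal to the faces through
    vertex 0, and their sum is normal to the opposite face. On each face the corresponding linear
    form is constant, so [RT_normal] keeps the normal component at degree [d]. *)
Lemma RT_green (T : cell) d (p : point -> point) : edges T \in unitmx -> RT d p ->
  exists g : 'I_n.+2 -> point -> R, (forall j, Pk d (g j)) /\
  forall phi, C1 phi ->
  \int[mu n.+1]_(x in osimplex T) (dot (p x) (grad phi x) + cdiv p x * phi x) =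
  \sum_j sint (face T j) (fun x => g j x * phi x).
Proof.
move=> uT RTp; pose W := invmx (edges T).
pose u x := bary T x.
have face0 x : osimplex (face T ord0) x -> \sum_k x ord0 k * \sum_i W k i =
    1 + \sum_i (row ord0 T *m W) ord0 i.
  move=> /(osimplex_face_bary uT)[]; rewrite bc0 => /eqP; rewrite subr_eq0 => /eqP e _.
  have -> : \sum_k x ord0 k * (\sum_i W k i) = \sum_i (x *m W) ord0 i.
    under [RHS]eq_bigr do rewrite mxE.
    by rewrite exchange_big/=; apply: eq_bigr => k _; rewrite mulr_sumr.
  rewrite e -big_split/=; apply: eq_bigr => i _; rewrite mulmxBl [X in _ = X + _]mxE [X in _ = _ + X + _]mxE.
  by rewrite subrK.
have faceS i x : osimplex (face T (lift ord0 i)) x -> \sum_k x ord0 k * W k i =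
    (row ord0 T *m W) ord0 i.
  move=> /(osimplex_face_bary uT)[]; rewrite bcS mulmxBl mxE [X in _ + X]mxE => /eqP.
  by rewrite subr_eq0 => /eqP <- _; rewrite mxE.
have [P0 PkP0 hP0] := RT_normal (fun k => \sum_i W k i) (1 + \sum_i (row ord0 T *m W) ord0 i) RTp.
have /choice[P hP] : forall i, exists P, Pk d P /\ forall x : point,
    \sum_k x ord0 k * W k i = (row ord0 T *m W) ord0 i -> \sum_k p x ord0 k * W k i = P x.
  move=> i; have [Q PkQ hQ] := RT_normal (fun k => W k i) ((row ord0 T *m W) ord0 i) RTp.
  by exists Q.
(* [cvol T] comes from the volume integral and [garea] cancels the Gram factor of [sint]. The sign
   is negative on the faces through vertex 0, where the edges start. *)
exists (fun j => fun x => if unlift ord0 j is Some i then - (cvol T / garea T j) * P i x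
  else cvol T / garea T j * P0 x).
split=> [j|phi Cphi].
  by case: unliftP => [i _|_]; apply: PkZ => //; case: (hP i).
have Cp k : C1 (component p k) by exact: C1_RT RTp.
pose F k x := component p k x * phi x.
have CF k : C1 (F k) by exact: C1M.
have cphi := C1_continuous Cphi.
transitivity (\int[mu n.+1]_(x in osimplex T) \sum_k partial k (F k) x).
  apply: eq_Rintegral => x _; rewrite /dot /cdiv mulr_suml -big_split/=.
  apply: eq_bigr => k _; rewrite partialM; [|exact: C1_differentiable|exact: C1_differentiable].
  by rewrite mxE [phi x * _]mulrC.
rewrite divergence_simplex//.
have cP0 : continuous (fun x => P0 x * phi x) by apply: continuous_fM => //; exact: continuous_Pk PkP0.
have cP i : continuous (fun x => P i x * phi x).
  by apply: continuous_fM => //; have [h _] := hP i; exact: continuous_Pk h.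
rewrite [RHS]big_ord_recl unlift_none sumrB mulrBr; congr (_ + _).
  rewrite -fint_sum; last first.
    move=> i; apply: continuous_sum_rV => k; apply: continuous_fM; [exact: C1_continuous|exact: cst_continuous].
  rewrite sintE (_ : (fun x => _ * phi x) = fun x => cvol T / garea T ord0 * (P0 x * phi x)); last first.
    by apply/funext => x; rewrite mulrA.
  rewrite fintZ// mulrA mulrCA mulfV ?mulr1 ?garea_neq0//; congr (_ * _).
  apply: eq_fint => x /face0/hP0 <-; rewrite mulr_suml exchange_big/=.
  by apply: eq_bigr => k _; rewrite mulr_sumr mulr_suml; apply: eq_bigr => i _; rewrite /F /component; ring.
rewrite mulr_sumr -sumrN; apply: eq_bigr => i _.
rewrite liftK sintE.
rewrite (_ : (fun x => _ * phi x) = fun x => - (cvol T / garea T (lift ord0 i)) * (P i x * phi x)); last first.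
  by apply/funext => x; rewrite mulrA.
rewrite fintZ// mulNr mulrN mulrA mulrCA mulfV ?mulr1 ?garea_neq0//; congr (- (_ * _)).
apply: eq_fint => x /faceS; have [_ h] := hP i; move/h <-.
by rewrite mulr_suml; apply: eq_bigr => k _; rewrite /F /component; ring.
Qed.

End swap.

(** * Weak divergence and normal traces *)

Lemma null_bigsetU d (T : measurableType d) (R : realType) (nu : {measure set T -> \bar R})
    (I : Type) (r : seq I) (N : I -> set T) :
  (forall i, measurable (N i)) -> (forall i, nu (N i) = 0%E) ->
  nu (\big[setU/set0]_(i <- r) N i) = 0%E.
Proof.
move=> mN N0; elim: r => [|i r IH]; first by rewrite big_nil measure0.
by rewrite big_cons null_set_setU//; exact: bigsetU_measurable.
Qed.

Section weak_divergence.
Context {R : realType} {n : nat}.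
Local Notation point := 'rV[R]_n.+1.
Local Notation cell := 'M[R]_(n.+2, n.+1).
Local Notation mu := (@lebesgue_rV R).
Local Notation ref m := (@reference R m).
Implicit Types (D E : set point) (v w : point -> point) (d q phi : point -> R).

Lemma weak_div_ex D v d : weak_div D v d -> weak_div D v (wdiv D v).
Proof. by move=> h; apply: (@xgetPex _ (cst 0) [set d | weak_div D v d]); exists d. Qed.

Lemma Hdiv_wdiv D v : Hdiv D v -> weak_div D v (wdiv D v).
Proof. by move=> [_ [d hd]]; exact: weak_div_ex hd. Qed.

Lemma C1c_integrableM D d phi : measurable D -> bounded_set D -> L2 D d -> C1 phi ->
  (mu n.+1).-integrable D (fun x => (d x * phi x)%:E).
Proof.
by move=> mD bD Ld Cphi; apply: L2_integrableM => //; apply: L2_cont => //; exact: C1_continuous.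
Qed.

(** Uniqueness by the du Bois-Reymond lemma. It makes integrals of the chosen [wdiv] against L^2
    functions independent of the choice. *)
Lemma weak_div_ae D v d d' : open D -> bounded_set D -> weak_div D v d -> weak_div D v d' ->
  {ae mu n.+1, forall x, D x -> d x = d' x}.
Proof.
move=> oD bD [Ld hd] [Ld' hd']; have mD := open_measurable_rV oD.
have := @du_Bois_Reymond R n D (fun x => d x - d' x) oD (L2B mD Ld Ld').
move=> H; have : {ae mu n.+1, forall x, D x -> d x - d' x = 0}.
  apply: H => phi Cphi; have Cphi1 := C1c_C1 Cphi.
  under eq_Rintegral do rewrite mulrBl.
  rewrite RintegralB//; [|exact: C1c_integrableM|exact: C1c_integrableM].
  by apply/eqP; rewrite subr_eq0 -eqr_opp -hd// -hd'.
by apply: filterS => x h /h/eqP; rewrite subr_eq0 => /eqP.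
Qed.

Lemma wdiv_integral D v d q : open D -> bounded_set D -> weak_div D v d -> L2 D q ->
  \int[mu n.+1]_(x in D) (wdiv D v x * q x) = \int[mu n.+1]_(x in D) (d x * q x).
Proof.
move=> oD bD hd [mq _]; have mD := open_measurable_rV oD.
have hw := weak_div_ex hd; have := weak_div_ae oD bD hw hd.
case: hd => -[md _] _; case: hw => -[mw _] _ h.
apply: ae_eq_Rintegral => //; [exact: measurable_funM|exact: measurable_funM|].
by apply: filterS h => x hx Dx; rewrite hx.
Qed.

Lemma C1c_Rintegral_sub D E (F : point -> R) : measurable D -> measurable E -> E `<=` D ->
  (forall x, ~ E x -> F x = 0) ->
  \int[mu n.+1]_(x in E) F x = \int[mu n.+1]_(x in D) F x.
Proof.
move=> mD mE ED F0; rewrite [LHS]Rintegral_mkcond [RHS]Rintegral_mkcond.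
apply: eq_Rintegral => x _; rewrite /patch.
have [xE|xE] := boolP (x \in E); first by rewrite mem_set//; apply: ED; exact/set_mem.
by case: ifP => // _; rewrite F0//; move: xE; rewrite notin_setE.
Qed.

Lemma weak_divS D E v d : measurable D -> measurable E -> E `<=` D ->
  weak_div D v d -> weak_div E v d.
Proof.
move=> mD mE ED [Ld hd]; split; first exact: L2S Ld.
move=> phi Cphi; have CphiD := C1c_sub ED Cphi.
have [K [_ _ KE K0 K0']] := C1c_out Cphi.
rewrite (C1c_Rintegral_sub mD mE ED); last first.
  move=> x Ex; rewrite /dot big1// => i _; rewrite mxE K0' ?mulr0// => /KE.
  exact: Ex.
rewrite (C1c_Rintegral_sub mD mE ED); last by move=> x Ex; rewrite K0 ?mulr0// => /KE; exact: Ex.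
exact: hd.
Qed.

Lemma dot_integrable D v phi : measurable D -> bounded_set D ->
  (forall i, L2 D (component v i)) -> C1 phi ->
  (mu n.+1).-integrable D (fun x => (dot (v x) (grad phi x))%:E).
Proof.
move=> mD bD Lv [_ cphi].
have h i : (mu n.+1).-integrable D (fun x => (component v i x * partial i phi x)%:E).
  by apply: L2_integrableM => //; exact: L2_cont.
have := @integrable_sum _ _ R (mu n.+1) D mD _ (index_enum 'I_n.+1) xpredT
  (fun i x => (component v i x * partial i phi x)%:E) (fun i _ => h i).
apply: eq_integrable => // x _; rewrite sumEFin; congr (_%:E).
by rewrite /dot; apply: eq_bigr => i _; rewrite mxE.
Qed.

Lemma normal_pairingE D v d phi : open D -> bounded_set D -> (forall i, L2 D (component v i)) ->
  weak_div D v d -> C1 phi ->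
  normal_pairing D v phi =
  \int[mu n.+1]_(x in D) dot (v x) (grad phi x) + \int[mu n.+1]_(x in D) (d x * phi x).
Proof.
move=> oD bD Lv hd Cphi; have mD := open_measurable_rV oD.
have hw := weak_div_ex hd.
rewrite /normal_pairing RintegralD//; last 2 first.
- exact: dot_integrable.
- by apply: C1c_integrableM => //; case: hw.
congr (_ + _); apply: wdiv_integral => //.
by apply: L2_cont => //; exact: C1_continuous.
Qed.

Lemma dotBl (x y z : point) : dot (x - y) z = dot x z - dot y z.
Proof. by rewrite /dot -sumrB; apply: eq_bigr => i _; rewrite !mxE mulrBl. Qed.

Lemma weak_divB D v w d e : measurable D -> bounded_set D ->
  (forall i, L2 D (component v i)) -> (forall i, L2 D (component w i)) ->
  weak_div D v d -> weak_div D w e ->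
  weak_div D (fun x => v x - w x) (fun x => d x - e x).
Proof.
move=> mD bD Lv Lw [Ld hd] [Le he]; split; first exact: L2B.
move=> phi Cphi; have Cphi1 := C1c_C1 Cphi.
under eq_Rintegral do rewrite dotBl.
rewrite RintegralB//; [|exact: dot_integrable|exact: dot_integrable].
under [in RHS]eq_Rintegral do rewrite mulrBl.
rewrite RintegralB//; [|exact: C1c_integrableM|exact: C1c_integrableM].
by rewrite hd// he// opprB opprK addrC.
Qed.

Lemma componentB v w i : component (fun x => v x - w x) i = fun x => component v i x - component w i x.
Proof. by apply/funext => x; rewrite /component !mxE. Qed.

(** The face moments of a reconstruction concern a trace of the difference of two fields, while the
    coupling condition and Green's formula supply the traces of each field. *)
Lemma normal_traceB (T : cell) v w g h : edges T \in unitmx ->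
  normal_trace T v g -> normal_trace T w h ->
  normal_trace T (fun x => v x - w x) (fun j x => g j x - h j x).
Proof.
move=> uT [[Lv [d hd]] Lg hg] [[Lw [e he]] Lh hh].
have oT := open_osimplex uT; have mT := measurable_osimplex uT; have bT := bounded_osimplex T.
have Lvw i : L2 (osimplex T) (component (fun x => v x - w x) i).
  by rewrite componentB; exact: L2B.
have hde := weak_divB mT bT Lv Lw hd he.
split.
- by split => //; exists (fun x => d x - e x).
- move=> j; apply: (@L2B R n (ref n) (g j \o chart (face T j)) (h j \o chart (face T j))) => //; exact: measurable_reference.
- move=> phi Cphi; have Cphi1 := C1c_C1 Cphi.
  have cphi := C1_continuous Cphi1.
  transitivity (normal_pairing (osimplex T) v phi - normal_pairing (osimplex T) w phi).
    rewrite (normal_pairingE oT bT Lvw hde)// (normal_pairingE oT bT Lv hd)// (normal_pairingE oT bT Lw he)//.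
    under eq_Rintegral do rewrite dotBl.
    rewrite RintegralB//; [|exact: dot_integrable|exact: dot_integrable].
    under [X in _ + X = _]eq_Rintegral do rewrite mulrBl.
    rewrite RintegralB//; first by ring.
    + by apply: C1c_integrableM => //; case: hd.
    + by apply: C1c_integrableM => //; case: he.
  rewrite hg// hh// -sumrB; apply: eq_bigr => j _.
  rewrite !sintE -mulrBr; congr (_ * _); rewrite /fint -RintegralB.
  + by apply: eq_Rintegral => t _; rewrite mulrBl.
  + exact: measurable_reference.
  + apply: (@L2_integrableM R n _ (g j \o chart (face T j)) (fun t => phi (chart (face T j) t))) => //.
      exact: measurable_reference.
    by apply: L2_cont; [exact: continuous_chart_comp|exact: measurable_reference|exact: bounded_reference].
  + apply: (@L2_integrableM R n _ (h j \o chart (face T j)) (fun t => phi (chart (face T j) t))) => //.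
      exact: measurable_reference.
    by apply: L2_cont; [exact: continuous_chart_comp|exact: measurable_reference|exact: bounded_reference].
Qed.

Lemma osimplex_face_disj (T : cell) j x : edges T \in unitmx ->
  osimplex (face T j) x -> ~ osimplex T x.
Proof.
move=> uT /(osimplex_face_bary uT)[xj _] /(osimplex_bary uT)/(_ j).
by rewrite xj ltxx.
Qed.

Lemma eq_fieldE D v p phi : (forall x, D x -> v x = p x) ->
  \int[mu n.+1]_(x in D) dot (v x) (grad phi x) = \int[mu n.+1]_(x in D) dot (p x) (grad phi x).
Proof. by move=> h; apply: eq_Rintegral => x /set_mem/h ->. Qed.

(** Green's formula does both: test functions supported in the open cell see no face and identify
    the weak divergence, and general ones then give the normal traces. *)
Lemma RT_normal_trace (T : cell) (d : nat) w (p : point -> point) : edges T \in unitmx -> RT d.+1 p ->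
  (forall x, osimplex T x -> w x = p x) ->
  weak_div (osimplex T) w (cdiv p) /\
  exists g : 'I_n.+2 -> point -> R, (forall j, Pk d.+1 (g j)) /\ normal_trace T w g.
Proof.
move=> uT RTp wp.
have oT := open_osimplex uT; have mT := measurable_osimplex uT; have bT := bounded_osimplex T.
have [g [Pg hg]] := RT_green uT RTp.
have Lp i : L2 (osimplex T) (component p i).
  by apply: L2_cont => //; apply: C1_continuous; exact: C1_RT RTp.
have Lw i : L2 (osimplex T) (component w i).
  by apply: eq_L2 (Lp i) => // x /set_mem xT; rewrite /component wp.
have Ld : L2 (osimplex T) (cdiv p).
  by apply: L2_cont => //; exact: continuous_Pk (Pk_cdiv_RT RTp).
have green phi : C1 phi ->
    \int[mu n.+1]_(x in osimplex T) dot (w x) (grad phi x) +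
    \int[mu n.+1]_(x in osimplex T) (cdiv p x * phi x) =
    \sum_j sint (face T j) (fun x => g j x * phi x).
  move=> Cphi; rewrite -hg// RintegralD//; [|exact: dot_integrable|exact: C1c_integrableM].
  by rewrite (eq_fieldE _ wp).
have wd : weak_div (osimplex T) w (cdiv p).
  split => // phi Cphi; have [K [_ _ KT K0 _]] := C1c_out Cphi.
  have /eqP := green _ (C1c_C1 Cphi); rewrite big1; first by rewrite addr_eq0 => /eqP.
  move=> j _; rewrite sintE (_ : fint _ _ = 0) ?mulr0//.
  rewrite (@eq_fint _ _ _ _ _ (fun=> 0)); first by rewrite /fint Rintegral_cst ?mul0r//; exact: measurable_reference.
  by move=> x xj; rewrite K0 ?mulr0// => /KT; exact: osimplex_face_disj xj.
split => //; exists g; split => //; split.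
- by split => //; exists (cdiv p).
- move=> j; apply: L2_cont; [|exact: measurable_reference|exact: bounded_reference].
  by apply: continuous_chart_comp; exact: continuous_Pk (Pg j).
- move=> phi Cphi; have Cphi1 := C1c_C1 Cphi.
  by rewrite (normal_pairingE oT bT Lw wd)// green.
Qed.

End weak_divergence.

(** * Meshes *)

Section mesh.
Context {R : realType} {n : nat}.
Local Notation point := 'rV[R]_n.+1.
Local Notation cell := 'M[R]_(n.+2, n.+1).
Local Notation mu := (@lebesgue_rV R).
Local Notation ref m := (@reference R m).

(** What a triangulation says about a single subdomain. [mesh_regular] is what puts the open cells
    inside [D] and not merely inside its closure. *)
Record mesh (D : set point) (s : seq cell) : Prop := Mesh {
  mesh_open : open D;
  mesh_bounded : bounded_set D;
  mesh_regular : interior (closure D) = D;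
  mesh_uniq : uniq s;
  mesh_unit : forall T, T \in s -> edges T \in unitmx;
  mesh_disj : forall T T', T \in s -> T' \in s -> T != T' -> osimplex T `&` osimplex T' = set0;
  mesh_covers : covers s D }.

Variables (D : set point) (s : seq cell).
Hypothesis Ds : mesh D s.

Let oD := mesh_open Ds.
Let mD : measurable D := open_measurable_rV oD.
Let bD := mesh_bounded Ds.
Let us := mesh_unit Ds.

Lemma mesh_measurable : measurable D. Proof. exact: mD. Qed.

Lemma mesh_simplex_closure T : T \in s -> simplex T `<=` closure D.
Proof. by move=> Ts x Tx; rewrite (mesh_covers Ds); exists T. Qed.

Lemma mesh_osimplex_sub T : T \in s -> osimplex T `<=` D.
Proof.
move=> Ts; rewrite -(mesh_regular Ds) -open_subsetE; last exact/open_osimplex/us.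
by apply: subset_trans (@osimplex_sub _ _ _ T) _; exact: mesh_simplex_closure.
Qed.

(** The open cells are disjoint and exhaust [D] up to cell boundaries, which are null. *)
Lemma Rintegral_mesh (f : point -> R) : (mu n.+1).-integrable D (EFin \o f) ->
  \int[mu n.+1]_(x in D) f x = \sum_(T <- s) \int[mu n.+1]_(x in osimplex T) f x.
Proof.
move=> fi; pose F T := if T \in s then osimplex T else set0.
have mF T : measurable (F T).
  by rewrite /F; case: ifP => // Ts; apply: measurable_osimplex; exact: us.
pose U := \big[setU/set0]_(T <- s) F T.
have UE : U = [set x | exists2 T, T \in s & osimplex T x].
  rewrite /U -bigcup_seq; apply/seteqP; split=> x [T Ts].
    by rewrite /F; move: (Ts) => /= ->; exists T.
  by exists T => //; rewrite /F Ts.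
have mU : measurable U by exact: bigsetU_measurable.
have UD : U `<=` D by rewrite UE => x [T Ts]; exact: mesh_osimplex_sub.
have null : mu n.+1 (D `\` U) = 0%E.
  pose N T : set point := if T \in s then simplex T `\` osimplex T else set0.
  have mN T : measurable (N T).
    rewrite /N; case: ifP => // Ts; apply: measurableD; [apply: measurable_simplex; exact: us|apply: measurable_osimplex; exact: us].
  have N0 T : mu n.+1 (N T) = 0%E.
    by rewrite /N; case: ifP => [Ts|_]; [apply: simplex_boundary_null; exact: us|exact: measure0].
  apply: (@subset_measure0 _ _ _ (mu n.+1) _ (\big[setU/set0]_(T <- s) N T)).
  - exact: measurableD.
  - exact: bigsetU_measurable.
  - move=> x [Dx Ux]; have : closure D x by exact: subset_closure.
    rewrite (mesh_covers Ds) => -[T Ts Tx]; rewrite -bigcup_seq; exists T => //.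
    by rewrite /N Ts; split => // oTx; apply: Ux; rewrite UE; exists T.
  - exact: null_bigsetU.
rewrite -(Rintegral_diff_null mD (measurableD mD mU) null fi).
rewrite (_ : D `\` (D `\` U) = U); last by rewrite setDD; apply/setIidPr.
rewrite /U Rintegral_bigsetU//.
- by rewrite !big_seq; apply: eq_bigr => T Ts; rewrite /F Ts.
- exact: mesh_uniq Ds.
- apply/trivIsetP => T T' /= Ts Ts' TT'; rewrite /F Ts Ts'; exact: (mesh_disj Ds).
- exact: integrableS fi.
Qed.

(** [wdiv D w] and the [wdiv] of a cell are separate choices; the former is still a weak divergence
    on the cell, so [normal_pairingE] may use it there. *)
Lemma normal_pairing_mesh (w : point -> point) phi : Hdiv D w -> C1 phi ->
  normal_pairing D w phi = \sum_(T <- s) normal_pairing (osimplex T) w phi.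
Proof.
move=> Hw Cphi; have [Lw _] := Hw; have hw := Hdiv_wdiv Hw.
have idot : (mu n.+1).-integrable D (fun x => (dot (w x) (grad phi x))%:E) by exact: dot_integrable.
have idiv : (mu n.+1).-integrable D (fun x => (wdiv D w x * phi x)%:E).
  by apply: C1c_integrableM => //; case: hw.
rewrite {1}/normal_pairing Rintegral_mesh; last first.
  by have := integrableD mD idot idiv; apply: eq_integrable => // x _; rewrite /= EFinD.
rewrite [LHS]big_seq [RHS]big_seq; apply: eq_bigr => T Ts; have uT := us Ts.
have sT := mesh_osimplex_sub Ts; have mT := measurable_osimplex uT; have bT := bounded_osimplex T.
have LwT i : L2 (osimplex T) (component w i) by exact: L2S (Lw i).
have hwT := weak_divS mD mT sT hw.
rewrite (normal_pairingE (open_osimplex uT) bT LwT hwT)//.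
rewrite RintegralD//; [exact: integrableS idot|exact: integrableS idiv].
Qed.

Lemma broken_traces d (w : point -> point) : broken s (RT d.+1) w ->
  exists g : cell -> 'I_n.+2 -> point -> R, forall T, T \in s ->
    (forall j, Pk d.+1 (g T j)) /\ normal_trace T w (g T).
Proof.
move=> bw; have H T : exists g : 'I_n.+2 -> point -> R, T \in s ->
    (forall j, Pk d.+1 (g j)) /\ normal_trace T w g.
  have [Ts|] := boolP (T \in s); last by exists (fun _ _ => 0).
  have [p RTp wp] := bw T Ts.
  by have [_ [g hg]] := RT_normal_trace (us Ts) RTp wp; exists g.
by have [g hg] := choice H; exists g.
Qed.

End mesh.

(** * Facets of a conforming mesh *)

Section faces.
Context {R : realType} {n : nat}.
Local Notation point := 'rV[R]_n.+1.
Local Notation cell := 'M[R]_(n.+2, n.+1).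

Lemma simplex_face_sub (T : cell) j : simplex (face T j) `<=` simplex T.
Proof.
move=> x /simplexP[t [t0 t1 ->]]; apply/simplexP; exists (extend j t).
rewrite sum_extend extend_face; split => // i.
by case: (unliftP j i) => [k ->|->]; rewrite ?extend_lift ?extend_self.
Qed.

Variable s : seq cell.
Hypothesis us : forall T, T \in s -> edges T \in unitmx.
Hypothesis cs : conforming s.

(** Otherwise the centre of [T] lies in the closure of [osimplex T'], and the two open cells
    meet. *)
Lemma simplex_not_sub (T T' : cell) : T \in s -> T' \in s -> T != T' -> ~ simplex T `<=` simplex T'.
Proof.
move=> Ts T's TT' sub; have [disj _] := proj2 cs _ _ Ts T's TT'.
have cT := osimplex_center (us Ts).
have : closure (osimplex T') (center T).
  apply: simplex_sub_closure; first exact: us.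
  by apply: sub; exact: osimplex_sub.
move=> /(_ (osimplex T)) []; first by apply: open_nbhs_nbhs; split => //; apply: open_osimplex; exact: us.
by move=> y [y1 y2]; have : (osimplex T `&` osimplex T') y by []; rewrite disj.
Qed.

Lemma face_vertices (T : cell) j (x : point) (A : {set 'I_n.+2}) : edges T \in unitmx -> osimplex (face T j) x -> hull T A x ->
  forall i, i != j -> i \in A.
Proof.
move=> uT /(osimplex_face_bary uT)[_ x0] /(hull_bary uT)[_ xA] i ij.
by apply: contraT => iA; have := x0 i ij; rewrite xA// ltxx.
Qed.

Lemma hull_sub m (S : 'M[R]_(m, n.+1)) (A B : {set 'I_m}) : (forall i, i \in A -> i \in B) ->
  hull S A `<=` hull S B.
Proof.
move=> AB x [t [t0 tA t1 ->]]; exists t; split => // i iB; apply: tA.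
by apply: contra iB; exact: AB.
Qed.

(** The common face of the two cells contains [x], whose coordinates other than the [j]-th are
    positive, so it has all vertices of the face. By [simplex_not_sub] it is a full cell on neither
    side. *)
Lemma face_meet T T' j x : T \in s -> T' \in s -> T != T' ->
  osimplex (face T j) x -> simplex T' x ->
  exists A', simplex (face T j) = hull T' A' /\ exists j1, j1 \notin A'.
Proof.
move=> Ts T's TT' xj xT'.
have [_ [A [A' [E1 E2]]]] := proj2 cs _ _ Ts T's TT'.
have xA : hull T A x.
  by rewrite -E1; split => //; apply: (@simplex_face_sub T j); exact: osimplex_sub.
have Aj := face_vertices (us Ts) xj xA.
have jA : j \notin A.
  apply/negP => jA; apply: (simplex_not_sub Ts T's TT') => y yT.
  suff : hull T A y by rewrite -E1 => -[].
  by rewrite (hull_full (us Ts))// => i; have [->//|/Aj] := eqVneq i j.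
have hA : hull T A = simplex (face T j).
  apply: (hull_face (us Ts)) => i; have [->|ij] := eqVneq i j; first exact/negbTE.
  by rewrite Aj.
exists A'; rewrite -hA; split => //; apply/existsP; rewrite -[X in is_true X]negbK negb_exists.
apply/negP => /forallP A'full.
apply: (simplex_not_sub T's Ts); first by rewrite eq_sym.
move=> y yT'; suff : hull T' A' y by rewrite -E2 -E1 => -[].
by rewrite (hull_full (us T's))// => i; have := A'full i; rewrite negbK.
Qed.

Lemma face_sub_simplex T T' j x : T \in s -> T' \in s -> T != T' ->
  osimplex (face T j) x -> simplex T' x -> simplex (face T j) `<=` simplex T'.
Proof.
move=> Ts T's TT' xj xT'; have [A' [-> _]] := face_meet Ts T's TT' xj xT'.
by apply: hull_sub => i _; rewrite inE.
Qed.

(** For distinct cells, the face of [T] is the hull of a proper vertex set [A'] of [T']. Counting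
    dimensions shows that [A'] omits exactly one vertex, so the face is a facet of [T'], and [x]
    identifies it as the [j']-th one. *)
Lemma same_face T T' j j' x : T \in s -> T' \in s ->
  osimplex (face T j) x -> simplex (face T' j') x ->
  simplex (face T j) = simplex (face T' j').
Proof.
move=> Ts T's xj xj'; have uT := us Ts; have uT' := us T's.
have [TT'|TT'] := eqVneq T T'.
  move: xj xj' => /(osimplex_face_bary uT)[_ x0]; rewrite -TT' => /(simplex_face_bary uT)[x'0 _].
  by have [->//|/x0] := eqVneq j' j; rewrite x'0 ltxx.
have [A' [hE [j1 j1A']]] := face_meet Ts T's TT' xj (@simplex_face_sub _ _ _ xj').
have A'j1 i : i != j1 -> i \in A'.
  move=> ij1; apply: contraT => iA'.
  have [|M [sM M0 hM]] := @hull_stochastic R n _ _ T' (face T j) A'; first by rewrite hE.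
  (* Column [j1] of [M] is zero, and without it [M] is square and invertible; a second vertex
     outside [A'] would produce a zero column. *)
  have uM : col' j1 M \in unitmx.
    apply: unitmx_inj => t tM; apply: (stochastic_affind sM hM (@face_affind _ _ _ uT j)).
    apply/rowP => k; rewrite mxE [RHS]mxE; case: (unliftP j1 k) => [l ->|->].
      have /rowP/(_ l) := tM; rewrite mxE [RHS]mxE; apply: etrans.
      by apply: eq_bigr => m _; rewrite !mxE.
    by rewrite big1// => m _; rewrite M0// mulr0.
  move: ij1 iA'; case: (unliftP j1 i) => [k ->|->]; last by rewrite eqxx.
  move=> _ kA'; have : delta_mx k ord0 = 0 :> 'cV[R]_n.+1.
    rewrite -[LHS](mulKmx uM) -colE (_ : col k _ = 0) ?mulmx0//.
    by apply/colP => m; rewrite !mxE M0.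
  by move=> /matrixP/(_ k ord0); rewrite !mxE !eqxx => /eqP; rewrite oner_eq0.
have h1 : hull T' A' = simplex (face T' j1).
  apply: (hull_face uT') => i; have [->|ij] := eqVneq i j1; first exact/negbTE.
  by rewrite A'j1.
rewrite hE h1; move: xj; rewrite (same_simplex_osimplex (@face_affind _ _ _ uT j)
  (@face_affind _ _ _ uT' j1)) ?hE//.
move=> /(osimplex_face_bary uT')[_ x0]; move: xj' => /(simplex_face_bary uT')[x'0 _].
by have [->//|/x0] := eqVneq j' j1; rewrite x'0 ltxx.
Qed.

End faces.

(** * Jumps of the normal trace *)

(** Removing the whole class of the first element preserves the hypothesis for the rest, which
    allows induction on the length. *)
Lemma sum_classes0 (V : zmodType) (I : eqType) (same : rel I) (a : I -> V) (r : seq I) :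
  reflexive same -> symmetric same -> transitive same ->
  (forall p, p \in r -> \sum_(q <- r | same p q) a q = 0) -> \sum_(q <- r) a q = 0.
Proof.
move=> rf sy tr; have [m] := ubnP (size r); elim: m r => // m IH [|p r] /= hm h.
  by rewrite big_nil.
rewrite (bigID (same p))/= h ?mem_head// add0r -big_filter; apply: IH.
  rewrite ltnS in hm; apply: leq_ltn_trans hm.
  by rewrite /= rf /= size_filter count_size.
move=> q; rewrite mem_filter => /andP[pq qr].
rewrite big_filter_cond/= -[RHS](h q qr); apply: eq_bigl => x.
have [qx|//] := boolP (same q x); last by rewrite andbF.
by rewrite andbT; apply: contra pq => px; apply: tr px _; rewrite sy.
Qed.

Section vanishing.
Context {R : realType} {m : nat}.
Local Notation point := 'rV[R]_m.
Local Notation mu := (lebesgue_rV m).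

Lemma ae_open_eq0 (D : set point) (f : point -> R) : open D -> continuous f ->
  {ae mu, forall x, D x -> f x = 0} -> forall x, D x -> f x = 0.
Proof.
move=> oD cf h x Dx; apply/eqP; apply: contraT => fx.
pose U := D `&` f @^-1` [set y | y != 0].
have oU : open U.
  by apply: openI => //; apply: open_comp; [move=> y _; exact: cf|exact: open_neq].
have := @lebesgue_rV_open_gt0 R m U oU; move=> /(_ (ex_intro _ x (conj Dx fx))).
rewrite (_ : mu U = 0%E) ?ltxx//.
apply/negligibleP; first exact: open_measurable_rV.
by apply: negligibleS h => y [Dy /eqP fy] /(_ Dy).
Qed.

(** The square root of [f] has zero L^2 norm, so it vanishes almost everywhere and, by continuity,
    everywhere on the open set. *)
Lemma integral_ge0_eq0 (D : set point) (f : point -> R) : open D -> bounded_set D ->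
  continuous f -> (forall x, 0 <= f x) -> \int[mu]_(x in D) f x = 0 ->
  forall x, D x -> f x = 0.
Proof.
move=> oD bD cf f0 h x Dx; have mD := open_measurable_rV oD.
have cs : continuous (fun y => Num.sqrt (f y)).
  by move=> y; apply: (@continuous_comp _ _ _ f Num.sqrt); [exact: cf|exact: sqrt_continuous].
have : Num.sqrt (f x) = 0.
  move: x Dx; apply: ae_open_eq0 => //; apply: L2_sqr_eq0 => //; first exact: L2_cont.
  by rewrite -[RHS]h; apply: eq_Rintegral => y _; rewrite -expr2 sqr_sqrtr.
by move=> /eqP; rewrite sqrtr_eq0 => fx; apply/eqP; rewrite eq_le fx f0.
Qed.

End vanishing.

Section flux_classes.
Context {R : realType} {n : nat}.
Local Notation point := 'rV[R]_n.+1.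
Local Notation cell := 'M[R]_(n.+2, n.+1).

(** A geometric facet is a class of pairs (cell, index) under this relation, with one pair for each
    adjacent cell. *)
Definition same_facet (p q : cell * 'I_n.+2) : bool :=
  `[< simplex (face p.1 p.2) = simplex (face q.1 q.2) >].

Lemma same_facet_refl : reflexive same_facet. Proof. by move=> p; exact/asboolP. Qed.

Lemma same_facet_sym : symmetric same_facet.
Proof. by move=> p q; apply/asboolP/asboolP => ->. Qed.

Lemma same_facet_trans : transitive same_facet.
Proof. by move=> p q r /asboolP qp /asboolP pr; apply/asboolP; rewrite qp. Qed.

Definition facets (s : seq cell) := [seq (T, j) | T <- s, j <- enum 'I_n.+2].

Lemma mem_facets s p : (p \in facets s) = (p.1 \in s).
Proof.
case: p => T j; apply/allpairsP/idP => [[[T' j'] /= [Ts _ [-> _]]]//|Ts].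
by exists (T, j); rewrite mem_enum.
Qed.

Lemma sum_facets s (F : cell -> 'I_n.+2 -> R) (P : cell -> pred 'I_n.+2) :
  \sum_(T <- s) \sum_(j | P T j) F T j = \sum_(p <- facets s | P p.1 p.2) F p.1 p.2.
Proof.
rewrite [RHS]big_mkcond /facets big_allpairs_dep; apply: eq_bigr => T _.
by rewrite big_enum/= big_mkcond.
Qed.

Variables (s : seq cell) (d : nat) (g : cell -> 'I_n.+2 -> point -> R).
Hypothesis us : forall T, T \in s -> edges T \in unitmx.
Hypothesis cs : conforming s.
Hypothesis Pg : forall T j, Pk d (g T j).

Definition facet_flux phi (p : cell * 'I_n.+2) :=
  sint (face p.1 p.2) (fun x => g p.1 p.2 x * phi x).

(** Traces are outward from each cell, so their sum over the adjacent cells is the jump, here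
    weighted by [garea]. It is a polynomial on the whole space and can therefore enter a test
    function or a multiplier. *)
Definition jump p (x : point) : R :=
  \sum_(q <- facets s | same_facet p q) garea q.1 q.2 * g q.1 q.2 x.

Lemma Pk_jump p : Pk d (jump p).
Proof. by apply: Pk_sum => q _; apply: PkZ; exact: Pg. Qed.

Lemma fint_same p q f : p \in facets s -> q \in facets s -> same_facet p q -> continuous f ->
  fint (face q.1 q.2) f = fint (face p.1 p.2) f.
Proof.
rewrite !mem_facets => ps qs /asboolP pq cf; apply: same_simplex_integral => //.
- by apply: face_affind; exact: us.
- by apply: face_affind; exact: us.
Qed.

Lemma sum_class phi p : p \in facets s -> continuous phi ->
  \sum_(q <- facets s | same_facet p q) facet_flux phi q =
  fint (face p.1 p.2) (fun x => jump p x * phi x).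
Proof.
move=> ps cphi; have cg q : continuous (g q.1 q.2) by exact: continuous_Pk (Pg _ _).
have cgp q : continuous (fun x => g q.1 q.2 x * phi x) by exact: continuous_fM.
transitivity (\sum_(q <- [seq q <- facets s | same_facet p q])
    fint (face p.1 p.2) (fun x => garea q.1 q.2 * (g q.1 q.2 x * phi x))).
  rewrite -[LHS]big_filter; apply: eq_big_seq => q; rewrite mem_filter => /andP[pq qs].
  by rewrite /facet_flux sintE (fint_same ps qs pq)// fintZ.
rewrite -fint_sum.
  apply: eq_fint => x _; rewrite /jump big_filter mulr_suml.
  by apply: eq_bigr => q _; rewrite mulrA.
move=> q; apply: continuous_fM => //; exact: cst_continuous.
Qed.

Lemma closed_simplex_face (T : cell) j : edges T \in unitmx -> closed (simplex (face T j)).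
Proof.
move=> uT; rewrite (_ : simplex _ = simplex T `&` (fun x => bary T x ord0 j) @^-1` [set 0]).
  apply: closedI; first exact: closed_simplex.
  by apply: closed_comp; [move=> x _; exact: continuous_bary|exact: closed_eq].
apply/seteqP; split=> x; rewrite /= simplex_face_bary// simplex_bary//; by case.
Qed.

Lemma facet_flux_eq0 phi p : (forall x, osimplex (face p.1 p.2) x -> phi x = 0) ->
  facet_flux phi p = 0.
Proof.
move=> h; rewrite /facet_flux sintE (@eq_fint _ _ _ _ _ (fun=> 0)).
  by rewrite /fint Rintegral_cst ?mul0r ?mulr0//; exact: measurable_reference.
by move=> x /h ->; rewrite mulr0.
Qed.

Lemma same_facet_point p q x : p \in facets s -> q \in facets s ->
  osimplex (face p.1 p.2) x -> simplex (face q.1 q.2) x -> same_facet p q.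
Proof. by rewrite !mem_facets => ps qs px qx; apply/asboolP; exact: (same_face us cs ps qs px qx). Qed.

Lemma fint_sqr_eq0 (p : cell * 'I_n.+2) (f b : point -> R) : continuous f -> continuous b -> (forall x, 0 <= b x) ->
  fint (face p.1 p.2) (fun x => f x * (f x * b x)) = 0 ->
  forall x, osimplex (face p.1 p.2) x -> 0 < b x -> f x = 0.
Proof.
move=> cf cb b0 h x [t rt <-{x}] bt.
have := @integral_ge0_eq0 R n (@reference R n) (fun t => f (chart (face p.1 p.2) t) *
  (f (chart (face p.1 p.2) t) * b (chart (face p.1 p.2) t))) (@open_reference R n) (@bounded_reference R n).
move=> /(_ _ _ h t rt) /eqP H.
have : f (chart (face p.1 p.2) t) * (f (chart (face p.1 p.2) t) * b (chart (face p.1 p.2) t)) == 0.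
  apply: H => [|y]; last by rewrite mulrA mulr_ge0// -expr2 sqr_ge0.
  apply: (@continuous_chart_comp R n n (face p.1 p.2) (fun x => f x * (f x * b x))).
  by apply: continuous_fM => //; exact: continuous_fM.
by rewrite !mulf_eq0 (gt_eqF bt) orbF orbb => /eqP.
Qed.

(* Testing with a bump function supported away from the other facets isolates
   the jump across a single facet. *)
Lemma jump_local (G : set point) p x : closed G ->
  (forall phi, C1c (~` G) phi -> \sum_(q <- facets s) facet_flux phi q = 0) ->
  p \in facets s -> osimplex (face p.1 p.2) x -> ~ G x -> jump p x = 0.
Proof.
move=> clG h ps px Gx.
pose C := G `|` \bigcup_(q in [set` [seq q <- facets s | ~~ same_facet p q]]) simplex (face q.1 q.2).
have clC : closed C.
  apply: closedU => //; apply: closed_bigcup; first exact: finite_seq.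
  by move=> q /=; rewrite mem_filter mem_facets => /andP[_ qs]; apply: closed_simplex_face; exact: us.
have Cx : (~` C) x.
  move=> [//|[q /=]]; rewrite mem_filter => /andP[/negP pq qs] qx.
  by apply: pq; exact: same_facet_point qx.
have /nbhs_ballP[e /= e0 eC] : nbhs x (~` C).
  by apply: open_nbhs_nbhs; split => //; exact: closed_openC.
pose r := e / 2; have r0 : 0 < r by rewrite divr_gt0.
have Cb : C1c (~` C) (bump x r).
  by apply: C1c_bump => //; rewrite (_ : r *+ 2 = e)// /r -mulr_natr divfK.
have cj : continuous (jump p) by exact: continuous_Pk (Pk_jump p).
have Cphi : C1c (~` C) (fun y => jump p y * bump x r y).
  by apply: C1c_mull => //; exact: C1_Pk (Pk_jump p).
have [K [_ _ KC K0 _]] := C1c_out Cphi.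
have CG : ~` C `<=` ~` G by apply: subsetC; exact: subsetUl.
have := h _ (C1c_sub CG Cphi).
rewrite (bigID (same_facet p))/= [X in _ + X]big_seq_cond [X in _ + X]big1 ?addr0; last first.
  move=> q /andP[qs pq]; apply: facet_flux_eq0 => y yq; apply: K0 => /KC; apply.
  by right; exists q; [rewrite /= mem_filter qs pq|exact: osimplex_sub].
have cb : continuous (bump x r) by apply: C1_continuous; exact: C1_bump.
rewrite sum_class//; last exact: continuous_fM.
move=> /fint_sqr_eq0 H; apply: (H cj cb) => //; first by move=> y; exact: bump_ge0.
by apply/(bump_gt0 x x r0); exact: ballxx.
Qed.

Lemma eq_facet_flux phi psi p : (forall x, osimplex (face p.1 p.2) x -> phi x = psi x) ->
  facet_flux phi p = facet_flux psi p.
Proof.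
by move=> h; rewrite /facet_flux !sintE; congr (_ * _); apply: eq_fint => x /h ->.
Qed.

Lemma same_facet_osimplex p q : p \in facets s -> q \in facets s -> same_facet p q ->
  osimplex (face p.1 p.2) = osimplex (face q.1 q.2).
Proof.
rewrite !mem_facets => ps qs /asboolP pq; apply: same_simplex_osimplex => //.
- by apply: face_affind; exact: us.
- by apply: face_affind; exact: us.
Qed.

(** Multipliers need not match across facets, so the jump can be cut off sharply to one facet, where
    a test function requires a bump. The first hypothesis on [G] says that it selects whole
    facets. *)
Lemma jump_coupled (G : pred (cell * 'I_n.+2)) p x :
  (forall q q', same_facet q q' -> G q -> G q') ->
  (forall l, (forall q, q \in facets s -> G q ->
     exists2 f, Pk d f & forall y, osimplex (face q.1 q.2) y -> l y = f y) ->
   \sum_(q <- facets s | G q) facet_flux l q = 0) ->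
  p \in facets s -> osimplex (face p.1 p.2) x -> G p -> jump p x = 0.
Proof.
move=> Gs h ps px Gp.
(* the multiplier is the jump itself, supported on the single facet [p] *)
pose l y := if y \in osimplex (face p.1 p.2) then jump p y else 0.
have lE q : q \in facets s -> forall y, osimplex (face q.1 q.2) y ->
    l y = if same_facet p q then jump p y else 0.
  move=> qs y yq; rewrite /l; have [pq|pq] := boolP (same_facet p q).
    by rewrite (same_facet_osimplex ps qs pq) mem_set.
  rewrite memNset// => yp; move/negP: pq; apply; apply: (same_facet_point ps qs yp).
  exact: osimplex_sub.
have cj : continuous (jump p) by exact: continuous_Pk (Pk_jump p).
have c1 : continuous (fun _ : point => 1 : R) by move=> y; exact: cst_continuous.
have := h l; rewrite (bigID (same_facet p))/= [X in _ + X]big_seq_cond [X in _ + X]big1 ?addr0; last first.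
  move=> q /andP[qs /andP[_ pq]]; apply: facet_flux_eq0 => y /lE ->//.
  by rewrite (negbTE pq).
rewrite (eq_bigl (same_facet p)); last first.
  by move=> q /=; apply/andP/idP => [[]//|pq]; split => //; exact: Gs pq Gp.
rewrite big_seq_cond (eq_bigr (facet_flux (jump p))); last first.
  by move=> q /andP[qs pq]; apply: eq_facet_flux => y /lE ->//; rewrite pq.
rewrite -big_seq_cond sum_class// => H.
apply: (@fint_sqr_eq0 p (jump p) (fun=> 1)) => //.
rewrite -[RHS]H; first by apply: eq_fint => y _; rewrite mulr1.
move=> q qs Gq; exists (fun y => if same_facet p q then jump p y else 0); last exact: lE.
by case: (same_facet p q); [exact: Pk_jump|exact: Pk_cst].
Qed.

Lemma sum_facet_flux0 phi :
  (forall p x, p \in facets s -> osimplex (face p.1 p.2) x -> jump p x = 0) ->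
  continuous phi -> \sum_(p <- facets s) facet_flux phi p = 0.
Proof.
move=> j0 cphi; apply: (@sum_classes0 _ _ same_facet); [exact: same_facet_refl|exact: same_facet_sym|exact: same_facet_trans|].
move=> p ps; rewrite sum_class// (@eq_fint _ _ _ _ _ (fun=> 0)).
  by rewrite /fint Rintegral_cst ?mul0r//; exact: measurable_reference.
by move=> x px; rewrite j0// mul0r.
Qed.

End flux_classes.

(** * Divergence of the reconstruction *)

Section commutation.
Context {R : realType} {n : nat}.
Local Notation point := 'rV[R]_n.+1.
Local Notation cell := 'M[R]_(n.+2, n.+1).
Local Notation mu := (@lebesgue_rV R).

Lemma L2_patch (A D : set point) f : measurable A -> measurable D -> L2 A f ->
  L2 D (fun x => if x \in A then f x else 0).
Proof.
move=> mA mD [mf f2]; apply: (L2S measurableT mD (@subsetT _ D)).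
split; first by apply/(measurable_restrictT f mA).
move: f2; rewrite integrable_mkcond//; apply: eq_integrable => // x _.
by rewrite /patch; case: ifP; rewrite ?expr0n.
Qed.

Lemma H1_Hdiv (D : set point) (v : point -> point) : measurable D -> bounded_set D ->
  (forall i, H1 D (component v i)) -> Hdiv D v.
Proof.
move=> mD bD h; split; first by move=> i; have [] := h i.
have [g hg] := choice (fun i => (h i).2 i).
exists (fun x => \sum_i g i x); split; first by apply: L2_sum => // i; have [] := hg i.
move=> phi Cphi; have Cphi1 := C1c_C1 Cphi; have [_ cphi] := Cphi1.
have Lv i : L2 D (component v i) by have [] := h i.
transitivity (\sum_i \int[mu n.+1]_(x in D) (component v i x * partial i phi x)).
  rewrite -(@Rintegral_sum R n.+1 D _ _ (fun i x => component v i x * partial i phi x))//.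
    by apply: eq_Rintegral => x _; apply: eq_bigr => i _; rewrite mxE.
  by move=> i; apply: L2_integrableM => //; exact: L2_cont.
rewrite (eq_bigr (fun i => - \int[mu n.+1]_(x in D) (g i x * phi x))); last first.
  by move=> i _; have [_ ->] := hg i.
rewrite sumrN -(@Rintegral_sum R n.+1 D _ _ (fun i x => g i x * phi x))//.
  by congr (- _); apply: eq_Rintegral => x _; rewrite mulr_suml.
by move=> i; apply: C1c_integrableM => //; have [] := hg i.
Qed.

(** Traces are tested with compactly supported functions; multiplication by [chi] makes polynomials
    admissible without changing them on the domain. *)
Lemma bounded_cutoff (D : set point) : bounded_set D -> exists2 chi : point -> R, C1c setT chi &
  forall x, D x -> chi x = 1 /\ forall i, partial i chi x = 0.
Proof.
move=> bD; have [e e0 De] := bounded_sub_ball bD; have [chi Cchi hchi] := @cutoff_exists R n e e0.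
by exists chi => // x /De/hchi.
Qed.

(** A multiplier is a polynomial on the open facet only; this suffices for the face moments to
    transfer its pairing from the trace of [v] to that of [w]. *)
Lemma sint_moment_eq (T : cell) (d : nat) (v w : point -> point) (g h : 'I_n.+2 -> point -> R) j
    (l p : point -> R) : edges T \in unitmx ->
  normal_trace T v h -> normal_trace T w g ->
  (forall f, normal_trace T (fun x => w x - v x) f ->
     forall j q, Pk d q -> sint (face T j) (fun x => f j x * q x) = 0) ->
  Pk d p -> (forall x, osimplex (face T j) x -> l x = p x) ->
  sint (face T j) (fun x => h j x * l x) = sint (face T j) (fun x => g j x * l x).
Proof.
move=> uT hv hw hm Pp lp.
have := hm _ (normal_traceB uT hw hv) j p Pp.
have [_ Lh _] := hv; have [_ Lg _] := hw.
have cp : continuous (fun t => p (chart (face T j) t)).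
  by apply: continuous_chart_comp; exact: continuous_Pk Pp.
have mr := @measurable_reference R n.
have Lp : L2 (@reference R n) (fun t => p (chart (face T j) t)).
  by apply: L2_cont => //; exact: bounded_reference.
rewrite !sintE => /eqP; rewrite mulf_eq0 (negbTE (garea_neq0 j uT)) /= => /eqP H.
congr (_ * _); rewrite (@eq_fint _ _ _ _ _ (fun x => h j x * p x)); last by move=> x /lp ->.
rewrite [RHS](@eq_fint _ _ _ _ _ (fun x => g j x * p x)); last by move=> x /lp ->.
apply/eqP; rewrite eq_sym -subr_eq0 -H /fint -RintegralB//.
- by apply/eqP; apply: eq_Rintegral => t _; rewrite mulrBl.
- exact: (L2_integrableM mr (Lg j) Lp).
- exact: (L2_integrableM mr (Lh j) Lp).
Qed.

(** Integration by parts leaves face terms, killed by the face moments, and (u, grad p), killed by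
    the cell moments since [grad p] has degree at most [d]. With d = k - 2 this accounts for both
    degrees in the definition of the operator. *)
Lemma moments_div (T : cell) (d : nat) (u : point -> point) (du q p : point -> R)
    (h : 'I_n.+2 -> point -> R) : edges T \in unitmx ->
  (forall i, L2 (osimplex T) (component u i)) -> weak_div (osimplex T) u du ->
  normal_trace T u h ->
  (forall j q, Pk d.+1 q -> sint (face T j) (fun x => h j x * q x) = 0) ->
  (forall psi, vPk d psi -> \int[mu n.+1]_(x in osimplex T) dot (u x) (psi x) = 0) ->
  Pk d.+1 p -> (forall x, osimplex T x -> q x = p x) ->
  \int[mu n.+1]_(x in osimplex T) (du x * q x) = 0.
Proof.
move=> uT Lu hu [_ _ hT] hj hpsi Pp qp.
have [chi Cchi chi1] := bounded_cutoff (@bounded_simplex R n _ T).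
have Cp := C1_Pk Pp; have Cphi := C1c_mull Cp Cchi.
have phiE x : simplex T x -> p x * chi x = p x by move=> /chi1[-> _]; rewrite mulr1.
have := hT _ Cphi; rewrite (normal_pairingE (open_osimplex uT) (bounded_osimplex T) Lu hu (C1c_C1 Cphi)).
rewrite big1 => [|j _]; last first.
  rewrite -(hj j p Pp) !sintE; congr (_ * _); apply: eq_fint => x xj.
  by rewrite phiE//; apply: (@simplex_face_sub _ _ T j); exact: osimplex_sub.
rewrite (_ : \int[_]_(x in _) dot _ _ = 0).
  rewrite add0r => <-; apply: eq_Rintegral => x /set_mem xT.
  by rewrite phiE ?qp//; exact: osimplex_sub.
rewrite -[RHS](hpsi (grad p)); last first.
  move=> i; have := Pk_partial i Pp; congr (Pk d _).
  by apply/funext => x; rewrite /component mxE.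
apply: eq_Rintegral => x /set_mem xT; congr dot; apply/rowP => i; rewrite !mxE.
have [c1 c2] := chi1 x (osimplex_sub xT).
rewrite partialM; [|by case: Cp|by case: (C1c_C1 Cchi)].
by rewrite c1 c2 mulr0 add0r mul1r.
Qed.

Lemma commute_div (D : set point) (s : seq cell) (d : nat) (v w : point -> point)
    (h : cell -> 'I_n.+2 -> point -> R) q : mesh D s -> Hdiv D v -> Hdiv D w ->
  (forall T, T \in s -> normal_trace T (fun x => w x - v x) (h T) /\
    forall j q, Pk d.+1 q -> sint (face T j) (fun x => h T j x * q x) = 0) ->
  (forall T, T \in s ->
    forall psi, vPk d psi -> \int[mu n.+1]_(x in osimplex T) dot (w x - v x) (psi x) = 0) ->
  L2 D q -> broken s (Pk d.+1) q ->
  \int[mu n.+1]_(x in D) (wdiv D w x * q x) = \int[mu n.+1]_(x in D) (wdiv D v x * q x).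
Proof.
move=> Ds Hv Hw hT hpsi Lq bq; have mD := mesh_measurable Ds; have bD := mesh_bounded Ds.
have [Lv _] := Hv; have [Lw _] := Hw; have hv := Hdiv_wdiv Hv; have hw := Hdiv_wdiv Hw.
have Lu i : L2 D (component (fun x => w x - v x) i) by rewrite componentB; exact: L2B.
have hu := weak_divB mD bD Lw Lv hw hv.
have [Ldv _] := hv; have [Ldw _] := hw; have [Ldu _] := hu.
apply/eqP; rewrite -subr_eq0 -RintegralB//; [|exact: L2_integrableM|exact: L2_integrableM].
under eq_Rintegral do rewrite -mulrBl.
rewrite (Rintegral_mesh Ds); last exact: L2_integrableM Ldu Lq.
rewrite big_seq big1// => T Ts; have [p Pp qp] := bq T Ts; have [hT1 hT2] := hT T Ts.
have uT := mesh_unit Ds Ts; have mT := measurable_osimplex uT; have TD := mesh_osimplex_sub Ds Ts.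
apply: (moments_div uT _ _ hT1 hT2 (hpsi T Ts) Pp qp).
- by move=> i; exact: L2S (Lu i).
- exact: weak_divS hu.
Qed.

Lemma piecewise_ex (s : seq cell) (D : set point) (d : nat) (P : cell -> point -> R) : mesh D s ->
  (forall T, T \in s -> Pk d (P T)) ->
  exists q, [/\ L2 D q, broken s (Pk d) q & forall T x, T \in s -> osimplex T x -> q x = P T x].
Proof.
move=> Ds hP; have mD := mesh_measurable Ds; have bD := mesh_bounded Ds.
pose F T x := if (T \in s) && (x \in osimplex T) then P T x else 0.
have qE T x : T \in s -> osimplex T x -> \sum_(T' <- s) F T' x = P T x.
  move=> Ts xT; rewrite (bigD1_seq T)//=; last exact: mesh_uniq Ds.
  rewrite {1}/F Ts mem_set//= big1_seq ?addr0// => T' /andP[T'T T's].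
  rewrite /F T's memNset//= => xT'.
  by have : (osimplex T' `&` osimplex T) x by []; rewrite (mesh_disj Ds T's Ts T'T).
exists (fun x => \sum_(T <- s) F T x); split => //.
- apply: L2_sum => // T; rewrite /F; have [Ts|_] := boolP (T \in s); last exact: L2_0.
  have mT := measurable_osimplex (mesh_unit Ds Ts).
  have LP : L2 D (P T) by apply: L2_cont => //; exact: continuous_Pk (hP T Ts).
  by have := L2_patch mT mD (L2S mD mT (mesh_osimplex_sub Ds Ts) LP).
- by move=> T Ts; exists (P T); [exact: hP|move=> x; exact: qE].
Qed.

End commutation.

(** * Balance of fluxes across the interface *)

Section coupling.
Context {R : realType} {n : nat}.
Local Notation point := 'rV[R]_n.+1.
Local Notation cell := 'M[R]_(n.+2, n.+1).
Local Notation mu := (@lebesgue_rV R).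
Variables (Os Od : set point) (Ts Td : seq cell) (d : nat).
Hypotheses (ms : mesh Os Ts) (md : mesh Od Td) (disj : Os `&` Od = set0).
Hypothesis cs : conforming (Ts ++ Td).

Lemma closure_disj (A B : set point) : open A -> A `&` B = set0 -> forall x, closure B x -> ~ A x.
Proof.
move=> oA AB x Bx Ax; have [//|y [By Ay]] := Bx A; first exact: open_nbhs_nbhs.
by have : (A `&` B) y by []; rewrite AB.
Qed.

(** An open set misses the closure of a set disjoint from it, so a common point of the closures lies
    in neither domain. In this form the interface is visibly closed. *)
Lemma GammaE : Gamma Os Od = closure Os `&` closure Od.
Proof.
have /interior_id os := mesh_open ms; have /interior_id od := mesh_open md.
rewrite /Gamma /boundary os od; apply/seteqP; split=> x; first by move=> [[? _] [? _]].
move=> [xs xd]; split; split => //; first exact: closure_disj (mesh_open ms) disj _ xd.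
by apply: closure_disj (mesh_open md) _ _ xs; rewrite setIC.
Qed.

Lemma closed_Gamma : closed (Gamma Os Od).
Proof. by rewrite GammaE; apply: closedI; exact: closed_closure. Qed.

Lemma no_flux_outer (D : set point) w phi : boundary D `&` ~` outer Os Od D `<=` Gamma Os Od ->
  no_flux D (outer Os Od D) w -> C1c (~` Gamma Os Od) phi -> normal_pairing D w phi = 0.
Proof. by move=> h nf Cphi; apply: nf; apply: C1c_sub Cphi; exact: subsetC. Qed.

Lemma boundary_outer (D : set point) : boundary D `&` ~` outer Os Od D `<=` Gamma Os Od.
Proof. by move=> x [xD xo]; apply: contrapT => xG; apply: xo. Qed.

Let S := Ts ++ Td.

Lemma unit_cat T : T \in S -> edges T \in unitmx.
Proof. by rewrite mem_cat => /orP[] h; [apply: (mesh_unit ms)|apply: (mesh_unit md)]. Qed.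

Lemma mesh_cat_disj T : T \in Ts -> T \notin Td.
Proof.
move=> h; apply/negP => h'; have [] := proj1 cs.
by rewrite cat_uniq => /and3P[_ /hasPn/(_ T h')]; rewrite h.
Qed.

(** Such an [x] lies in a cell of the other domain, and by conformity the whole face is contained in
    that cell. Facets off the interface thus have relative interiors that miss it, as localisation
    requires. *)
Lemma in_Gamma_point T j x : T \in S -> osimplex (face T j) x -> Gamma Os Od x ->
  in_Gamma Os Od T j.
Proof.
move=> TS xj; rewrite GammaE /in_Gamma => -[xs xd]; apply/asboolP; rewrite GammaE.
have subs T' : T' \in Ts -> simplex T' `<=` closure Os by exact: mesh_simplex_closure.
have subd T' : T' \in Td -> simplex T' `<=` closure Od by exact: mesh_simplex_closure.
move: (TS); rewrite mem_cat => /orP[h|h].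
  have [T' T'd xT'] : exists2 T', T' \in Td & simplex T' x by move: xd; rewrite (mesh_covers md).
  have TT' : T != T' by apply: contraTneq T'd => <-; exact: mesh_cat_disj.
  have T'S : T' \in S by rewrite mem_cat T'd orbT.
  rewrite subsetI; split; first by apply: subset_trans (subs T h); exact: simplex_face_sub.
  apply: subset_trans (subd T' T'd); exact: (face_sub_simplex unit_cat cs TS T'S TT' xj xT').
have [T' T's xT'] : exists2 T', T' \in Ts & simplex T' x by move: xs; rewrite (mesh_covers ms).
have TT' : T != T' by apply: contraTneq h => ->; exact: mesh_cat_disj.
have T'S : T' \in S by rewrite mem_cat T's.
rewrite subsetI; split; last by apply: subset_trans (subd T h); exact: simplex_face_sub.
apply: subset_trans (subs T' T's); exact: (face_sub_simplex unit_cat cs TS T'S TT' xj xT').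
Qed.

Lemma flux_balance (vs vd ws wd : point -> point) gs gd :
  (forall T, T \in Ts -> normal_trace T vs (gs T)) ->
  (forall T, T \in Td -> normal_trace T vd (gd T)) ->
  (forall l, Lambdah Os Od Ts Td d.+2 l ->
    pairing_Gamma Os Od Ts gs l + pairing_Gamma Os Od Td gd l = 0) ->
  Upsh1 Os Od d.+2 Os Ts ws -> Upsh1 Os Od d.+2 Od Td wd ->
  (forall T, T \in Ts -> forall h, normal_trace T (fun x => ws x - vs x) h ->
     forall j q, Pk d.+1 q -> sint (face T j) (fun x => h j x * q x) = 0) ->
  (forall T, T \in Td -> forall h, normal_trace T (fun x => wd x - vd x) h ->
     forall j q, Pk d.+1 q -> sint (face T j) (fun x => h j x * q x) = 0) ->
  forall phi, C1c setT phi -> normal_pairing Os ws phi + normal_pairing Od wd phi = 0.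
Proof.
move=> hgs hgd hl [Hws bws nws] [Hwd bwd nwd] mss msd phi Cphi.
have [fs hfs] := broken_traces ms bws; have [fd hfd] := broken_traces md bwd.
(* The default 0 outside the mesh makes every [g T j] a polynomial, as the lemmas on [jump] ask for
   all pairs. *)
pose g T := if T \in Ts then fs T else if T \in Td then fd T else fun _ _ => 0.
have gsE T : T \in Ts -> g T = fs T by rewrite /g => ->.
have gdE T : T \in Td -> g T = fd T.
  move=> h; rewrite /g h; case: ifP => // h'.
  by have := mesh_cat_disj h'; rewrite h.
have Pg T j : Pk d.+1 (g T j).
  rewrite /g; case: ifP => [/hfs[]//|_]; case: ifP => [/hfd[]//|_]; exact: Pk_cst.
have FE psi : C1c setT psi -> normal_pairing Os ws psi + normal_pairing Od wd psi =
    \sum_(p <- facets S) facet_flux g psi p.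
  move=> Cpsi; have Cpsi1 := C1c_C1 Cpsi.
  rewrite (normal_pairing_mesh ms Hws Cpsi1) (normal_pairing_mesh md Hwd Cpsi1).
  rewrite -(sum_facets S (fun T j => facet_flux g psi (T, j)) (fun _ => xpredT)) big_cat/=.
  congr (_ + _); apply: eq_big_seq => T h.
    by have [_ [_ _ ->]] := hfs T h; rewrite // /facet_flux/= gsE.
  by have [_ [_ _ ->]] := hfd T h; rewrite // /facet_flux/= gdE.
rewrite FE//; apply: (sum_facet_flux0 unit_cat Pg); last exact: C1_continuous (C1c_C1 Cphi).
move=> p x pS px; have [pG|pG] := boolP (in_Gamma Os Od p.1 p.2); last first.
  (* Interior and outer facets are treated alike: a test function supported off the interface is
     admissible in both [no_flux] conditions. *)
  apply: (jump_local unit_cat cs Pg closed_Gamma _ pS px).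
    move=> psi Cpsi; rewrite -FE; last exact: C1c_sub Cpsi.
    by rewrite !(no_flux_outer (@boundary_outer _) _ Cpsi)// addr0.
  by move=> xG; move/negP: pG; apply; apply: in_Gamma_point xG => //; rewrite mem_facets in pS.
apply: (@jump_coupled _ _ S d.+1 g unit_cat cs Pg (fun q => in_Gamma Os Od q.1 q.2) p x _ _ pS px pG).
  by move=> q q' /asboolP h; rewrite /in_Gamma h.
move=> l hL; have := hl l; rewrite /pairing_Gamma => H.
rewrite -(sum_facets S (fun T j => facet_flux g l (T, j)) (in_Gamma Os Od)) big_cat/=.
rewrite -[RHS]H; last first.
  move=> T j TS TG; have := hL (T, j); rewrite mem_facets; exact.
(* The traces of the reconstruction are exchanged for those of [vs] and [vd], to which the coupling
   condition applies. *)
congr (_ + _); apply: eq_big_seq => T h; apply: eq_bigr => j jG.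
  have TS : T \in S by rewrite mem_cat h.
  have [|f Pf lf] := hL (T, j) _ jG; first by rewrite mem_facets.
  have [_ tf] := hfs T h.
  by rewrite /facet_flux/= gsE// (sint_moment_eq (unit_cat TS) (hgs T h) tf (mss T h) Pf lf).
have TS : T \in S by rewrite mem_cat h orbT.
have [|f Pf lf] := hL (T, j) _ jG; first by rewrite mem_facets.
have [_ tf] := hfd T h.
by rewrite /facet_flux/= gdE// (sint_moment_eq (unit_cat TS) (hgd T h) tf (msd T h) Pf lf).
Qed.

End coupling.

(** * Vanishing of the divergences and gluing of the two fields *)

Section divergence_free.
Context {R : realType} {n : nat}.
Local Notation point := 'rV[R]_n.+1.
Local Notation cell := 'M[R]_(n.+2, n.+1).
Local Notation mu := (@lebesgue_rV R).

Lemma bounded_setU (A B : set point) : bounded_set A -> bounded_set B -> bounded_set (A `|` B).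
Proof.
move=> bA bB; have [e e0 Ae] := bounded_sub_ball bA; have [f f0 Bf] := bounded_sub_ball bB.
apply: (@sub_bounded R n _ (ball 0 (e + f))); last exact: bounded_ball_rV.
move=> x [/Ae|/Bf]; apply: le_ball; first by rewrite lerDl ltW.
by rewrite lerDr ltW.
Qed.

Lemma domain_mesh sigma (Os Od : set point) (Ts Td : seq cell) : domain Os -> domain Od ->
  triangulation sigma Os Od Ts Td -> mesh Os Ts /\ mesh Od Td.
Proof.
move=> [[oOs _] bOs _ _ rOs] [[oOd _] bOd _ _ rOd] [uT [uniqT cT] covs covd].
move: uniqT; rewrite cat_uniq => /and3P[us _ ud].
split; constructor => //.
- by move=> T Th; have [] := uT T; rewrite // mem_cat Th.
- by move=> T T' Th T'h TT'; have [] := cT T T'; rewrite // mem_cat ?Th ?T'h.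
- by move=> T Th; have [] := uT T; rewrite // mem_cat Th orbT.
- by move=> T T' Th T'h TT'; have [] := cT T T'; rewrite // mem_cat ?Th ?T'h orbT.
Qed.

(** The chosen [wdiv] need not be piecewise polynomial; [q] replaces it under integrals and can
    serve as a discrete pressure. *)
Lemma broken_wdiv (D : set point) (s : seq cell) (d : nat) (w : point -> point) : mesh D s ->
  Hdiv D w -> broken s (RT d.+1) w ->
  exists q, [/\ L2 D q, broken s (Pk d.+1) q & forall f, L2 D f ->
    \int[mu n.+1]_(x in D) (wdiv D w x * f x) = \int[mu n.+1]_(x in D) (q x * f x)].
Proof.
move=> Ds Hw bw; have hw := Hdiv_wdiv Hw; have [Ldw _] := hw.
have mD := mesh_measurable Ds; have bD := mesh_bounded Ds.
have H T : exists p : point -> R, T \in s -> Pk d.+1 p /\ weak_div (osimplex T) w p.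
  have [Th|] := boolP (T \in s); last by exists (fun=> 0).
  have [p RTp wp] := bw T Th; have [hp _] := RT_normal_trace (mesh_unit Ds Th) RTp wp.
  by exists (cdiv p) => _; split => //; exact: Pk_cdiv_RT.
have [P hP] := choice H.
have [|q [Lq bq qP]] := @piecewise_ex R n s D d.+1 P Ds; first by move=> T /hP[].
exists q; split => // f Lf.
rewrite (Rintegral_mesh Ds (L2_integrableM mD Ldw Lf)) (Rintegral_mesh Ds (L2_integrableM mD Lq Lf)).
apply: eq_big_seq => T Th; have uT := mesh_unit Ds Th; have TD := mesh_osimplex_sub Ds Th.
have mT := measurable_osimplex uT; have [_ hpT] := hP T Th.
have hwT := weak_divS mD mT TD hw.
have ae := weak_div_ae (open_osimplex uT) (bounded_osimplex T) hwT hpT.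
have [mf _] := L2S mD mT TD Lf; have [mq _] := L2S mD mT TD Lq; have [[mw _] _] := hwT.
apply: ae_eq_Rintegral => //; [exact: measurable_funM|exact: measurable_funM|].
by apply: filterS ae => x hx xT; rewrite hx// (qP T).
Qed.

Lemma reconstruction_div (D : set point) (s : seq cell) (d : nat) (v w : point -> point) gv q :
  mesh D s -> Hdiv D v -> (forall T, T \in s -> normal_trace T v (gv T)) ->
  Hdiv D w -> broken s (RT d.+1) w ->
  (forall T, T \in s ->
    (forall psi, vPk d psi -> \int[mu n.+1]_(x in osimplex T) dot (w x - v x) (psi x) = 0) /\
    (forall g, normal_trace T (fun x => w x - v x) g ->
       forall j q, Pk d.+1 q -> sint (face T j) (fun x => g j x * q x) = 0)) ->
  L2 D q -> broken s (Pk d.+1) q ->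
  \int[mu n.+1]_(x in D) (wdiv D w x * q x) = \int[mu n.+1]_(x in D) (wdiv D v x * q x).
Proof.
move=> Ds Hv hv Hw bw hm Lq bq; have [gw hgw] := broken_traces Ds bw.
have hB T (Th : T \in s) := normal_traceB (mesh_unit Ds Th) (hgw T Th).2 (hv T Th).
apply: (@commute_div R n D s d v w (fun T j x => gw T j x - gv T j x)) => // T Th.
  by split; [exact: hB|exact: (hm T Th).2 _ (hB T Th)].
exact: (hm T Th).1.
Qed.

Lemma L2_sqr_orth (D : set point) (q f : point -> R) : measurable D -> L2 D q -> L2 D f ->
  \int[mu n.+1]_(x in D) (q x * q x) = 0 -> \int[mu n.+1]_(x in D) (q x * f x) = 0.
Proof.
move=> mD Lq Lf /(L2_sqr_eq0 mD Lq) h; have [mq _] := Lq; have [mf _] := Lf.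
rewrite (@ae_eq_Rintegral _ _ _ _ (fun=> 0)) ?Rintegral_cst ?mul0r//.
- exact: measurable_funM.
- by apply: filterS h => x hx Dx; rewrite hx// mul0r.
Qed.

(** Test functions on [Omega] may cross the interface, so only the sum over the two domains is asked
    to vanish. The pasted field is 0 off both domains, hence the rest of [Omega] contributes
    nothing. *)
Lemma paste_weak_div (Os Od : set point) (ws wd : point -> point) :
  open Os -> open Od -> bounded_set Os -> bounded_set Od -> Os `&` Od = set0 ->
  (forall i, L2 Os (component ws i)) -> (forall i, L2 Od (component wd i)) ->
  (forall phi, C1c setT phi -> \int[mu n.+1]_(x in Os) dot (ws x) (grad phi x) +
     \int[mu n.+1]_(x in Od) dot (wd x) (grad phi x) = 0) ->
  (forall i, L2 (Omega Os Od) (component (paste Os Od (ws, wd)) i)) /\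
  weak_div (Omega Os Od) (paste Os Od (ws, wd)) (cst 0).
Proof.
move=> os od bs bd disj Ls Ld h.
have ms := open_measurable_rV os; have md := open_measurable_rV od.
have oO : open (Omega Os Od) by exact: open_interior.
have mO := open_measurable_rV oO.
have sub : Os `|` Od `<=` Omega Os Od.
  by rewrite -open_subsetE; [exact: subset_closure|exact: openU].
have nd x : Os x -> ~ Od x by move=> xs xd; have : (Os `&` Od) x by []; rewrite disj.
have Lp (E : set point) i : measurable E -> L2 E (component (paste Os Od (ws, wd)) i).
  move=> mE; have := L2D mE (L2_patch ms mE (Ls i)) (L2_patch md mE (Ld i)).
  rewrite (_ : (fun x => _) = component (paste Os Od (ws, wd)) i)//.
  apply/funext => x; rewrite /component /paste /=.
  have [xs|xs] := boolP (x \in Os); first by rewrite memNset ?addr0//; exact/nd/set_mem.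
  by rewrite add0r; case: ifP; rewrite ?mxE.
split; first by move=> i; exact: Lp.
split; first exact: L2_0.
move=> phi Cphi; have CT := C1c_sub (@subsetT _ _) Cphi; have C1phi := C1c_C1 Cphi.
under [in RHS]eq_Rintegral do rewrite mul0r.
rewrite Rintegral_cst// mul0r oppr0 -[RHS](h _ CT).
have mU : measurable (Os `|` Od) by exact: measurableU.
rewrite -(C1c_Rintegral_sub mO mU sub); last first.
  move=> x xU; rewrite /paste !memNset; [|by move=> ?; apply: xU; right|by move=> ?; apply: xU; left].
  by rewrite /dot big1// => i _; rewrite mxE mul0r.
rewrite Rintegral_setU//.
- congr (_ + _); apply: eq_Rintegral => x xD; rewrite /paste; first by rewrite xD.
  by rewrite xD memNset// => /nd; apply; exact: set_mem.
- apply: (@dot_integrable R n _ (paste Os Od (ws, wd)) phi) => //; first exact: bounded_setU.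
  by move=> i; exact: Lp.
- by apply/disj_setPS => x [xs xd]; case: (nd x).
Qed.

End divergence_free.

Theorem lemma4p1 (R : realType) (n : nat) (hN : n.+1 = 2%N \/ n.+1 = 3%N)
  (Os Od : set 'rV[R]_n.+1) (hOs : domain Os) (hOd : domain Od)
  (hOsd : Os `&` Od = set0)
  (sigma : R) (Ts Td : seq 'M[R]_(n.+2, n.+1))
  (hT : triangulation sigma Os Od Ts Td)
  (k : nat) (hk : (2 <= k)%N)
  (m : nat) (bubble : 'I_m -> 'rV[R]_n.+1 -> 'rV[R]_n.+1)
  (hbubble : forall i, Vs Os Od (bubble i))
  (betas : R) (hbetas : 0 < betas) (hLBB : LBB Os Od Ts k betas bubble)
  (kappa : R) (hkappa : 0 < kappa) (hKorn : Korn Os Od Ts k kappa bubble)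
  (Qhd : set ('rV[R]_n.+1 -> R))
  (hQhd : forall q, Qhd q -> L2 Od q /\ broken Td (Pk k.-1) q)
  (hdiv : div_onto Os Od Td k Qhd)
  (beta : R) (hbeta : 0 < beta)
  (hinfsup : coupled_inf_sup Os Od Ts Td k beta bubble Qhd)
  (Pis Pid : ('rV[R]_n.+1 -> 'rV[R]_n.+1) -> 'rV[R]_n.+1 -> 'rV[R]_n.+1)
  (hPis : reconstruction Os Od k Os Ts (Vs Os Od) Pis)
  (hPid : reconstruction Os Od k Od Td (Vd Os Od) Pid) :
  [set (Pis v.1, Pid v.2) | v in Vh0 Os Od Ts Td k bubble Qhd]
  `<=` Upsh Os Od Ts Td k `&` Upsilon Os Od.
Proof.
have [ms md] := domain_mesh hOs hOd hT; have [_ cT _ _] := hT.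
(* With [k] written as [d.+2], pressures and normal traces have degree [d.+1] and cell moments
   degree [d]. *)
case: k hk hLBB hKorn hQhd hdiv hinfsup hPis hPid => [//|[//|d]] _ _ _ hQhd hdiv _ hPis hPid.
move=> _ [[vs vd] [[[Vvs _] Vvd [gs [gd [hgs hgd hl]]]] hb] <-] /=.
have [Uws mws] := hPis _ Vvs; have Vd_vd : Vd Os Od vd by case: Vvd.
have [Uwd mwd] := hPid _ Vd_vd.
move: (Pis vs) (Pid vd) Uws mws Uwd mwd => ws wd Uws mws Uwd mwd {hPis hPid}.
rewrite !subSS subn0 /= in mws mwd.
have Ms := mesh_measurable ms; have Md := mesh_measurable md.
have Bs := mesh_bounded ms; have Bd := mesh_bounded md.
have [Hws bws nws] := Uws; have [Hwd bwd nwd] := Uwd.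
have Hvs : Hdiv Os vs by apply: H1_Hdiv => // i; have [] := Vvs i.
have [Hvd _ _] := Vvd.
have L1 f (D : set 'rV[R]_n.+1) : measurable D -> bounded_set D -> C1 f -> L2 D f.
  by move=> mD bD Cf; apply: L2_cont => //; exact: C1_continuous.
have Q0 : Qhs Os Ts d.+2 (fun=> 0).
  split; [exact: L2_0|by move=> T _; exists (fun=> 0) => //; exact: Pk_cst|].
  by rewrite Rintegral_cst// mul0r.
(* The pressure pair (0, q) isolates the part of [b_form] on [Od]. *)
have bd q : Qhd q -> \int[lebesgue_rV n.+1]_(x in Od) (wdiv Od vd x * q x) = 0.
  move=> Qq; have := hb (fun=> 0, q) (conj Q0 Qq); rewrite /b_form/=.
  under eq_Rintegral do rewrite mulr0.
  by rewrite Rintegral_cst// mul0r oppr0 sub0r => /eqP; rewrite oppr_eq0 => /eqP.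
have div_wd f : L2 Od f -> \int[lebesgue_rV n.+1]_(x in Od) (wdiv Od wd x * f x) = 0.
  (* [wd] itself belongs to [Vhd], so its divergence has a representative [q] in [Qhd]; tested
     against itself, [q] has zero L^2 norm. *)
  move=> Lf; have [q Qq hq] := hdiv.1 wd Uwd; have [Lq bq] := hQhd q Qq.
  rewrite (wdiv_integral (mesh_open md) Bd hq Lf); apply: L2_sqr_orth => //.
  rewrite -(wdiv_integral (mesh_open md) Bd hq Lq).
  by rewrite (reconstruction_div md Hvd hgd Hwd bwd mwd Lq bq) bd.
have balance := flux_balance ms md hOsd cT hgs hgd hl Uws Uwd
  (fun T h => (mws T h).2) (fun T h => (mwd T h).2).
have mean_ws : \int[lebesgue_rV n.+1]_(x in Os) wdiv Os ws x = 0.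
  (* Where [chi] is 1 its gradient vanishes, so the balance reduces to the sum of the two mean
     divergences, the second of which is already 0. *)
  have [chi Cchi chi1] := bounded_cutoff (bounded_setU Bs Bd).
  have := balance chi Cchi; have C1chi := C1c_C1 Cchi.
  have dot0 (D : set 'rV[R]_n.+1) w : measurable D -> D `<=` Os `|` Od ->
      \int[lebesgue_rV n.+1]_(x in D) dot (w x) (grad chi x) = 0.
    move=> mD DU; transitivity (\int[lebesgue_rV n.+1]_(x in D) (0 : R)).
      apply: eq_Rintegral => x /set_mem/DU/chi1[_ c0].
      by rewrite /dot big1// => i _; rewrite mxE c0 mulr0.
    by rewrite Rintegral_cst// mul0r.
  have [Lws _] := Hws; have [Lwd _] := Hwd.
  rewrite (normal_pairingE (mesh_open ms) Bs Lws (Hdiv_wdiv Hws) C1chi).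
  rewrite (normal_pairingE (mesh_open md) Bd Lwd (Hdiv_wdiv Hwd) C1chi).
  rewrite div_wd; last exact: L1.
  rewrite !dot0 ?addr0 ?add0r; [|exact: Md|exact: subsetUr|exact: Ms|exact: subsetUl].
  by move=> <-; apply: eq_Rintegral => x xs; rewrite (chi1 x _).1 ?mulr1//; left; exact: set_mem.
have div_ws f : L2 Os f -> \int[lebesgue_rV n.+1]_(x in Os) (wdiv Os ws x * f x) = 0.
  move=> Lf; have [q [Lq bq hq]] := broken_wdiv ms Hws bws.
  rewrite hq//; apply: L2_sqr_orth => //; rewrite -hq//.
  rewrite (reconstruction_div ms Hvs hgs Hws bws mws Lq bq).
  (* Any element of [Qhd] completes the pressure pair, since its contribution is 0 by [bd]. *)
  have [q0 Qq0 _] := hdiv.1 vd Vvd.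
  have Qq : Qhs Os Ts d.+2 q.
    split => //; rewrite -[RHS]mean_ws.
    have := hq (fun=> 1) (L1 _ _ Ms Bs (C1_cst 1)).
    by under eq_Rintegral do rewrite mulr1; under [in RHS]eq_Rintegral do rewrite mulr1.
  have := hb (q, q0) (conj Qq Qq0); rewrite /b_form/= bd// subr0.
  by move=> /eqP; rewrite oppr_eq0 => /eqP.
have dot0 phi : C1c setT phi -> \int[lebesgue_rV n.+1]_(x in Os) dot (ws x) (grad phi x) +
    \int[lebesgue_rV n.+1]_(x in Od) dot (wd x) (grad phi x) = 0.
  move=> Cphi; have C1phi := C1c_C1 Cphi; rewrite -[RHS](balance phi Cphi).
  rewrite (normal_pairingE (mesh_open ms) Bs Hws.1 (Hdiv_wdiv Hws) C1phi).
  rewrite (normal_pairingE (mesh_open md) Bd Hwd.1 (Hdiv_wdiv Hwd) C1phi).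
  by rewrite div_ws ?div_wd ?addr0//; exact: L1.
have [Lp wp] := paste_weak_div (mesh_open ms) (mesh_open md) Bs Bd hOsd Hws.1 Hwd.1 dot0.
split; first by split.
split => //; first by split => //; exists (cst 0).
by move=> phi Cphi; apply: balance; exact: C1c_sub Cphi.
Qed.
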